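(* Let $(M,\mathbf{g})$ be a relativistic spacetime, let $U$ be an open subset of $M$, and let $\pi:O^+M\to M$ be the positive connected component of the orthonormal frame bundle over $(M,\mathbf{g})$. Suppose there exists a curve $\gamma:[0,a)\to M$ (with $0<a\le\infty$) with finite generalised affine length and no endpoint in $M$, whose image is contained in $U$, and let $\{t_n\}_{n\in\mathbb{N}}$ be a sequence in $[0,a)$ such that $t_n\to a$ as $n\to\infty$. Then there exists a sequence $\{\tilde V_n\}_{n\in\mathbb{N}}$ of open subsets of $O^+M$ such that, for every natural distance function $d$ on $O^+M$: (i) each $\tilde V_n$ is bounded with respect to $d$, and the closure $\mathrm{cl}(\tilde V_n)$ of $\tilde V_n$ in $O^+M$ is Cauchy incomplete with respect to (the restriction of) $d$; (ii) for each $n$, $V_n:=\pi(\tilde V_n)$ is a ($b$-incomplete) singular region of $(M,\mathbf{g})$ which contains the image of $\gamma|_{[t_n,a)}$; (iii) the diameter of $\tilde V_n$ with respect to $d$ tends to zero as $n\to\infty$.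
   Context: A (relativistic) spacetime is a pair $(M,\mathbf{g})$ where $M$ is a connected, Hausdorff, smooth $4$-manifold and $\mathbf{g}$ is a smooth Lorentz metric of signature $(3,1)$; it is assumed throughout to be time- and space-orientable, with orientations fixed. Curves and $b$-incompleteness. Curves $\gamma:[0,a)\to M$, $0<a\le\infty$, are $C^1$. Given a basis $\{\mathbf{e}_i\}_{1\le i\le 4}$ of $T_{\gamma(0)}M$, extend it along $\gamma$ by parallel transport with respect to the Levi-Civita connection of $\mathbf{g}$, and write the tangent vector of $\gamma$ at $\gamma(t)$ as $\sum_i V^i(t)\,\mathbf{e}_i|_{\gamma(t)}$. The generalised affine parameter relative to this basis is $\lambda(t)=\int_0^t\left(\sum_i V^i(t')^2\right)^{1/2}dt'$, and the generalised affine length of $\gamma$ is $\lim_{t\to a}\lambda(t)$; whether it is finite does not depend on the chosen basis. A point $p\in M$ is an endpoint of $\gamma$ if for every neighbourhood $N$ of $p$ there is $t\in[0,a)$ with $\gamma(t')\in N$ for all $t'>t$. The curve $\gamma$ is $b$-incomplete if it has finite generalised affine length and no endpoint in $M$. A ($b$-incomplete) singular region of $(M,\mathbf{g})$ is an open connected subset of $M$ that contains the image of some $b$-incomplete curve $[0,a')\to M$, $0<a'\le\infty$. Frame bundles and natural distance functions. $FM\to M$ is the frame bundle (pairs $(p,\{\mathbf{e}_i\})$ with $\{\mathbf{e}_i\}$ a basis of $T_pM$), a principal $GL(4,\mathbb{R})$-bundle. $\pi:O^+M\to M$ is the connected bundle of $\mathbf{g}$-orthonormal, oriented and time-oriented frames,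 a principal bundle with structure group $SO^+(3,1)$ (the identity component of $O(3,1)$). Let $\omega$ be the $\mathfrak{gl}(4,\mathbb{R})$-valued connection one-form of the Levi-Civita connection on the frame bundle, and $\theta$ the canonical $\mathbb{R}^4$-valued one-form ($\theta_u(\mathbf{X})$ is the coordinate vector of $d\pi_u(\mathbf{X})$ in the frame $u$). For any choice of Euclidean (positive definite) inner products on $\mathfrak{gl}(4,\mathbb{R})$ and $\mathbb{R}^4$, put $\mathbf{h}(\mathbf{X},\mathbf{Y})|_u=\langle\omega_u(\mathbf{X}),\omega_u(\mathbf{Y})\rangle_{\mathfrak{gl}(4,\mathbb{R})}+\langle\theta_u(\mathbf{X}),\theta_u(\mathbf{Y})\rangle_{\mathbb{R}^4}$. The restriction (pullback) of $\mathbf{h}$ to $O^+M$ is a Riemannian metric, called a natural metric on $O^+M$; the associated Riemannian distance function (infimum of lengths of curves in the connected manifold $O^+M$) is called a natural distance function on $O^+M$. A subset of $O^+M$ is Cauchy incomplete with respect to $d$ if, with the restricted distance, it is not a complete metric space. *)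

(* Defs.v *)
(* Vectors are rows: linear maps and changes of coordinates act by multiplication on
   the right. *)
From HB Require Import structures.
From mathcomp Require Import all_boot all_order all_algebra.
From mathcomp Require Import all_classical all_reals all_analysis.
From mathcomp Require Import sesquilinear.

Set Implicit Arguments.
Unset Strict Implicit.
Unset Printing Implicit Defensive.

Import Order.TTheory GRing.Theory Num.Theory.
Import numFieldNormedType.Exports.

Local Open Scope classical_set_scope.
Local Open Scope ring_scope.

Section Calculus.
Context {R : realType}.

Fixpoint Ck (k : nat) (V : normedModType R) (A : set 'rV[R]_4)
    (f : 'rV[R]_4 -> V) : Prop :=
  match k with
  | 0 => {within A, continuous f}
  | k'.+1 => (forall x, A x -> differentiable f x) /\
             (forall v : 'rV[R]_4, Ck k' A ('D_v f))
  end.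

(* Only used for open [A]. *)
Definition smooth_on (V : normedModType R) (A : set 'rV[R]_4)
    (f : 'rV[R]_4 -> V) : Prop := forall k, Ck k A f.

(* Derivative relative to a nondegenerate interval [D]: one-sided at the
   endpoints belonging to [D], and independent of the values of [f] off [D]. *)
Definition diff_quot (V : normedModType R) (f : R -> V) (t s : R) : V :=
  (s - t)^-1 *: (f s - f t).

Definition deriv_within (V : normedModType R) (D : set R) (f : R -> V) (t : R) : V :=
  lim (diff_quot f t s @[s --> within D t^']).

Definition C1_within_at (V : normedModType R) (D : set R) (f : R -> V) (t : R) : Prop :=
  cvg (diff_quot f t s @[s --> within D t^']) /\
  deriv_within D f s @[s --> within D (nbhs t)] --> deriv_within D f t.

End Calculus.

(* Nothing below depends on which atlas of the smooth structure is chosen, nor on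
   the choice of [chart_at]; second countability is not assumed. *)
Record manifold4 (R : realType) := Manifold4 {
  mcarrier :> topologicalType;
  mhausdorff : hausdorff_space mcarrier;
  mconnected : connected [set: mcarrier];
  chart : Type;
  chart_dom : chart -> set mcarrier;
  chart_map : chart -> mcarrier -> 'rV[R]_4;
  chart_inv : chart -> 'rV[R]_4 -> mcarrier;
  chart_dom_open : forall c, open (chart_dom c);
  chart_range_open : forall c, open (chart_map c @` chart_dom c);
  chart_mapK : forall c p, chart_dom c p -> chart_inv c (chart_map c p) = p;
  chart_map_continuous : forall c, {within chart_dom c, continuous (chart_map c)};
  chart_inv_continuous : forall c, {within chart_map c @` chart_dom c, continuous (chart_inv c)};
  transition_smooth : forall c c',
    smooth_on (chart_map c @` (chart_dom c `&` chart_dom c')) (chart_map c' \o chart_inv c);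
  chart_at : mcarrier -> chart;
  chart_atP : forall p, chart_dom (chart_at p) p }.

(* T_pM is R^4, a tangent vector at p being represented by its components in the
   chart [chart_at p].  [tchange c p] turns these into components in the chart c
   (v |-> v *m tchange c p), for p in the domain of c. *)
Definition tchange (R : realType) (M : manifold4 R) (c : chart M) (p : M) : 'M[R]_4 :=
  jacobian (chart_map c \o chart_inv (chart_at p)) (chart_map (chart_at p) p).

Definition minkowski (R : realType) : 'M[R]_4 :=
  diag_mx (\row_(j < 4) if j == ord_max then -1 else 1).

(* [metric p] is the Gram matrix of g on T_pM.  The time orientation is given by a
   continuous timelike vector field, the orientation by a continuous nowhere
   vanishing 4-form, whose value on a frame with component matrix E at p is
   [orientation p * \det E].  Given the time orientation, an orientation is the same
   thing as a space orientation. *)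
Record spacetime (R : realType) := Spacetime {
  smanifold :> manifold4 R;
  metric : smanifold -> 'M[R]_4;
  time_field : smanifold -> 'rV[R]_4;
  orientation : smanifold -> R;
  metric_sym : forall p, (metric p)^T = metric p;
  metric_lorentz : forall p,
    exists2 P : 'M[R]_4, P \in unitmx & P *m metric p *m P^T = minkowski R;
  metric_smooth : forall c : chart smanifold,
    smooth_on (chart_map c @` chart_dom c)
      (fun x => let p := chart_inv c x in
         invmx (tchange c p) *m metric p *m (invmx (tchange c p))^T);
  time_field_timelike : forall p,
    (time_field p *m metric p *m (time_field p)^T) 0 0 < 0;
  time_field_continuous : forall c : chart smanifold,
    {within chart_dom c, continuous (fun p => time_field p *m tchange c p)};
  orientation_neq0 : forall p, orientation p != 0;
  orientation_continuous : forall c : chart smanifold,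
    {within chart_dom c, continuous (fun p => orientation p / \det (tchange c p))} }.

Section FrameBundle.
Context {R : realType} (S : spacetime R).

(* Row i of [fmat] is the vector e_i of the frame. *)
Record frame := Frame {
  fpt : S;
  fmat : 'M[R]_4;
  fmat_unit : fmat \in unitmx }.

HB.instance Definition _ := gen_eqMixin frame.
HB.instance Definition _ := gen_choiceMixin frame.

Definition fcomp (c : chart S) (u : frame) : 'M[R]_4 := fmat u *m tchange c (fpt u).

(* The chart of FM over [chart_dom c], with values in R^4 x GL(4,R). *)
Definition frame_coord (c : chart S) (u : frame) : ('rV[R]_4 * 'M[R]_4)%type :=
  (chart_map c (fpt u), fcomp c u).

(* The manifold topology of FM: W is open when its image in each of these charts is. *)
Definition frame_open (W : set frame) : Prop :=
  forall (c : chart S) (u : frame), W u -> chart_dom c (fpt u) ->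
    \forall z \near frame_coord c u,
      forall u', chart_dom c (fpt u') -> frame_coord c u' = z -> W u'.

Lemma frame_openT : frame_open setT.
Proof. by move=> c u _ _; near=> z. Unshelve. all: by end_near. Qed.

Lemma frame_openI : setI_closed frame_open.
Proof.
move=> A B oA oB c u [Au Bu] cu.
have hA := oA c u Au cu; have hB := oB c u Bu cu.
apply: filterS2 hA hB => z zA zB u' cu' e; split; [exact: zA | exact: zB].
Qed.

Lemma frame_open_bigU (I : Type) (f : I -> set frame) :
  (forall i, frame_open (f i)) -> frame_open (\bigcup_i f i).
Proof.
move=> of_ c u [i _ fiu] cu; have h := of_ i c u fiu cu.
by apply: filterS h => z zA u' cu' e; exists i => //; exact: zA.
Qed.

HB.instance Definition _ :=
  isOpenTopological.Build frame frame_openT frame_openI frame_open_bigU.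

(* Orthonormal (e_4 is the timelike vector), oriented and time-oriented frames; with
   signature (3,1), e_4 lies in the cone of the time field when their product is
   negative.  As the type associated to a set, [OplusM] carries the subspace
   topology. *)
Definition positive_frame : set frame := [set u |
  [/\ fmat u *m metric (fpt u) *m (fmat u)^T = minkowski R,
      0 < orientation (fpt u) * \det (fmat u) &
      (row ord_max (fmat u) *m metric (fpt u) *m (time_field (fpt u))^T) 0 0 < 0]].

Definition OplusM : topologicalType := set_type positive_frame.

Definition Oframe (u : OplusM) : frame := set_val u.

Definition Opi (u : OplusM) : S := fpt (Oframe u).

Section Connection.
Variables (c : chart S) (x : 'rV[R]_4).

Definition metric_in (y : 'rV[R]_4) : 'M[R]_4 :=
  let p := chart_inv c y in
  invmx (tchange c p) *m metric p *m (invmx (tchange c p))^T.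

Definition dmetric (i : 'I_4) : 'M[R]_4 := 'D_(delta_mx 0 i) metric_in x.

(* [christoffel i j k] is Gamma^k_{ij}. *)
Definition christoffel (i j k : 'I_4) : R :=
  2^-1 * \sum_(l < 4) invmx (metric_in x) k l *
    (dmetric i l j + dmetric j i l - dmetric l i j).

Definition christoffel_mx (xi : 'rV[R]_4) : 'M[R]_4 :=
  \matrix_(j, k) \sum_(i < 4) xi 0 i * christoffel i j k.

End Connection.

(* A tangent vector X of FM at u is given by its components in the chart of FM
   over [chart_at (fpt u)]: X.1 are those of its projection to T_pM, X.2 those of the
   variation of the frame. *)
Definition frame_tangent : Type := ('rV[R]_4 * 'M[R]_4)%type.

Definition frame_components (u : frame) (v : 'rV[R]_4) : 'rV[R]_4 :=
  v *m invmx (fmat u).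

Definition theta (u : frame) (X : frame_tangent) : 'rV[R]_4 := frame_components u X.1.

(* The Levi-Civita connection form: nabla_X e_i = \sum_j omega^j_i(X) e_j, with
   omega^j_i in row j and column i. *)
Definition omega (u : frame) (X : frame_tangent) : 'M[R]_4 :=
  let c := chart_at (fpt u) in
  ((X.2 + fmat u *m christoffel_mx c (chart_map c (fpt u)) X.1) *m invmx (fmat u))^T.

(* Curves are total functions on R; only their values on the interval D matter. *)
Definition C1_curve (D : set R) (gamma : R -> S) : Prop :=
  {within D, continuous gamma} /\
  forall (c : chart S) t, D t -> chart_dom c (gamma t) -> C1_within_at D (chart_map c \o gamma) t.

Definition velocity (D : set R) (gamma : R -> S) (t : R) : 'rV[R]_4 :=
  deriv_within D (chart_map (chart_at (gamma t)) \o gamma) t.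

Definition C1_frame_curve (D : set R) (u : R -> frame) : Prop :=
  C1_curve D (fpt \o u) /\
  forall (c : chart S) t, D t -> chart_dom c (fpt (u t)) -> C1_within_at D (fcomp c \o u) t.

Definition frame_velocity (D : set R) (u : R -> frame) (t : R) : frame_tangent :=
  (velocity D (fpt \o u) t, deriv_within D (fcomp (chart_at (fpt (u t))) \o u) t).

Definition parallel_frame (D : set R) (gamma : R -> S) (e : R -> frame) : Prop :=
  [/\ forall t, D t -> fpt (e t) = gamma t,
      C1_frame_curve D e &
      forall t, D t -> omega (e t) (frame_velocity D e t) = 0].

Definition ico (s : R) (a : \bar R) : set R := [set t | s <= t /\ (t%:E < a)%E].

Definition gen_affine_param (a : \bar R) (gamma : R -> S) (e : R -> frame) (t : R) : \bar R :=
  (\int[lebesgue_measure]_(s in `[0%R, t])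
    (Num.sqrt (\sum_(i < 4)
      (frame_components (e s) (velocity (ico 0 a) gamma s)) 0 i ^+ 2))%:E)%E.

(* Finiteness does not depend on the basis at gamma(0), i.e. on the parallel frame e. *)
Definition finite_gen_affine_length (a : \bar R) (gamma : R -> S) : Prop :=
  exists2 e : R -> frame, parallel_frame (ico 0 a) gamma e &
    exists l : R,
      gen_affine_param a gamma e (fine x)
        @[x --> within [set x : \bar R | (0 <= x < a)%E] (nbhs a)] --> l%:E.

Definition endpoint (a : \bar R) (gamma : R -> S) (p : S) : Prop :=
  forall N : set S, nbhs p N ->
    exists2 t, ico 0 a t & forall t', ico 0 a t' -> t < t' -> N (gamma t').

Definition b_incomplete (a : \bar R) (gamma : R -> S) : Prop :=
  finite_gen_affine_length a gamma /\ ~ (exists p, endpoint a gamma p).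

Definition singular_region (V : set S) : Prop :=
  [/\ open V, connected V &
      exists (a : \bar R) (gamma : R -> S),
        [/\ (0 < a)%E, C1_curve (ico 0 a) gamma, b_incomplete a gamma &
            gamma @` ico 0 a `<=` V]].

Definition natural_metric (bgl : {dot 'M[R]_4 for idfun}) (bR : {dot 'rV[R]_4 for idfun})
    (u : frame) (X Y : frame_tangent) : R :=
  bgl (omega u X) (omega u Y) + bR (theta u X) (theta u Y).

Definition natural_length (bgl : {dot 'M[R]_4 for idfun}) (bR : {dot 'rV[R]_4 for idfun})
    (s t : R) (u : R -> OplusM) : \bar R :=
  (\int[lebesgue_measure]_(r in `[s, t])
    (let X := frame_velocity `[s, t]%classic (Oframe \o u) r in
     Num.sqrt (natural_metric bgl bR (Oframe (u r)) X X))%:E)%E.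

(* The infimum is taken in \bar R, where it is +oo for the empty set; by connectedness
   of O+M all the values are in fact finite. *)
Definition natural_dist (bgl : {dot 'M[R]_4 for idfun}) (bR : {dot 'rV[R]_4 for idfun})
    (x y : OplusM) : \bar R :=
  ereal_inf [set l | exists s t (u : R -> OplusM),
    [/\ s < t, C1_frame_curve `[s, t]%classic (Oframe \o u), u s = x, u t = y &
        l = natural_length bgl bR s t u]].

Definition natural_distance_function (d : OplusM -> OplusM -> \bar R) : Prop :=
  exists (bgl : {dot 'M[R]_4 for idfun}) (bR : {dot 'rV[R]_4 for idfun}),
    d = natural_dist bgl bR.

End FrameBundle.

Section Distance.
Context {R : realType} {T : Type} (d : T -> T -> \bar R).

Definition dist_bounded (A : set T) : Prop :=
  exists r : R, forall x y, A x -> A y -> (d x y <= r%:E)%E.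

Definition dist_diam (A : set T) : \bar R :=
  ereal_sup [set d x y | x in A & y in A].

Definition dist_cauchy (x_ : nat -> T) : Prop :=
  forall e : R, 0 < e ->
    exists N : nat, forall m n, (N <= m)%N -> (N <= n)%N -> (d (x_ m) (x_ n) < e%:E)%E.

Definition dist_complete (A : set T) : Prop :=
  forall x_ : nat -> T, (forall n, A (x_ n)) -> dist_cauchy x_ ->
    exists2 x, A x & d (x_ n) x @[n --> \oo] --> 0%E.

Definition cauchy_incomplete (A : set T) : Prop := ~ dist_complete A.

End Distance.

(* Main.v *)
Require Import Defs.
From HB Require Import structures.
From mathcomp Require Import all_boot all_order all_algebra.
From mathcomp Require Import all_classical all_reals all_analysis.
From mathcomp Require Import sesquilinear ring lra.

(* On the frame bundle |omega| + |theta| defines lengths of curves that are comparable with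
   those of every natural metric, since all inner products on a finite-dimensional space are
   equivalent; so the sets V_n can be built from these lengths, independently of d.

   Let u be a positive orthonormal parallel frame along gamma, obtained from any parallel
   frame by a constant change of basis.  As omega vanishes along u, the length of u is at most
   a multiple of the generalised affine length of gamma; hence u(t) is Cauchy as t -> a.  Take
   for V_n the points of O+M that some curve of length < 1/(n+1) joins to u([t_n, a)).  Then V_n
   is bounded and its diameter tends to 0.  If u(t_k) converged to some x, then gamma would
   have the endpoint pi(x), because curves of small length starting at x stay over a given
   neighbourhood of pi(x).

   Conversely every frame close to a given one, in a chart of FM, can be reached in O+M by a
   curve of small length whose endpoint lies over the same point: orthonormalise the
   straight-line family of frames in the chart by Gram-Schmidt for the Lorentz metric.  This
   makes V_n and pi(V_n) open.  Finally pi(V_n) is connected, and it contains the tail of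
   gamma, which is itself b-incomplete after a translation of the parameter. *)

Set Implicit Arguments.
Unset Strict Implicit.
Unset Printing Implicit Defensive.

Import Order.TTheory GRing.Theory Num.Theory.
Import numFieldNormedType.Exports.

Local Open Scope classical_set_scope.
Local Open Scope ring_scope.

(** The obstacle is the representation of tangent vectors: [omega] and [theta] at a frame over p are
    computed in the chart [chart_at p], which may jump as p moves. So not even the continuity of the
    speed of a C^1 curve of frames is visible from the definitions. It comes from the transformation
    law of the Christoffel symbols, which gives both forms the same expression in every chart, in
    particular in one fixed chart near a given point. That law is not obtained by expanding the
    Christoffel formula: it is derived from the uniqueness of the torsion-free metric connection,
    for which the transition maps must have symmetric second derivatives.

    Lengths are carried by a primitive of the speed. Reparametrization is then the chain rule and
    estimates are mean value inequalities; integrals occur only where a natural length or the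
    generalised affine parameter is evaluated.

    The curves in the distance are C^1, not piecewise C^1, so a concatenation has to come to rest at
    the junction before the triangle inequality for lengths is available. *)

Section MatrixAnalysis.
Context {R : realType}.

Lemma mx_entry_le m n (A : 'M[R]_(m, n)) i j : `|A i j| <= `|A|.
Proof.
rewrite {2}/Num.Def.normr /= mx_normrE.
exact: (le_bigmax _ (fun ij : 'I_m * 'I_n => `|A ij.1 ij.2|) (i, j)).
Qed.

Lemma mx_norm_le m n (A : 'M[R]_(m, n)) (C : R) :
  0 <= C -> (forall i j, `|A i j| <= C) -> `|A| <= C.
Proof.
move=> C0 AC; rewrite /Num.Def.normr /= mx_normrE.
by apply/bigmax_leP; split=> // -[i j] _; exact: AC.
Qed.

(** The norm is the largest absolute value of an entry, which is not submultiplicative: an entry of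
    the product is a sum of n terms. *)
Lemma mx_norm_mul m n p (A : 'M[R]_(m, n)) (B : 'M[R]_(n, p)) :
  `|A *m B| <= n%:R * (`|A| * `|B|).
Proof.
apply: mx_norm_le => [|i j]; first by rewrite !mulr_ge0.
rewrite mxE (le_trans (ler_norm_sum _ _ _))//.
apply: (@le_trans _ _ (\sum_(k < n) `|A| * `|B|)).
  by apply: ler_sum => k _; rewrite normrM ler_pM// mx_entry_le.
by rewrite sumr_const card_ord mulr_natl.
Qed.

Lemma mx_norm_tr m n (A : 'M[R]_(m, n)) : `|A^T| = `|A|.
Proof.
apply/eqP; rewrite eq_le; apply/andP; split.
  by apply: mx_norm_le => // i j; rewrite mxE mx_entry_le.
by apply: mx_norm_le => // i j; have := mx_entry_le A^T j i; rewrite mxE.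
Qed.

(** * Limits of matrix-valued functions *)

Section Limits.
Context {T : Type} {F : set_system T} {FF : Filter F}.

Lemma cvg_mx m n (f : T -> 'M[R]_(m, n)) (l : 'M[R]_(m, n)) :
  (forall i j, f x i j @[x --> F] --> l i j) -> f x @[x --> F] --> l.
Proof.
move=> fl; apply/cvgrPdist_le => /= e e0; near=> x.
apply: mx_norm_le => [|i j]; first exact: ltW.
move: i j; near: x; apply: filter_forall => i; apply: filter_forall => j.
have /cvgrPdist_le /(_ e e0) := fl i j.
by apply: filterS => x; rewrite !mxE.
Unshelve. all: by end_near. Qed.

Lemma cvg_entry m n (f : T -> 'M[R]_(m, n)) (l : 'M[R]_(m, n)) i j :
  f x @[x --> F] --> l -> f x i j @[x --> F] --> l i j.
Proof.
move=> fl; apply: (@cvg_comp _ _ _ f (fun A : 'M[R]_(m, n) => A i j) F _ _ fl).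
exact: coord_continuous.
Qed.

Lemma cvg_sumr (I : Type) (r : seq I) (P : pred I) (V : normedModType R)
    (f : I -> T -> V) (l : I -> V) :
  (forall i, P i -> f i x @[x --> F] --> l i) ->
  \sum_(i <- r | P i) f i x @[x --> F] --> \sum_(i <- r | P i) l i.
Proof. by move=> fl; apply: cvg_big => //; exact: add_continuous. Qed.

Lemma cvg_prodr (I : Type) (r : seq I) (P : pred I) (f : I -> T -> R) (l : I -> R) :
  (forall i, P i -> f i x @[x --> F] --> l i) ->
  \prod_(i <- r | P i) f i x @[x --> F] --> \prod_(i <- r | P i) l i.
Proof. by move=> fl; apply: cvg_big => //; exact: mul_continuous. Qed.

Lemma cvg_mulmx m n p (f : T -> 'M[R]_(m, n)) (g : T -> 'M[R]_(n, p))
    (A : 'M[R]_(m, n)) (B : 'M[R]_(n, p)) :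
  f x @[x --> F] --> A -> g x @[x --> F] --> B ->
  f x *m g x @[x --> F] --> A *m B.
Proof.
move=> fA gB; apply: cvg_mx => i j; rewrite mxE.
under eq_cvg do rewrite mxE.
by apply: cvg_sumr => k _; apply: cvgM; exact: cvg_entry.
Qed.

Lemma cvg_trmx m n (f : T -> 'M[R]_(m, n)) (A : 'M[R]_(m, n)) :
  f x @[x --> F] --> A -> (f x)^T @[x --> F] --> A^T.
Proof.
move=> fA; apply: cvg_mx => i j; rewrite mxE.
by under eq_cvg do rewrite mxE; exact: cvg_entry.
Qed.

Lemma cvg_det n (f : T -> 'M[R]_n) (A : 'M[R]_n) :
  f x @[x --> F] --> A -> \det (f x) @[x --> F] --> \det A.
Proof.
move=> fA; apply: cvg_sumr => s _; apply: cvgM; first exact: cvg_cst.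
by apply: cvg_prodr => i _; exact: cvg_entry.
Qed.

(** Cramer's rule. On singular matrices [invmx] is the identity, so the formula with the adjugate is
    only available near the limit, where the determinant does not vanish. *)
Lemma cvg_invmx n (f : T -> 'M[R]_n) (A : 'M[R]_n) : A \in unitmx ->
  f x @[x --> F] --> A -> invmx (f x) @[x --> F] --> invmx A.
Proof.
move=> uA fA; have dA : \det A != 0 by rewrite -unitfE -unitmxE.
have fd := cvg_det fA.
rewrite {2}/invmx uA.
apply: (@cvg_trans _ ((fun x => (\det (f x))^-1 *: \adj (f x)) @ F)).
  apply: near_eq_cvg.
  have : \forall x \near F, \det (f x) != 0.
    exact: cvgr_neq0 fd dA.
  by apply: filterS => x d0; rewrite /invmx unitmxE unitfE d0.
apply: cvgZ; first exact: cvgV.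
apply: cvg_mx => i j; rewrite mxE; under eq_cvg do rewrite mxE.
rewrite /cofactor; apply: cvgM; first exact: cvg_cst.
apply: cvg_det; apply: cvg_mx => k l; rewrite !mxE.
by under eq_cvg do rewrite !mxE; exact: cvg_entry.
Qed.

End Limits.

End MatrixAnalysis.

(** * Derivatives relative to an interval *)

Section DerivativeWithin.
Context {R : realType}.

(** [deriv_within] is a [lim], with a default value when there is no convergence; [dw] states the
    convergence together with its value. *)
Definition dw (V : normedModType R) (D : set R) (f : R -> V) (t : R) (l : V) : Prop :=
  diff_quot f t s @[s --> within D t^'] --> l.

Implicit Types (V W : normedModType R) (D : set R).

Lemma cvg_congr_near (T U : Type) (F : set_system T) {FF : Filter F} (f g : T -> U)
    (l : set_system U) :
  (\forall x \near F, f x = g x) -> f x @[x --> F] --> l -> g x @[x --> F] --> l.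
Proof.
move=> fg; apply: cvg_trans; apply: near_eq_cvg.
by apply: filterS fg => x ->.
Qed.

(* Caratheodory's form of the derivative: no division, hence stable under composition
   with maps that are not injective near t. *)
Lemma dwP V D (f : R -> V) t l : D t ->
  dw D f t l <-> exists2 q : R -> V, forall s, D s -> f s - f t = (s - t) *: q s &
                                     q s @[s --> within D (nbhs t)] --> l.
Proof.
move=> Dt; split=> [fl|[q fq ql]].
  exists (fun s => if s == t then l else diff_quot f t s).
    move=> s Ds; case: eqVneq => [->|st]; first by rewrite !subrr scale0r.
    by rewrite /diff_quot scalerA mulfV ?scale1r// subr_eq0.
  apply/cvgrPdist_le => /= e e0.
  move/cvgrPdist_le : fl => /(_ e e0).
  rewrite !near_withinE => H.
  rewrite /prop_near1 /=; apply: filterS H => s H Ds.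
  by case: eqVneq => [_|st]; [rewrite subrr normr0 ltW|exact: H].
rewrite /dw; apply: (@cvg_congr_near _ _ _ _ q).
  rewrite near_withinE near_withinE; near=> s => st Ds.
  rewrite /diff_quot fq// scalerA mulVf ?scale1r// subr_eq0.
  exact: st.
move=> A /ql; rewrite /within /= /dnbhs /within /nbhs /=.
by apply: filterS => s As _; exact: As.
Unshelve. all: by end_near. Qed.

Lemma dw_near V D (f g : R -> V) t l : D t ->
  (\forall s \near within D (nbhs t), f s = g s) -> dw D f t l -> dw D g t l.
Proof.
move=> Dt fg; rewrite /dw; apply: cvg_congr_near.
have ft : f t = g t by move: fg; rewrite near_withinE => /nbhs_singleton; exact.
rewrite near_withinE near_withinE; move: fg; rewrite near_withinE.
by apply: filterS => s fgs _ Ds; rewrite /diff_quot fgs// ft.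
Qed.

Lemma dw_subset V D D' (f : R -> V) t l : D' `<=` D -> dw D f t l -> dw D' f t l.
Proof. by move=> DD'; apply: cvg_trans; apply: cvg_app; exact: within_subset. Qed.

Lemma dw_continuous V D (f : R -> V) t l : D t -> dw D f t l ->
  f s @[s --> within D (nbhs t)] --> f t.
Proof.
move=> Dt /(dwP _ _ Dt)[q fq ql].
have : (s - t) *: q s + f t @[s --> within D (nbhs t)] --> (t - t) *: l + f t.
  apply: cvgD; last exact: cvg_cst.
  apply: cvgZ => //; apply: cvgB; last exact: cvg_cst.
  exact: cvg_within.
rewrite subrr scale0r add0r; apply: cvg_congr_near.
by rewrite near_withinE; near=> s => Ds; rewrite -fq// subrK.
Unshelve. all: by end_near. Qed.

Lemma dw_unique V D (f : R -> V) t l l' : ProperFilter (within D t^') ->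
  dw D f t l -> dw D f t l' -> l = l'.
Proof. by move=> PF fl fl'; apply: (cvg_unique _ fl fl'). Qed.

Lemma deriv_withinE V D (f : R -> V) t l : ProperFilter (within D t^') ->
  dw D f t l -> deriv_within D f t = l.
Proof. by move=> PF fl; apply/cvg_lim. Qed.

Lemma dw_cst V D (v : V) t : dw D (cst v) t 0.
Proof.
rewrite /dw /diff_quot; under eq_cvg do rewrite /cst subrr scaler0.
exact: cvg_cst.
Qed.

Lemma dw_id D t : D t -> dw D id t 1.
Proof.
by move=> Dt; apply/dwP => //; exists (cst 1) => [s Ds|]; [rewrite -[RHS]/(_ * _) mulr1|exact: cvg_cst].
Qed.

Lemma dwD V D (f g : R -> V) t l m :
  dw D f t l -> dw D g t m -> dw D (fun s => f s + g s) t (l + m).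
Proof.
rewrite /dw => fl gm; apply: (cvg_congr_near _ (cvgD fl gm)); near=> s.
by rewrite /= /diff_quot -scalerDr opprD addrACA.
Unshelve. all: by end_near. Qed.

Lemma dwN V D (f : R -> V) t l : dw D f t l -> dw D (fun s => - f s) t (- l).
Proof.
rewrite /dw => fl; apply: (cvg_congr_near _ (cvgN fl)); near=> s.
by rewrite /= /diff_quot -scalerN opprB opprK [- f s + _]addrC.
Unshelve. all: by end_near. Qed.

Lemma dwB V D (f g : R -> V) t l m :
  dw D f t l -> dw D g t m -> dw D (fun s => f s - g s) t (l - m).
Proof. by move=> fl /dwN; exact: dwD. Qed.

Lemma dwZ V D (f : R -> R) (g : R -> V) t l m : D t ->
  dw D f t l -> dw D g t m -> dw D (fun s => f s *: g s) t (l *: g t + f t *: m).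
Proof.
move=> Dt Dfl Dgm.
have gc := dw_continuous Dt Dgm.
move: Dfl Dgm => /(dwP _ _ Dt)[p fp pl] /(dwP _ _ Dt)[q gq qm].
apply/(dwP _ _ Dt); exists (fun s => p s *: g s + f t *: q s) => [s Ds|].
  have E1 : (s - t) *: (p s *: g s) = (f s - f t) *: g s by rewrite scalerA (fp s Ds).
  have E2 : (s - t) *: (f t *: q s) = f t *: (g s - g t).
    by rewrite scalerA mulrC -scalerA gq.
  by rewrite scalerDr E1 E2 scalerBl scalerBr addrA subrK.
apply: cvgD; first exact: cvgZ.
by apply: cvgZ => //; exact: cvg_cst.
Qed.

Lemma dwM D (f g : R -> R) t l m : D t ->
  dw D f t l -> dw D g t m -> dw D (fun s => f s * g s) t (l * g t + f t * m).
Proof. exact: dwZ. Qed.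

Lemma dw_entry D m n (f : R -> 'M[R]_(m, n)) t l i j :
  dw D f t l -> dw D (fun s => f s i j) t (l i j).
Proof.
rewrite /dw => fl.
have : diff_quot f t s i j @[s --> within D t^'] --> l i j by exact: cvg_entry.
apply: cvg_congr_near; near=> s.
by rewrite /diff_quot !mxE.
Unshelve. all: by end_near. Qed.

Lemma dw_mx D m n (f : R -> 'M[R]_(m, n)) t (l : 'M[R]_(m, n)) :
  (forall i j, dw D (fun s => f s i j) t (l i j)) -> dw D f t l.
Proof.
move=> fl; apply: cvg_mx => i j; have := fl i j; rewrite /dw; apply: cvg_congr_near; near=> s.
by rewrite /diff_quot !mxE.
Unshelve. all: by end_near. Qed.

Lemma dw_mulmx D m n p (f : R -> 'M[R]_(m, n)) (g : R -> 'M[R]_(n, p)) t l k : D t ->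
  dw D f t l -> dw D g t k -> dw D (fun s => f s *m g s) t (l *m g t + f t *m k).
Proof.
move=> Dt Dfl Dgm.
have gc := dw_continuous Dt Dgm.
move: Dfl Dgm => /(dwP _ _ Dt)[a fa al] /(dwP _ _ Dt)[b gb bk].
apply/(dwP _ _ Dt); exists (fun s => a s *m g s + f t *m b s) => [s Ds|].
  rewrite scalerDr scalemxAl -fa// scalemxAr -gb// mulmxBl mulmxBr.
  by rewrite addrA subrK.
by apply: cvgD; apply: cvg_mulmx => //; exact: cvg_cst.
Qed.

Lemma dw_trmx D m n (f : R -> 'M[R]_(m, n)) t l :
  dw D f t l -> dw D (fun s => (f s)^T) t l^T.
Proof.
move=> fl; apply: dw_mx => i j; rewrite mxE.
have : dw D (fun s => f s j i) t (l j i) by exact: dw_entry.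
rewrite /dw; apply: cvg_congr_near; near=> s.
by rewrite /diff_quot !mxE.
Unshelve. all: by end_near. Qed.

Lemma cvg_within_comp (T U : topologicalType) (D : set T) (D' : set U) (f : T -> U) t :
  D t -> (forall s, D s -> D' (f s)) ->
  f s @[s --> within D (nbhs t)] --> f t -> f s @[s --> within D (nbhs t)] --> within D' (nbhs (f t)).
Proof.
move=> Dt DD' fc A HA.
have : \forall s \near within D (nbhs t), D' (f s) -> A (f s).
  exact: (fc [set y | D' y -> A y] HA).
suff : (\forall s \near within D (nbhs t), D' (f s) -> A (f s)) ->
  \forall s \near within D (nbhs t), A (f s) by apply.
by rewrite !near_withinE; apply: filterS => s H Ds; exact: H (DD' _ Ds).
Qed.

Lemma dw_comp V D D' (psi : R -> R) (f : R -> V) t p l : D' t ->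
  (forall s, D' s -> D (psi s)) ->
  dw D' psi t p -> dw D f (psi t) l -> dw D' (f \o psi) t (p *: l).
Proof.
move=> D't DD' psip fl.
have pc := cvg_within_comp D't DD' (dw_continuous D't psip).
move: psip fl => /(dwP _ _ D't)[a pa ap] /(dwP _ _ (DD' _ D't))[b fb bl].
apply/(dwP _ _ D't); exists (fun s => a s *: b (psi s)) => [s Ds|].
  rewrite /= fb; last exact: DD'.
  by rewrite pa// scalerA.
by apply: cvgZ => //; apply: cvg_comp bl.
Qed.

Lemma is_derive_dw V D (f : R -> V) (t : R) l : is_derive t (1 : R) f l -> dw D f t l.
Proof.
move=> fl; apply: (@dw_subset _ setT) => //.
have H : h^-1 *: ((f \o shift t) (h *: (1 : R)) - f t) @[h --> 0^'] --> 'D_(1 : R) f t.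
  exact: (@ex_derive _ _ _ _ _ _ _ fl).
rewrite (@derive_val _ _ _ _ _ _ _ fl) in H.
rewrite /dw withinET.
have tt : (s - t) @[s --> t^'] --> 0^'.
  move=> A; rewrite /dnbhs /within /= => -[e e0 eA]; exists e => // s /= ste st.
  apply: eA; last by rewrite subr_eq0.
  by rewrite /ball_ /= sub0r opprB.
have := cvg_comp _ _ tt H; apply: cvg_trans; apply: near_eq_cvg; near=> s.
by rewrite /= /diff_quot -[(s - t) *: 1]/((s - t) * 1) mulr1 subrK.
Unshelve. all: by end_near. Qed.

Lemma dw_is_derive V (D : set R) (f : R -> V) (t : R) l : nbhs t D ->
  dw D f t l -> is_derive t (1 : R) f l.
Proof.
move=> Dt fl.
have H : h^-1 *: ((f \o shift t) (h *: (1 : R)) - f t) @[h --> 0^'] --> l.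
  have tt : (h + t) @[h --> 0^'] --> within D t^'.
    move=> A; rewrite /dnbhs /within /= => -[e e0 eA].
    have [d d0 dD] := Dt.
    exists (Num.min e d); first by rewrite /= lt_min e0.
    move=> h /=; rewrite sub0r normrN lt_min => /andP[he hd] h0; apply: eA.
    - by rewrite /ball_ /= opprD addrCA subrr addr0 normrN.
    - by rewrite -subr_eq0 addrK.
    - by apply: dD; rewrite /ball_ /= opprD addrCA subrr addr0 normrN.
  have := cvg_comp _ _ tt fl; apply: cvg_trans; apply: near_eq_cvg; near=> h.
  by rewrite /= /diff_quot addrK -[h *: 1]/(h * 1) mulr1.
apply: DeriveDef; first by apply/cvg_ex; exists l.
exact/cvg_lim.
Unshelve. all: by end_near. Qed.

(** The increment of [Phi \o f] is the differential applied to [f s - f t], plus a remainder [r s].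
    The first part is handled by linearity and continuity of the differential. The remainder is
    small compared with [f s - f t], hence compared with [s - t], as the difference quotients of f
    are bounded near t. *)
Lemma dw_diff V W D (f : R -> V) (Phi : V -> W) t l : D t ->
  dw D f t l -> differentiable Phi (f t) -> dw D (Phi \o f) t ('d Phi (f t) l).
Proof.
move=> Dt fl dPhi.
have [q fq ql] := (dwP _ _ Dt).1 fl.
have fc := dw_continuous Dt fl.
have dc := diff_continuous dPhi.
have /diff_locallyP[_ /eqaddoP Phix] := dPhi.
pose r s := Phi (f s) - Phi (f t) - 'd Phi (f t) (f s - f t).
have ro : (s - t)^-1 *: r s @[s --> within D t^'] --> (0 : W).
  apply/cvgr0Pnorm_le => e e0.
  (* The difference quotients converge to l, so near t their norm is at most [|l| + 1]; the little-o
     estimate is used with e divided by this bound. *)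
  have e'0 : 0 < e / (`|l| + 1) by rewrite divr_gt0.
  have h1 : \forall s \near within D t^', `|diff_quot f t s| <= `|l| + 1.
    by have := cvgr_norm_le _ fl (`|l| + 1); apply; rewrite ltrDl.
  have h2 : \forall s \near within D t^', `|r s| <= e / (`|l| + 1) * `|f s - f t|.
    have f0 : f s - f t @[s --> within D (nbhs t)] --> (0 : V).
      by rewrite -(subrr (f t)); apply: cvgB => //; exact: cvg_cst.
    have : \forall s \near within D (nbhs t), `|r s| <= e / (`|l| + 1) * `|f s - f t|.
      apply: (@filterS _ (within D (nbhs t)) _ _ _ _ (f0 _ (Phix _ e'0))) => s.
      by rewrite /r /= !fctE /= subrK opprD addrA.
    by rewrite !near_withinE; apply: filterS => s H _ Ds; exact: H.
  near=> s.
  have st : s - t != 0.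
    rewrite subr_eq0; near: s.
    rewrite near_withinE near_withinE.
    by near=> s.
  rewrite normrZ normfV ler_pdivrMl ?normr_gt0//.
  apply: (le_trans (_ : _ <= e / (`|l| + 1) * `|f s - f t|)); first by near: s.
  have -> : f s - f t = (s - t) *: diff_quot f t s.
    by rewrite /diff_quot scalerA mulfV ?scale1r.
  rewrite normrZ mulrCA ler_pM2l ?normr_gt0//.
  rewrite -mulrA ler_piMr ?(ltW e0)// ler_pdivrMl// mulr1.
  by near: s.
rewrite /dw -[X in _ --> X]addr0.
have dl : 'd Phi (f t) (diff_quot f t s) @[s --> within D t^'] --> 'd Phi (f t) l.
  exact: (cvg_comp _ _ fl (dc l)).
apply: (cvg_congr_near _ (cvgD dl ro)); near=> s.
by rewrite /= /diff_quot linearZ -scalerDr /r [X in _ *: X]addrC subrK.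
Unshelve. all: by end_near. Qed.

End DerivativeWithin.

(** * Mean value inequalities and primitives on an interval *)

Section RealAnalysis.
Context {R : realType}.
Implicit Types D : set R.

(** No point of D is isolated in D; this is what makes a derivative relative to D unique. *)
Definition perfect_in D : Prop := forall t, D t -> ProperFilter (within D t^').

Lemma perfect_inP D : (forall t, D t -> forall e, 0 < e -> exists2 s, D s & s != t /\ `|s - t| < e) ->
  perfect_in D.
Proof.
move=> H t Dt; apply: Build_ProperFilter_ex => A.
rewrite /within /dnbhs /within /= => -[e e0 eA].
have [s Ds [st se]] := H t Dt e e0.
by exists s; apply: eA => //; rewrite /ball_ /= distrC.
Qed.

Lemma perfect_segment (s t : R) : s < t -> perfect_in `[s, t]%classic.
Proof.
move=> st; apply: perfect_inP => r /=; rewrite in_itv /= => /andP[sr rt] e e0.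
pose d := Num.min (e / 2) ((t - s) / 2).
have d0 : 0 < d by rewrite lt_min !divr_gt0// subr_gt0.
have de : d < e by rewrite gt_min; apply/orP; left; lra.
have dts : d <= (t - s) / 2 by rewrite ge_min lexx orbT.
(* Move inwards: to the right from the left half of the segment, to the left from the right half. *)
have [rm|rm] := leP r ((s + t) / 2).
  exists (r + d); first by rewrite /= in_itv /=; apply/andP; split; lra.
  split; first by rewrite gt_eqF// ltrDl.
  by rewrite addrAC subrr add0r gtr0_norm.
exists (r - d); first by rewrite /= in_itv /=; apply/andP; split; lra.
split; first by rewrite lt_eqF// gtrBl.
by rewrite addrAC subrr add0r normrN gtr0_norm.
Qed.

Lemma ico_open_up (s : R) (a : \bar R) t : ico s a t -> exists2 e, 0 < e & forall r, `|r - t| < e -> s <= r -> ico s a r.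
Proof.
case: a => [a||] [st ta] //.
- rewrite lte_fin in ta; exists (a - t); first by rewrite subr_gt0.
  move=> r rt sr; split => //; rewrite lte_fin.
  by move: rt; rewrite ltr_norml => /andP[_]; lra.
- by exists 1 => // r _ sr; split => //; exact: ltry.
Qed.

Lemma perfect_ico (s : R) (a : \bar R) : perfect_in (ico s a).
Proof.
apply: perfect_inP => t Dt e e0; have [d d0 H] := ico_open_up Dt.
pose c := Num.min d e / 2.
have c0 : 0 < c by rewrite divr_gt0// lt_min d0.
have cd : c < d by rewrite /c ltr_pdivrMr// gt_min; apply/orP; left; lra.
have ce : c < e by rewrite /c ltr_pdivrMr// gt_min; apply/orP; right; lra.
have tc : `|t + c - t| = c by rewrite addrAC subrr add0r gtr0_norm.
exists (t + c); last by rewrite gt_eqF ?ltrDl// tc.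
by apply: H; [rewrite tc|rewrite (le_trans Dt.1)// lerDl ltW].
Qed.

Lemma ico_interval (s : R) (a : \bar R) x y r : ico s a x -> ico s a y -> x <= r <= y -> ico s a r.
Proof.
move=> [sx _] [_ ya] /andP[xr ry]; split; first exact: le_trans xr.
by apply: le_lt_trans ya; rewrite lee_fin.
Qed.

Lemma dw_MVT (f f' : R -> R) (s t : R) : s < t ->
  (forall r, s <= r <= t -> dw `[s, t]%classic f r (f' r)) ->
  exists2 r, s < r < t & f t - f s = f' r * (t - s).
Proof.
move=> st fd.
have [||r] := @MVT R f f' s t st.
- move=> r rst; apply: (@dw_is_derive _ _ `[s, t]%classic).
    apply: (@filterS _ _ _ `]s, t[%classic); first exact: subset_itv_oo_cc.
    by apply: open_nbhs_nbhs; split => //; exact: itv_open.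
  by apply: fd; move: rst; rewrite in_itv /= => /andP[/ltW-> /ltW->].
- apply/subspace_continuousP => r /= rst; apply: (@dw_continuous _ _ _ _ _ (f' r)) => //.
  by apply: fd; move: rst; rewrite in_itv.
by rewrite in_itv /= => rst ->; exists r.
Qed.

Lemma dw_le (f f' g g' : R -> R) (s t : R) : s <= t ->
  (forall r, s <= r <= t -> dw `[s, t]%classic f r (f' r)) ->
  (forall r, s <= r <= t -> dw `[s, t]%classic g r (g' r)) ->
  (forall r, s <= r <= t -> f' r <= g' r) -> f t - f s <= g t - g s.
Proof.
rewrite le_eqVlt => /predU1P[->|st] fd gd fg; first by rewrite !subrr.
have [r /andP[/ltW sr /ltW rt] E] := @dw_MVT (fun r => g r - f r) (fun r => g' r - f' r) s t st
  (fun r h => dwB (gd r h) (fd r h)).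
rewrite -subr_ge0 (_ : _ - _ = (g t - f t) - (g s - f s)); last by ring.
by rewrite E mulr_ge0// subr_ge0 ?fg ?sr// ltW.
Qed.

Lemma dw_cst_eq (f : R -> R) (s t : R) : s <= t ->
  (forall r, s <= r <= t -> dw `[s, t]%classic f r 0) -> f t = f s.
Proof.
rewrite le_eqVlt => /predU1P[->//|st] fd.
have [r _] := @dw_MVT f (cst 0) s t st fd.
by rewrite mul0r => /eqP; rewrite subr_eq0 => /eqP.
Qed.

(** In the sup norm the mean value inequality for matrices is the real one, applied to each entry
    and to its opposite. *)
Lemma dw_norm_le m n (f f' : R -> 'M[R]_(m, n)) (g g' : R -> R) (s t : R) : s <= t ->
  (forall r, s <= r <= t -> dw `[s, t]%classic f r (f' r)) ->
  (forall r, s <= r <= t -> dw `[s, t]%classic g r (g' r)) ->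
  (forall r, s <= r <= t -> `|f' r| <= g' r) -> `|f t - f s| <= g t - g s.
Proof.
move=> st fd gd fg.
have H i j : `|f t i j - f s i j| <= g t - g s.
  have fij r : s <= r <= t -> dw `[s, t]%classic (fun r => f r i j) r (f' r i j).
    by move=> /fd rst; exact: dw_entry.
  have fgij r : s <= r <= t -> `|f' r i j| <= g' r.
    by move=> /fg; apply: le_trans; exact: mx_entry_le.
  rewrite ler_norml; apply/andP; split.
    have h : - f t i j - - f s i j <= g t - g s.
      apply: (dw_le st (fun r h => dwN (fij r h)) gd) => r /fgij; apply: le_trans.
      by rewrite -normrN ler_norm.
    by lra.
  apply: (dw_le st fij gd) => r /fgij; apply: le_trans; exact: ler_norm.
apply: mx_norm_le => [|i j]; last by rewrite !mxE.
(* A matrix without entries gives no lower bound on [g t - g s]; its nonnegativity comes from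
   comparing g with a constant. *)
have := @dw_le (cst 0) (cst 0) g g' s t st (fun r _ => @dw_cst R R _ 0 r) gd.
by rewrite subrr; apply => r /fg; exact: le_trans.
Qed.

(** Since v is only controlled on [s, t], it is first extended by constants through [clamp]. The
    extension is continuous everywhere and is integrated from s - 1, with t + 1 as upper limit, so
    that the fundamental theorem gives two-sided derivatives at s and t as well. *)
Lemma primitive (v : R -> R) (s t : R) : s < t -> {within `[s, t], continuous v} ->
  exists L : R -> R, (forall r, s <= r <= t -> is_derive r (1 : R) L (v r)) /\
    forall p q, s <= p -> p < q -> q <= t ->
      (\int[lebesgue_measure]_(x in `[p, q]) (v x)%:E = (L q - L p)%:E)%E.
Proof.
move=> st vc.
pose clamp r := Num.max s (Num.min r t).
have clampE r : s <= r <= t -> clamp r = r.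
  by move=> /andP[sr rt]; rewrite /clamp min_l// max_r.
have clamp_in r : `[s, t]%classic (clamp r).
  by rewrite /= in_itv /= /clamp le_max lexx /= ge_max (ltW st) ge_min lexx orbT.
pose w r := v (clamp r).
have wc : continuous (w : R -> R).
  move=> r; rewrite /continuous_at.
  have cc : clamp x @[x --> r] --> clamp r.
    apply: (@continuous_max R R (cst s) (fun x => Num.min x t) r).
      exact: cst_continuous.
    apply: (@continuous_min R R id (cst t) r); first exact: cvg_id.
    exact: cst_continuous.
  have cc' : clamp x @[x --> r] --> within `[s, t]%classic (nbhs (clamp r)).
    move=> A HA; apply: (@filterS _ (nbhs r) _ _ _ _ (cc _ HA)) => x; apply.
    exact: clamp_in.
  by move/subspace_continuousP : vc => /(_ _ (clamp_in r)); exact: cvg_comp cc'.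
have wi : lebesgue_measure.-integrable `[s - 1, t + 1] (EFin \o w).
  apply: continuous_compact_integrable; first exact: segment_compact.
  exact: continuous_subspaceT.
pose L x := (\int[lebesgue_measure]_(y in [set` `[s - 1, x]]) (w y))%R.
have Ld r : s <= r <= t -> derivable L r 1 /\ derive1 L r = w r.
  move=> /andP[sr rt]; apply: (@continuous_FTC1_closed _ w (s - 1) r (t + 1)) => //.
  - by rewrite ltr_pwDr.
  - by rewrite ltrBlDr ltr_pwDr.
  - exact: wc.
exists L; split.
  move=> r rst; have [Lr] := Ld r rst.
  rewrite derive1E /w clampE// => E; apply: DeriveDef => //.
move=> p q sp pq qt.
transitivity (\int[lebesgue_measure]_(x in `[p, q]) (w x)%:E)%E.
  apply: eq_integral => x; rewrite inE /= in_itv /= => /andP[px xq].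
  by rewrite /w clampE// (le_trans sp px) (le_trans xq qt).
have Lc r : s <= r <= t -> {for r, continuous L}.
  by move=> /Ld[Lr _]; apply: differentiable_continuous; exact/derivable1_diffP.
rewrite EFinB; apply: continuous_FTC2 => //.
- exact: continuous_subspaceT.
- split.
  + move=> x; rewrite in_itv /= => /andP[/ltW px /ltW xq].
    by case: (Ld x) => //; rewrite (le_trans sp px) (le_trans xq qt).
  + apply: cvg_at_right_filter; apply: Lc; rewrite sp (le_trans _ qt)// ltW//.
  + apply: cvg_at_left_filter; apply: Lc; rewrite qt (le_trans sp)// ltW//.
- move=> x; rewrite in_itv /= => /andP[/ltW px /ltW xq].
  by case: (Ld x) => //; rewrite (le_trans sp px) (le_trans xq qt).
Qed.

Section C1.
Variable V : normedModType R.

Lemma C1_within_at_dw D (f : R -> V) t : C1_within_at D f t -> dw D f t (deriv_within D f t).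
Proof. by case. Qed.

Lemma C1_within_atI D (f f' : R -> V) t : perfect_in D -> D t ->
  (\forall s \near within D (nbhs t), dw D f s (f' s)) ->
  f' s @[s --> within D (nbhs t)] --> f' t -> C1_within_at D f t.
Proof.
move=> pD Dt fd fc.
have ft : dw D f t (f' t) by move: fd; rewrite near_withinE => /nbhs_singleton; exact.
split; first by apply/cvg_ex; exists (f' t).
rewrite (deriv_withinE (pD _ Dt) ft); move: fc; apply: cvg_congr_near.
move: fd; rewrite !near_withinE; apply: filterS => s fs Ds.
by rewrite (deriv_withinE (pD _ Ds) (fs Ds)).
Qed.

(** The neighbourhoods are nested because continuity of the derivative at t involves the derivatives
    at the points s near t, hence the values of f around each such s. *)
Lemma C1_within_at_near D (f g : R -> V) t : perfect_in D -> D t ->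
  (\forall s \near t, \forall r \near within D (nbhs s), f r = g r) ->
  C1_within_at D f t -> C1_within_at D g t.
Proof.
move=> pD Dt fg [fd fc].
have E s : D s -> (\forall r \near within D (nbhs s), f r = g r) ->
    deriv_within D f s = deriv_within D g s.
  move=> Ds fgs; have ss := fgs; rewrite near_withinE in ss.
  have e := nbhs_singleton ss Ds.
  rewrite /deriv_within; congr (lim _).
  have H : \forall r \near within D s^', diff_quot f s r = diff_quot g s r.
    rewrite near_withinE near_withinE; move: fgs; rewrite near_withinE.
    by apply: filterS => r H _ Dr; rewrite /diff_quot H// e.
  rewrite eqEsubset; split; apply: near_eq_cvg; first exact: H.
  by apply: filterS H => r ->.
have fgt : \forall r \near within D (nbhs t), f r = g r by exact: nbhs_singleton fg.
split.
  by apply/cvg_ex; exists (deriv_within D f t); apply: (dw_near Dt fgt); exact: fd.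
rewrite -(E t)//; move: fc; apply: cvg_congr_near.
by rewrite near_withinE; apply: filterS fg => s fgs Ds; exact: E.
Qed.

End C1.

End RealAnalysis.

(** * Jacobians and symmetry of second derivatives *)

#[local] Opaque diff derive.

Section SeveralVariables.
Context {R : realType}.

Lemma linear_diff (V W : normedModType R) (f : {linear V -> W}) x : continuous f ->
  differentiable f x /\ 'd f x = f :> (V -> W).
Proof. by move=> fc; split; [exact: linear_differentiable|exact: diff_lin]. Qed.

Lemma near_diffE (V W : normedModType R) (f g : V -> W) x v :
  (\forall y \near x, f y = g y) -> differentiable f x -> differentiable g x ->
  'd f x v = 'd g x v.
Proof.
move=> fg fd gd; rewrite -!deriveE//.
have [->|v0] := eqVneq v 0; first by rewrite !derive0.
by apply: near_eq_derive.
Qed.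

Lemma row_jacobian n m (f : 'rV[R]_n -> 'rV[R]_m) x i :
  row i (jacobian f x) = 'd f x (delta_mx 0 i).
Proof. by rewrite rowE /jacobian mul_rV_lin1. Qed.

Lemma near_differentiable (V W : normedModType R) (f g : V -> W) x :
  (\forall y \near x, f y = g y) -> differentiable f x -> differentiable g x.
Proof.
move=> fg fd; have [fc /eqaddoP fo] := (diff_locallyP x f).1 fd.
have gx : f x = g x by exact: nbhs_singleton fg.
have go : g \o shift x = cst (g x) + 'd f x +o_ (0 : V) id.
  apply/eqaddoP => e e0; have := fo e e0.
  have : \forall h \near (0 : V), f (h + x) = g (h + x).
    have sc : (h + x) @[h --> (0 : V)] --> x.
      by rewrite -[X in _ --> X]add0r; apply: cvgD; [exact: cvg_id|exact: cvg_cst].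
    exact: (sc _ fg).
  by apply: filterS2 => h E; rewrite !fctE /= E gx.
have dE := diff_unique fc go.
by apply/diff_locallyP; split; rewrite dE.
Qed.

Lemma jacobian_comp n m p (f : 'rV[R]_n -> 'rV[R]_m) (g : 'rV[R]_m -> 'rV[R]_p) x :
  differentiable f x -> differentiable g (f x) ->
  jacobian (g \o f) x = jacobian f x *m jacobian g (f x).
Proof.
move=> fd gd; apply/row_matrixP => i.
rewrite /jacobian.
rewrite row_mul.
rewrite [in LHS]rowE.
rewrite [row i (lin1_mx ('d f x))]rowE.
rewrite 3!mul_rV_lin1.
by rewrite diff_comp.
Qed.

Lemma near_jacobianE n m (f g : 'rV[R]_n -> 'rV[R]_m) x :
  (\forall y \near x, f y = g y) -> differentiable f x -> differentiable g x ->
  jacobian f x = jacobian g x.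
Proof.
move=> fg fd gd; apply/row_matrixP => i.
apply: etrans (row_jacobian f x i) _.
apply: etrans _ (esym (row_jacobian g x i)).
apply: (near_diffE (delta_mx 0 i) fg fd gd).
Qed.

Lemma jacobian_id n (x : 'rV[R]_n) : jacobian id x = 1%:M.
Proof.
apply/row_matrixP => i; rewrite row_jacobian rowE mulmx1.
by rewrite diff_val.
Qed.

Lemma mulmx_continuous m n p (A : 'M[R]_(m, n)) : continuous (mulmx A : 'M[R]_(n, p) -> _).
Proof.
move=> B; apply: (@cvg_mulmx R _ (nbhs B) _ m n p (cst A) id); last exact: cvg_id.
exact: cvg_cst.
Qed.

Lemma diff_sum_delta n (V : normedModType R) (f : 'rV[R]_n -> V) x v : differentiable f x ->
  'd f x v = \sum_(i < n) v 0 i *: 'D_(delta_mx 0 i) f x.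
Proof.
move=> fd; rewrite {1}(row_sum_delta v) linear_sum; apply: eq_bigr => i _.
by rewrite linearZ deriveE.
Qed.

Lemma jacobian_sum n m (f : 'rV[R]_n -> 'rV[R]_m) x : differentiable f x ->
  jacobian f x = \sum_(i < n) (delta_mx i 0 : 'cV_n) *m 'D_(delta_mx 0 i) f x.
Proof.
move=> fd; apply/row_matrixP => i.
rewrite row_jacobian rowE mulmx_sumr (bigD1 i)//= big1 ?addr0.
  rewrite mulmxA mul_delta_mx deriveE//.
  have -> : delta_mx 0 0 = 1%:M :> 'M[R]_1 by apply/matrixP => a b; rewrite !mxE !ord1.
  by rewrite mul1mx.
by move=> j ji; rewrite mulmxA mul_delta_mx_cond eq_sym (negbTE ji) mulr0n mul0mx.
Qed.

Lemma line_is_derive (V W : normedModType R) (g : V -> W) p u (s : R) :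
  differentiable g (p + s *: u) ->
  is_derive s (1 : R) (fun r => g (p + r *: u)) ('D_u g (p + s *: u)).
Proof.
move=> gd; rewrite deriveE//.
apply: (@dw_is_derive _ _ setT); first exact: filterT.
apply: (@dw_diff _ _ _ _ (fun r : R => p + r *: u)) => //.
have -> : u = 0 + (1 *: u + s *: 0) by rewrite scale1r scaler0 addr0 add0r.
apply: dwD; first exact: dw_cst.
have -> : (fun r : R => r *: (0 + (1 *: u + s *: 0))) = (fun r => r *: u).
  by apply/funext => r; rewrite scale1r scaler0 addr0 add0r.
by apply: dwZ => //; [exact: dw_id|exact: dw_cst].
Qed.

Section Schwarz.
Context {V : normedModType R}.

(** The mean value theorem is used twice: in direction u for the difference [G] of two translates of
    g, then in direction v for the derivative of g along u. *)
Lemma second_difference (g : V -> R) x u v (h : R) : 0 < h ->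
  (forall a b, 0 <= a <= h -> 0 <= b <= h ->
    differentiable g (x + a *: u + b *: v) /\
    differentiable ('D_u g) (x + a *: u + b *: v)) ->
  exists a b, [/\ 0 <= a <= h, 0 <= b <= h &
    g (x + h *: u + h *: v) - g (x + h *: u) - g (x + h *: v) + g x =
    h * h * 'D_v ('D_u g) (x + a *: u + b *: v)].
Proof.
move=> h0 gd.
have hh : 0 <= h <= h by rewrite lexx ltW.
have oo : 0 <= (0:R) <= h by rewrite lexx ltW.
pose G s := g (x + h *: v + s *: u) - g (x + s *: u).
have Gd s : 0 <= s <= h -> is_derive s (1 : R) G
    ('D_u g (x + h *: v + s *: u) - 'D_u g (x + s *: u)).
  move=> sh; apply: is_deriveB; apply: line_is_derive.
    by have [+ _] := gd s h sh hh; rewrite addrAC.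
  by have [+ _] := gd s 0 sh oo; rewrite scale0r addr0.
have [a /andP[/ltW a0 /ltW ah] Ea] := @dw_MVT _ G _ 0 h h0 (fun r rh => is_derive_dw _ (Gd r rh)).
have ah' : 0 <= a <= h by rewrite a0.
have Hd s : 0 <= s <= h -> is_derive s (1 : R) (fun s => 'D_u g (x + a *: u + s *: v))
    ('D_v ('D_u g) (x + a *: u + s *: v)).
  by move=> sh; apply: line_is_derive; have [] := gd a s ah' sh.
have [b /andP[/ltW b0 /ltW bh] Eb] := @dw_MVT _ _ _ 0 h h0 (fun r rh => is_derive_dw _ (Hd r rh)).
exists a, b; split => //; first by rewrite b0.
move: Eb; rewrite scale0r addr0 subr0 => Eb.
move: Ea; rewrite /G scale0r !addr0 subr0 => Ea.
rewrite (_ : _ + g x = g (x + h *: v + h *: u) - g (x + h *: u) - (g (x + h *: v) - g x)).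
  by rewrite Ea [x + h *: v + a *: u]addrAC Eb; ring.
by rewrite [x + h *: v + _]addrAC opprB addrA addrAC.
Qed.

Let norm_sub_le (a b c d e : R) :
  `|a - c| <= e / 2 -> `|b - d| <= e / 2 -> c = d -> `|a - b| <= e.
Proof.
move=> ac bd cd; rewrite (splitr e) (_ : a - b = (a - c) - (b - d)); last by rewrite cd; ring.
by apply: le_trans (ler_normB _ _) _; exact: lerD.
Qed.

(** The second difference over a small parallelogram is symmetric in u and v. By [second_difference]
    it is [h * h] times either mixed derivative, each at some point of the parallelogram; by
    continuity both values are close to those at x. *)
Lemma schwarz (g : V -> R) x u v (A : set V) : nbhs x A ->
  (forall y, A y -> [/\ differentiable g y, differentiable ('D_u g) y & differentiable ('D_v g) y]) ->
  {for x, continuous ('D_u ('D_v g))} -> {for x, continuous ('D_v ('D_u g))} ->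
  'D_u ('D_v g) x = 'D_v ('D_u g) x.
Proof.
move=> Ax gd uvc vuc.
apply/eqP; rewrite -subr_eq0 -normr_eq0 eq_le normr_ge0 andbT.
apply/ler_addgt0Pr => e e0; rewrite add0r.
have e2 : 0 < e / 2 by rewrite divr_gt0.
move/cvgrPdist_le : uvc => /(_ _ e2) uvc; move/cvgrPdist_le : vuc => /(_ _ e2) vuc.
have /nbhs_ballP[d /= d0 dA] : nbhs x (A `&` ([set y | `|'D_u ('D_v g) x - 'D_u ('D_v g) y| <= e / 2] `&`
  [set y | `|'D_v ('D_u g) x - 'D_v ('D_u g) y| <= e / 2])).
  exact: (filterI Ax (filterI uvc vuc)).
(* With this side length the whole parallelogram stays in the ball of radius d, also when u or v is
   zero. *)
pose h := d / 2 / (`|u| + `|v| + 1).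
have h0 : 0 < h by rewrite !divr_gt0.
have inA a b : 0 <= a <= h -> 0 <= b <= h -> (A `&` ([set y | `|'D_u ('D_v g) x - 'D_u ('D_v g) y| <= e / 2] `&`
  [set y | `|'D_v ('D_u g) x - 'D_v ('D_u g) y| <= e / 2])) (x + a *: u + b *: v).
  move=> /andP[a0 ah] /andP[b0 bh]; apply: dA; rewrite -ball_normE /ball_ /=.
  rewrite -addrA opprD addrA subrr add0r normrN.
  apply: le_lt_trans (ler_normD _ _) _; rewrite !normrZ !ger0_norm//.
  apply: (@le_lt_trans _ _ (h * (`|u| + `|v| + 1))).
    by rewrite !mulrDr -[leLHS]addr0 !lerD// ?ler_wpM2r// mulr1 ltW.
  by rewrite /h divfK ?gt_eqF// ltr_pdivrMr// ltr_pMr// ltr1n.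
have [a [b [ah bh E1]]] := @second_difference g x u v h h0
  (fun a b ah bh => let: conj Ay _ := inA a b ah bh in let: And3 p q _ := gd _ Ay in conj p q).
have inA' s r : 0 <= s <= h -> 0 <= r <= h -> (A `&` ([set y | `|'D_u ('D_v g) x - 'D_u ('D_v g) y| <= e / 2] `&`
  [set y | `|'D_v ('D_u g) x - 'D_v ('D_u g) y| <= e / 2])) (x + s *: v + r *: u).
  by move=> ah' bh'; rewrite addrAC; exact: inA.
have [a' [b' [ah' bh' E2]]] := @second_difference g x v u h h0
  (fun a b ah bh => let: conj Ay _ := inA' a b ah bh in let: And3 p _ q := gd _ Ay in conj p q).
have EX : g (x + h *: u + h *: v) - g (x + h *: u) - g (x + h *: v) + g x =
    g (x + h *: v + h *: u) - g (x + h *: v) - g (x + h *: u) + g x.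
  by rewrite [x + h *: v + h *: u]addrAC; ring.
have hh : h * h != 0 by rewrite mulf_neq0// gt_eqF.
have E := mulfI hh (etrans (esym E1) (etrans EX E2)).
have [_ [_ I1]] := inA _ _ ah bh.
have [_ [I2 _]] := inA' _ _ ah' bh'.
exact: (norm_sub_le I2 I1 (esym E)).
Qed.

End Schwarz.

End SeveralVariables.

(** * Changes of charts *)

Section Charts.
Context {R : realType} (M : manifold4 R).
Implicit Types (c : chart M) (p : M) (x : 'rV[R]_4).

Definition cimg c : set 'rV[R]_4 := chart_map c @` chart_dom c.
Definition trans c c' : 'rV[R]_4 -> 'rV[R]_4 := chart_map c' \o chart_inv c.
Definition tdom c c' : set 'rV[R]_4 := chart_map c @` (chart_dom c `&` chart_dom c').

Lemma cimg_inv c x : cimg c x -> chart_dom c (chart_inv c x) /\ chart_map c (chart_inv c x) = x.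
Proof. by move=> [p cp <-]; rewrite chart_mapK. Qed.

Lemma cimg_map c p : chart_dom c p -> cimg c (chart_map c p).
Proof. by move=> cp; exists p. Qed.

Lemma cimg_nbhs c x : cimg c x -> nbhs x (cimg c).
Proof. by move=> cx; apply: open_nbhs_nbhs; split => //; exact: chart_range_open. Qed.

Lemma chart_dom_nbhs c p : chart_dom c p -> nbhs p (chart_dom c).
Proof. by move=> cp; apply: open_nbhs_nbhs; split => //; exact: chart_dom_open. Qed.

Lemma chart_map_cts c p : chart_dom c p -> {for p, continuous (chart_map c)}.
Proof.
move=> cp; have := @chart_map_continuous _ M c.
by rewrite (continuous_open_subspace _ (@chart_dom_open _ M c)); apply; rewrite inE.
Qed.

Lemma chart_inv_cts c x : cimg c x -> {for x, continuous (chart_inv c)}.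
Proof.
move=> cx; have := @chart_inv_continuous _ M c.
by rewrite (continuous_open_subspace _ (@chart_range_open _ M c)); apply; rewrite inE.
Qed.

Lemma tdomP c c' x : tdom c c' x <-> cimg c x /\ chart_dom c' (chart_inv c x).
Proof.
split=> [[p [cp c'p] <-]|[cx c'x]].
  by rewrite chart_mapK//; split => //; exact: cimg_map.
have [dx mx] := cimg_inv cx.
by exists (chart_inv c x).
Qed.

Lemma tdom_map c c' p : chart_dom c p -> chart_dom c' p -> tdom c c' (chart_map c p).
Proof. by move=> cp c'p; exists p. Qed.

Lemma tdom_nbhs c c' x : tdom c c' x -> nbhs x (tdom c c').
Proof.
move=> /tdomP[cx c'x].
have := chart_inv_cts cx (chart_dom_nbhs c'x); rewrite /fmap /=.
apply: filterS2 (cimg_nbhs cx) => y cy c'y; exact/tdomP.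
Qed.

Lemma tdom_open c c' : open (tdom c c').
Proof. by rewrite openE => x; exact: tdom_nbhs. Qed.

Lemma trans_map c c' p : chart_dom c p -> trans c c' (chart_map c p) = chart_map c' p.
Proof. by move=> cp; rewrite /trans /= chart_mapK. Qed.

Lemma trans_diff c c' x : tdom c c' x -> differentiable (trans c c') x.
Proof. by have [+ _] := transition_smooth c c' 1; exact. Qed.

Lemma trans_diff2 c c' x v : tdom c c' x -> differentiable ('D_v (trans c c')) x.
Proof. by have [_ /(_ v)[+ _]] := transition_smooth c c' 2; exact. Qed.

Lemma trans_cts2 c c' x u v : tdom c c' x -> {for x, continuous ('D_u ('D_v (trans c c')))}.
Proof.
move=> cx; have [_ /(_ v)[_ /(_ u) /=]] := transition_smooth c c' 2.
by rewrite (continuous_open_subspace _ (@tdom_open c c')); apply; rewrite inE.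
Qed.

Definition Jac c c' x : 'M[R]_4 := jacobian (trans c c') x.

Lemma Jac_sum c c' x : tdom c c' x ->
  Jac c c' x = \sum_(i < 4) (delta_mx i 0 : 'cV_4) *m 'D_(delta_mx 0 i) (trans c c') x.
Proof. by move=> cx; apply: jacobian_sum; exact: trans_diff. Qed.

Definition dJac c c' x (v : 'rV[R]_4) : 'M[R]_4 :=
  \sum_(i < 4) (delta_mx i 0 : 'cV_4) *m 'D_v ('D_(delta_mx 0 i) (trans c c')) x.

(** Smoothness is expressed by directional derivatives, whereas [Jac] is built from the total
    differential. Written as a sum of columns times partial derivatives, [Jac] inherits
    differentiability from the latter. *)
Lemma Jac_diff c c' x : tdom c c' x ->
  differentiable (Jac c c') x /\ forall v, 'd (Jac c c') x v = dJac c c' x v.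
Proof.
move=> cx.
pose F := fun y => \sum_(i < 4) (delta_mx i 0 : 'cV[R]_4) *m 'D_(delta_mx 0 i) (trans c c') y.
have Fi i : differentiable (mulmx (delta_mx i 0 : 'cV[R]_4) \o 'D_(delta_mx 0 i) (trans c c')) x.
  apply: differentiable_comp; first exact: trans_diff2.
  by case: (linear_diff ('D_(delta_mx 0 i) (trans c c') x) (@mulmx_continuous R 4 1 4 (delta_mx i 0 : 'cV[R]_4))).
have FE : F = \sum_(i < 4) (mulmx (delta_mx i 0 : 'cV[R]_4) \o 'D_(delta_mx 0 i) (trans c c')).
  by apply/funext => y; rewrite fct_sumE.
have Fd : differentiable F x by rewrite FE; apply: differentiable_sum.
have JF : \forall y \near x, F y = Jac c c' y.
  by apply: filterS (tdom_nbhs cx) => y cy; rewrite Jac_sum.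
have Jd : differentiable (Jac c c') x.
  exact: near_differentiable JF Fd.
split => // v; rewrite -(near_diffE v JF)// -deriveE// FE derive_sum; last first.
  by move=> i; exact: diff_derivable.
apply: eq_bigr => i _; rewrite deriveE// diff_comp//=; last first.
  by case: (linear_diff ('D_(delta_mx 0 i) (trans c c') x) (@mulmx_continuous R 4 1 4 (delta_mx i 0 : 'cV[R]_4))).
  exact: trans_diff2.
have [_ ->] := linear_diff ('D_(delta_mx 0 i) (trans c c') x) (@mulmx_continuous R 4 1 4 (delta_mx i 0 : 'cV[R]_4)).
by rewrite deriveE//; exact: trans_diff2.
Qed.

End Charts.

Lemma near_continuous_at (T U : topologicalType) (f g : T -> U) x :
  (\forall y \near x, f y = g y) -> {for x, continuous f} -> {for x, continuous g}.
Proof.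
move=> fg fc; have fgx : f x = g x by exact: nbhs_singleton fg.
have : g y @[y --> x] --> f x by exact: cvg_congr_near fg fc.
by rewrite fgx.
Qed.

Section ChartChanges.
Context {R : realType} (M : manifold4 R).
Implicit Types (c : chart M) (p : M) (x : 'rV[R]_4).

Lemma Jac_comp c c' c'' p : chart_dom c p -> chart_dom c' p -> chart_dom c'' p ->
  Jac c c'' (chart_map c p) = Jac c c' (chart_map c p) *m Jac c' c'' (chart_map c' p).
Proof.
move=> cp c'p c''p.
have t1 := tdom_map cp c'p; have t2 := tdom_map cp c''p; have t3 := tdom_map c'p c''p.
have E : \forall y \near chart_map c p, trans c c'' y = (trans c' c'' \o trans c c') y.
  apply: filterS (tdom_nbhs t1) => y /tdomP[cy c'y].
  by rewrite /trans /= chart_mapK.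
have d3 : differentiable (trans c' c'') (trans c c' (chart_map c p)).
  by rewrite trans_map//; exact: trans_diff.
have d2 := trans_diff t1.
rewrite /Jac (near_jacobianE E (trans_diff t2) (differentiable_comp d2 d3)).
rewrite (jacobian_comp d2 d3).
by rewrite (trans_map c' cp).
Qed.

Lemma Jac_self c p : chart_dom c p -> Jac c c (chart_map c p) = 1%:M.
Proof.
move=> cp; rewrite -(jacobian_id (chart_map c p)); apply: near_jacobianE.
- apply: filterS (cimg_nbhs (cimg_map cp)) => y /cimg_inv[_].
  by rewrite /trans /=.
- by apply: trans_diff; exact: tdom_map.
- by [].
Qed.

Lemma Jac_mulV c c' p : chart_dom c p -> chart_dom c' p ->
  Jac c c' (chart_map c p) *m Jac c' c (chart_map c' p) = 1%:M.
Proof. by move=> cp c'p; rewrite -Jac_comp// Jac_self. Qed.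

Lemma Jac_unit c c' p : chart_dom c p -> chart_dom c' p -> Jac c c' (chart_map c p) \in unitmx.
Proof. by move=> cp c'p; exact: (mulmx1_unit (Jac_mulV cp c'p)).1. Qed.

Lemma tchangeE c p : tchange c p = Jac (chart_at p) c (chart_map (chart_at p) p).
Proof. by []. Qed.

Lemma tchange_self p : tchange (chart_at p) p = 1%:M.
Proof. by rewrite tchangeE; apply: Jac_self; exact: chart_atP. Qed.

#[local] Opaque Jac.

Lemma tchange_unit c p : chart_dom c p -> tchange c p \in unitmx.
Proof. by move=> cp; rewrite tchangeE Jac_unit//; exact: chart_atP. Qed.

Lemma tchange_cocycle c c' p : chart_dom c p -> chart_dom c' p ->
  tchange c' p = tchange c p *m Jac c c' (chart_map c p).
Proof. by move=> cp c'p; rewrite !tchangeE; apply: Jac_comp => //; exact: chart_atP. Qed.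

(** Schwarz's theorem for real functions is applied to each coordinate [ent] of the transition map;
    being linear and continuous, [ent] commutes with directional derivatives. *)
Lemma trans_derive_sym c c' x u v : tdom c c' x ->
  'D_u ('D_v (trans c c')) x = 'D_v ('D_u (trans c c')) x.
Proof.
move=> cx; apply/rowP => j.
pose ent (w : 'rV[R]_4) : R := w 0 j.
have entc : continuous ent by exact: coord_continuous.
have entl : linear ent by move=> a w w'; rewrite /ent !mxE.
pose entL := HB.pack_for {linear 'rV[R]_4 -> R} ent (GRing.isLinear.Build _ _ _ _ ent entl).
have entd y : differentiable ent y by have [] := @linear_diff R _ _ entL y entc.
have entD y : 'd ent y = ent :> (_ -> _) by have [_] := @linear_diff R _ _ entL y entc.
have cE (f : 'rV[R]_4 -> 'rV[R]_4) y w : differentiable f y -> 'D_w (ent \o f) y = ent ('D_w f y).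
  move=> fd; rewrite [LHS]deriveE; last exact: differentiable_comp.
  by rewrite diff_comp//= entD -deriveE.
have D1 w y : tdom c c' y -> 'D_w (ent \o trans c c') y = ent ('D_w (trans c c') y).
  by move=> cy; apply: cE; exact: trans_diff.
have D1d w y : tdom c c' y -> differentiable ('D_w (ent \o trans c c')) y.
  move=> cy; apply: (@near_differentiable R _ _ (ent \o 'D_w (trans c c'))).
    by apply: filterS (tdom_nbhs cy) => z cz; rewrite D1.
  by apply: differentiable_comp => //; exact: trans_diff2.
have D2 w w' y : tdom c c' y ->
    'D_w ('D_w' (ent \o trans c c')) y = ent ('D_w ('D_w' (trans c c')) y).
  move=> cy; rewrite -cE; last exact: trans_diff2.
  have dd := D1d w' y cy.
  have dd' : differentiable (ent \o 'D_w' (trans c c')) y.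
    by apply: differentiable_comp => //; exact: trans_diff2.
  have H : \forall z \near y, 'D_w' (ent \o trans c c') z = (ent \o 'D_w' (trans c c')) z.
    by apply: filterS (tdom_nbhs cy) => z cz; rewrite D1.
  apply: etrans (deriveE w dd) _; apply: etrans _ (esym (deriveE w dd')).
  exact: (near_diffE w H dd dd').
apply: etrans (esym (D2 u v x cx)) _; apply: etrans _ (D2 v u x cx).
have cc w w' : {for x, continuous ('D_w ('D_w' (ent \o trans c c')))}.
  apply: (@near_continuous_at _ _ (ent \o 'D_w ('D_w' (trans c c')))).
    by apply: filterS (tdom_nbhs cx) => z cz; rewrite D2.
  by apply: continuous_comp; [exact: trans_cts2|exact: entc].
apply: (schwarz (tdom_nbhs cx)) => [y cy||]; [|exact: cc|exact: cc].
split; [|exact: D1d|exact: D1d].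
by apply: differentiable_comp => //; exact: trans_diff.
Qed.

Lemma mul_dJac c c' x v w : tdom c c' x ->
  w *m dJac c c' x v = \sum_(i < 4) \sum_(k < 4) w 0 i *: (v 0 k *:
    'D_(delta_mx 0 k) ('D_(delta_mx 0 i) (trans c c')) x).
Proof.
move=> cx; rewrite /dJac mulmx_sumr; apply: eq_bigr => i _.
rewrite mulmxA -scaler_sumr; have dd := trans_diff2 (delta_mx 0 i) cx.
rewrite -(diff_sum_delta v dd) -deriveE//.
have -> : (w *m delta_mx i 0 = (w 0 i)%:M :> 'M[R]_1).
  apply/matrixP => a b; rewrite !ord1 !mxE (bigD1 i)//= big1 => [|j ji]; rewrite !mxE ?eqxx ?mulr1 ?addr0//.
  by rewrite (negbTE ji) mulr0.
by rewrite mul_scalar_mx.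
Qed.

(** The symmetry of second derivatives, in the shape in which it is combined with
    torsion-freeness. *)
Lemma mul_dJac_sym c c' x v w : tdom c c' x -> w *m dJac c c' x v = v *m dJac c c' x w.
Proof.
move=> cx; rewrite !mul_dJac// exchange_big; apply: eq_bigr => k _; apply: eq_bigr => i _.
by rewrite !scalerA mulrC trans_derive_sym.
Qed.

Lemma dJac_cts c c' (T : Type) (F : set_system T) (FF : Filter F)
    (f g : T -> 'rV[R]_4) x v : tdom c c' x ->
  f s @[s --> F] --> x -> g s @[s --> F] --> v ->
  dJac c c' (f s) (g s) @[s --> F] --> dJac c c' x v.
Proof.
move=> cx fx gv.
have E y w : tdom c c' y -> dJac c c' y w =
  \sum_(i < 4) (delta_mx i 0 : 'cV[R]_4) *m (\sum_(k < 4) w 0 k *: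
    'D_(delta_mx 0 k) ('D_(delta_mx 0 i) (trans c c')) y).
  move=> cy; apply: eq_bigr => i _; have dd := trans_diff2 (delta_mx 0 i) cy.
  by rewrite -(diff_sum_delta w dd) -deriveE.
rewrite E//; apply: (@cvg_congr_near _ _ _ _ (fun s => \sum_(i < 4) (delta_mx i 0 : 'cV[R]_4) *m
   (\sum_(k < 4) g s 0 k *: 'D_(delta_mx 0 k) ('D_(delta_mx 0 i) (trans c c')) (f s)))).
  by apply: (@filterS _ F _ _ _ _ (fx _ (tdom_nbhs cx))) => s cs; rewrite E.
apply: cvg_sumr => i _; apply: cvg_mulmx; first exact: cvg_cst.
apply: cvg_sumr => k _; apply: cvgZ; first exact: cvg_entry.
apply: (cvg_comp f ('D_(delta_mx 0 k) ('D_(delta_mx 0 i) (trans c c'))) fx).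
exact: trans_cts2.
Qed.

End ChartChanges.

(** * The Levi-Civita connection under changes of charts *)

#[local] Opaque dJac.

Section LeviCivita.
Context {R : realType} (S : spacetime R).
Implicit Types (c : chart S) (p : S) (x v w xi : 'rV[R]_4).

Lemma minkowski_sq : Defs.minkowski R *m Defs.minkowski R = 1%:M.
Proof.
rewrite /Defs.minkowski mulmx_diag; apply/matrixP => i j; rewrite !mxE.
by case: ifP => _; rewrite ?mulrN ?mulNr ?opprK ?mulr1.
Qed.

Lemma minkowski_unit : Defs.minkowski R \in unitmx.
Proof. exact: (mulmx1_unit minkowski_sq).1. Qed.

Lemma metric_unit p : metric p \in unitmx.
Proof.
have [P Pu PE] := metric_lorentz p.
have := minkowski_unit; rewrite -PE !unitmx_mul => /andP[/andP[_ ->]].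
by [].
Qed.

Lemma metric_in_map c p : metric_in c (chart_map c p) =
  let q := chart_inv c (chart_map c p) in
  invmx (tchange c q) *m metric q *m (invmx (tchange c q))^T.
Proof. by []. Qed.

Lemma metric_chart c p : chart_dom c p ->
  metric p = tchange c p *m metric_in c (chart_map c p) *m (tchange c p)^T.
Proof.
move=> cp; rewrite metric_in_map /= chart_mapK//.
have uT := tchange_unit cp.
rewrite !mulmxA mulmxV// mul1mx -mulmxA -trmx_mul mulmxV// trmx1 mulmx1.
by [].
Qed.

Lemma metric_in_sym c x : (metric_in c x)^T = metric_in c x.
Proof. by rewrite /metric_in /= !trmx_mul trmxK Defs.metric_sym mulmxA. Qed.

Lemma metric_in_unit c x : cimg c x -> metric_in c x \in unitmx.
Proof.
move=> /cimg_inv[cx _]; rewrite /metric_in /= !unitmx_mul unitmx_tr unitmx_inv.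
by rewrite (tchange_unit cx) metric_unit.
Qed.

Lemma metric_in_diff c x : cimg c x -> differentiable (metric_in c) x.
Proof. by have [+ _] := metric_smooth c 1; exact. Qed.

Lemma metric_in_dcts c x v : cimg c x -> {for x, continuous ('D_v (metric_in c))}.
Proof.
move=> cx; have [_ /(_ v) /=] := metric_smooth c 1.
rewrite (continuous_open_subspace _ (@chart_range_open _ S c)) => H.
by apply: H; rewrite inE.
Qed.

Lemma metric_in_cts c x : cimg c x -> {for x, continuous (metric_in c)}.
Proof. by move=> cx; apply: differentiable_continuous; exact: metric_in_diff. Qed.

Lemma congr_cancel (T J G : 'M[R]_4) : T \in unitmx ->
  invmx T *m (T *m J *m G *m (T *m J)^T) *m (invmx T)^T = J *m G *m J^T.
Proof.
move=> uT; rewrite trmx_mul -!mulmxA -trmx_mul (mulVmx uT) trmx1 mulmx1.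
by rewrite !mulmxA mulVmx// mul1mx.
Qed.

Lemma metric_trans c c' x : tdom c c' x ->
  metric_in c x = Jac c c' x *m metric_in c' (trans c c' x) *m (Jac c c' x)^T.
Proof.
move=> /tdomP[cx c'x]; have [dx mx] := cimg_inv cx.
set p := chart_inv c x in dx c'x mx.
have H2 : metric_in c x = invmx (tchange c p) *m metric p *m (invmx (tchange c p))^T by [].
rewrite H2 (metric_chart c'x) (tchange_cocycle dx c'x) mx.
exact: congr_cancel (tchange_unit dx).
Qed.

Lemma dmetricE c x i : dmetric c x i = 'D_(delta_mx 0 i) (metric_in c) x.
Proof. by []. Qed.

#[local] Opaque metric_in dmetric.

Lemma dmetric_sym c x i : cimg c x -> (dmetric c x i)^T = dmetric c x i.
Proof.
move=> cx; apply/matrixP => j k; rewrite mxE !dmetricE.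
rewrite derive_mx; last exact/diff_derivable/metric_in_diff.
rewrite [LHS]mxE [RHS]mxE.
have -> // : (fun y => metric_in c y k j) = (fun y => metric_in c y j k).
by apply/funext => y; rewrite -[in LHS]metric_in_sym mxE.
Qed.

Lemma dmetric_symE c x i j k : cimg c x -> dmetric c x i j k = dmetric c x i k j.
Proof.
move=> cx; have := congr1 (fun A : 'M[R]_4 => A k j) (dmetric_sym i cx).
by rewrite mxE.
Qed.

Lemma cvg_matrix (T : Type) (F : set_system T) (FF : Filter F) m n
    (f : T -> 'I_m -> 'I_n -> R) (l : 'I_m -> 'I_n -> R) :
  (forall i j, f x i j @[x --> F] --> l i j) ->
  \matrix_(i, j) f x i j @[x --> F] --> \matrix_(i, j) l i j.
Proof.
move=> fl; apply: cvg_mx => i j; rewrite mxE.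
by under eq_cvg do rewrite mxE; exact: fl.
Qed.

Definition Gam c x i : 'M[R]_4 := \matrix_(j, k) christoffel c x i j k.

Lemma christoffel_mxE c x xi : christoffel_mx c x xi = \sum_(i < 4) xi 0 i *: Gam c x i.
Proof.
apply/matrixP => j k; rewrite mxE summxE; apply: eq_bigr => i _; by rewrite !mxE.
Qed.

Lemma christoffel_mxZ c x a xi : christoffel_mx c x (a *: xi) = a *: christoffel_mx c x xi.
Proof.
by rewrite !christoffel_mxE scaler_sumr; apply: eq_bigr => i _; rewrite mxE scalerA.
Qed.

Let swap (a b d a' b' d' : R) : a = a' -> b = b' -> d = d' -> a + b - d = b' + a' - d'.
Proof. by move=> -> -> ->; rewrite [a' + b']addrC. Qed.

Lemma christoffel_sym c x i j k : cimg c x -> christoffel c x i j k = christoffel c x j i k.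
Proof.
move=> cx; rewrite /christoffel; congr (_ * _); apply: eq_bigr => l _; congr (_ * _).
exact: (swap (dmetric_symE i l j cx) (dmetric_symE j i l cx) (dmetric_symE l i j cx)).
Qed.

(** Torsion-freeness of the connection in a chart. *)
Lemma christoffel_mx_sym c x v w : cimg c x ->
  v *m christoffel_mx c x w = w *m christoffel_mx c x v.
Proof.
move=> cx; apply/rowP => k; rewrite !mxE.
under eq_bigr do rewrite mxE mulr_sumr.
under [RHS]eq_bigr do rewrite mxE mulr_sumr.
rewrite exchange_big; apply: eq_bigr => i _; apply: eq_bigr => j _.
by rewrite christoffel_sym// mulrCA.
Qed.

Let half (a b d e : R) : a = d -> 2^-1 * (a + b - e) + 2^-1 * (d + e - b) = d.
Proof. by move=> ->; field. Qed.

(** Metric compatibility in the i-th coordinate direction: lowering the upper index gives the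
    Christoffel symbols of the first kind, and in their symmetrization all but one derivative of the
    metric cancel. *)
Lemma Gam_metric c x i : cimg c x ->
  Gam c x i *m metric_in c x + (Gam c x i *m metric_in c x)^T = dmetric c x i.
Proof.
move=> cx; set g := metric_in c x.
have gs : (invmx g)^T = invmx g by rewrite trmx_inv metric_in_sym.
have gV : invmx g *m g = 1%:M by rewrite mulVmx// metric_in_unit.
(* These are the symbols of the first kind: the inverse metric in [christoffel] cancels against the
   metric, which leaves only the term [l = m]. *)
have low j m : (Gam c x i *m g) j m =
    2^-1 * (dmetric c x i m j + dmetric c x j i m - dmetric c x m i j).
  rewrite mxE; under eq_bigr do rewrite mxE /christoffel -mulrA mulr_suml.
  rewrite -mulr_sumr exchange_big; congr (_ * _).
  rewrite (bigD1 m)//= [X in _ + X]big1 => [|l lm].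
    under eq_bigr do rewrite mulrAC.
    rewrite -mulr_suml (_ : \sum_(k < 4) _ = 1) ?mul1r ?addr0//.
    have := congr1 (fun A : 'M[R]_4 => A m m) gV; rewrite [RHS]mxE eqxx mulr1n [LHS]mxE => <-.
    by apply: eq_bigr => k _; rewrite -[in RHS]gs [in RHS]mxE.
  under eq_bigr do rewrite mulrAC.
  rewrite -mulr_suml (_ : \sum_(k < 4) _ = 0) ?mul0r//.
  have := congr1 (fun A : 'M[R]_4 => A l m) gV; rewrite [RHS]mxE (negbTE lm) mulr0n [LHS]mxE => E.
  rewrite -[RHS]E.
  by apply: eq_bigr => k _; rewrite -[in RHS]gs [in RHS]mxE.
apply/matrixP => j m; rewrite [LHS]mxE [X in _ + X]mxE.
apply: etrans (congr2 +%R (low j m) (low m j)) _.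
exact: half (dmetric_symE i m j cx).
Qed.

Lemma christoffel_metric c x xi : cimg c x ->
  'd (metric_in c) x xi =
  christoffel_mx c x xi *m metric_in c x + (christoffel_mx c x xi *m metric_in c x)^T.
Proof.
move=> cx; rewrite (diff_sum_delta xi (metric_in_diff cx)) christoffel_mxE.
rewrite mulmx_suml linear_sum -big_split; apply: eq_bigr => i _ /=.
by rewrite -scalemxAl linearZ /= -scalerDr Gam_metric.
Qed.

Lemma Gam_cts c x i : cimg c x -> {for x, continuous (fun y => Gam c y i)}.
Proof.
move=> cx; suff H : Gam c y i @[y --> x] --> Gam c x i by exact: H.
rewrite /Gam; apply: (@cvg_matrix _ (nbhs x) _) => j k; rewrite /christoffel.
apply: (@cvgM _ _ (nbhs x)); first exact: cvg_cst.
apply: (@cvg_sumr R _ (nbhs x)) => l _; apply: (@cvgM _ _ (nbhs x)).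
  apply: (@cvg_entry R _ (nbhs x)); apply: (@cvg_invmx R _ (nbhs x)).
    exact: metric_in_unit.
  exact: metric_in_cts.
by apply: (@cvgB _ _ _ (nbhs x)); [apply: (@cvgD _ _ _ (nbhs x))|];
  apply: (@cvg_entry R _ (nbhs x)); exact: metric_in_dcts.
Qed.

Lemma christoffel_mx_cvg c (T : Type) (F : set_system T) (FF : Filter F)
    (f g : T -> 'rV[R]_4) x v : cimg c x ->
  f s @[s --> F] --> x -> g s @[s --> F] --> v ->
  christoffel_mx c (f s) (g s) @[s --> F] --> christoffel_mx c x v.
Proof.
move=> cx fx gv; rewrite christoffel_mxE; under eq_cvg do rewrite christoffel_mxE.
apply: cvg_sumr => i _; apply: cvgZ; first exact: cvg_entry.
apply: (cvg_comp f (fun y => Gam c y i) fx); exact: Gam_cts.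
Qed.

(* The uniqueness part of the fundamental theorem of Riemannian geometry: T is the
   difference of two torsion-free metric connections, seen in two charts. *)
Lemma sym_skew_eq0 (T : 'rV[R]_4 -> 'M[R]_4) (J g : 'M[R]_4) :
  (forall v w, v *m T w = w *m T v) ->
  J \in unitmx -> g \in unitmx ->
  (forall v, T v *m g *m J^T = - (T v *m g *m J^T)^T) -> forall v, T v = 0.
Proof.
move=> Ts uJ ug Tk v.
pose B (a b d : 'rV[R]_4) := (b *m (T a *m g *m J^T) *m d^T) 0 0.
have B1 a b d : B a b d = B b a d by rewrite /B !mulmxA Ts.
have B2 a b d : B a b d = - B a d b.
  rewrite /B [in LHS]Tk mulmxN mulNmx mxE; congr (- _).
  have tr11 (A : 'M[R]_1) : A 0 0 = A^T 0 0 by rewrite mxE.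
  by rewrite [LHS]tr11 !trmx_mul !trmxK !mulmxA.
have B0 a b d : B a b d = 0.
  (* Six alternating exchanges, three symmetric in the first two arguments and three skew in the
     last two, restore the order of the arguments and change the sign. *)
  have : B a b d = - B a b d.
    by rewrite {1}B1 B2 B1 B2 opprK B1 B2.
  lra.
have TgJ : T v *m g *m J^T = 0.
  apply/matrixP => i j; rewrite [RHS]mxE.
  have := B0 v (delta_mx 0 i) (delta_mx 0 j).
  by rewrite /B -rowE trmx_delta -colE !mxE.
have uJt : J^T \in unitmx by rewrite unitmx_tr.
by rewrite -[T v](mulmxK ug) -[T v *m g](mulmxK uJt) TgJ !mul0mx.
Qed.

(** The derivative of [gc = J g J^T] is computed twice: by compatibility of A with gc, and by the
    Leibniz rule with compatibility of B with g. This gives [X + X^T = Y + Y^T], so [X - Y] is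
    skew. *)
Lemma skew_of_metric (A B D J g gc dc dc' : 'M[R]_4) :
  g^T = g -> gc = J *m g *m J^T -> dc = A *m gc + (A *m gc)^T ->
  dc' = B *m g + (B *m g)^T -> dc = (D *m g + J *m dc') *m J^T + J *m g *m D^T ->
  (A *m J - (D + J *m B)) *m g *m J^T = - ((A *m J - (D + J *m B)) *m g *m J^T)^T.
Proof.
move=> gs -> -> -> H.
pose X := A *m (J *m g *m J^T); pose Y := (D *m g + J *m (B *m g)) *m J^T.
have E : (A *m J - (D + J *m B)) *m g *m J^T = X - Y.
  by rewrite /X /Y !mulmxBl !mulmxDl !mulmxA.
have YT : Y^T = J *m (g *m D^T + (B *m g)^T *m J^T).
  by rewrite /Y trmx_mul trmxK linearD /= !trmx_mul gs.
have {}H : X + X^T = Y + Y^T.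
  by rewrite H YT /Y !mulmxDr !mulmxDl !mulmxA -!addrA; congr (_ + (_ + _)); rewrite addrC.
apply/eqP; rewrite E -addr_eq0 linearB /=.
by rewrite addrACA -opprD H subrr.
Qed.

(** The inhomogeneous transformation law. The difference of the two sides is a tensor in xi: it is
    symmetric, since both connections are torsion-free and second derivatives commute, and it is
    skew with respect to the metric, since both connections are compatible with it. Such a tensor
    vanishes by [sym_skew_eq0]. *)
Lemma christoffel_trans c c' x xi : tdom c c' x ->
  christoffel_mx c x xi *m Jac c c' x =
  dJac c c' x xi + Jac c c' x *m christoffel_mx c' (trans c c' x) (xi *m Jac c c' x).
Proof.
move=> cx; have [cx1 c'x] := (tdomP _ _ _).1 cx; have [dx mx] := cimg_inv cx1.
have cx' : cimg c' (trans c c' x) by exact: cimg_map.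
set J := Jac c c' x; set g := metric_in c' (trans c c' x).
have uJ : J \in unitmx by rewrite /J -mx; exact: Jac_unit.
have ug : g \in unitmx by exact: metric_in_unit.
pose Ga := fun v => christoffel_mx c x v.
pose Gb := fun v => christoffel_mx c' (trans c c' x) v.
suff : Ga xi *m J - (dJac c c' x xi + J *m Gb (xi *m J)) = 0.
  by move/eqP; rewrite subr_eq0 => /eqP.
apply: (@sym_skew_eq0 (fun v => Ga v *m J - (dJac c c' x v + J *m Gb (v *m J))) J g) => //.
  move=> v w; rewrite !mulmxBr !mulmxDr !mulmxA (mul_dJac_sym v w cx).
  by rewrite /Ga /Gb (christoffel_mx_sym v w cx1) (christoffel_mx_sym (v *m J) (w *m J) cx').
move=> v.
(* Both sides of [metric_trans] are differentiated at 0 along the line through x with direction v;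
   uniqueness of the derivative gives the identity that [skew_of_metric] requires. *)
pose ln (s : R) : 'rV[R]_4 := x + s *: v.
have lnd : dw setT ln 0 v.
  have h1 : dw setT (fun s : R => s *: v) 0 (1 *: v + 0 *: (0 : 'rV[R]_4)).
    by apply: dwZ => //; [exact: dw_id|exact: dw_cst].
  have := dwD (dw_cst setT x 0) h1.
  by rewrite scale1r scaler0 addr0 add0r.
have ln0 : ln 0 = x by rewrite /ln scale0r addr0.
have dg : dw setT (metric_in c \o ln) 0 ('d (metric_in c) x v).
  rewrite -[in 'd _ _ _]ln0; apply: dw_diff => //; rewrite ln0; exact: metric_in_diff.
have dJ : dw setT (Jac c c' \o ln) 0 (dJac c c' x v).
  have [Jd <-] := Jac_diff cx.
  by rewrite -[in 'd _ _ _]ln0; apply: dw_diff => //; rewrite ln0.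
have dt : dw setT (trans c c' \o ln) 0 (v *m J).
  have td := trans_diff cx.
  have <- : 'd (trans c c') x v = v *m J by rewrite -deriveE// deriveEjacobian.
  by rewrite -[in 'd _ _ _]ln0; apply: dw_diff => //; rewrite ln0.
have dg' : dw setT (metric_in c' \o (trans c c' \o ln)) 0
    ('d (metric_in c') (trans c c' x) (v *m J)).
  rewrite -[in 'd _ _ _]ln0; apply: dw_diff => //; rewrite /= ln0; exact: metric_in_diff.
have dprod := dw_mulmx I (dw_mulmx I dJ dg') (dw_trmx dJ).
have dprod' : dw setT (metric_in c \o ln) 0 ((dJac c c' x v *m g + J *m 'd (metric_in c') (trans c c' x) (v *m J)) *m J^T + J *m g *m (dJac c c' x v)^T).
  move: dprod; rewrite /= ln0; apply: dw_near => //.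
  have lnc := dw_continuous I lnd; rewrite ln0 in lnc.
  apply: (@filterS _ (within setT (nbhs (0 : R))) _ _ _ _ (lnc _ (tdom_nbhs cx))) => s ts.
  by rewrite /= (metric_trans ts).
have PF : ProperFilter (within [set: R] 0^').
  by rewrite withinET; exact: Proper_dnbhs_numFieldType.
exact: (skew_of_metric (metric_in_sym c' (trans c c' x)) (metric_trans cx)
  (christoffel_metric v cx1) (christoffel_metric (v *m J) cx') (dw_unique PF dg dprod')).
Qed.

End LeviCivita.

(** * The connection and canonical forms along a curve of frames *)

#[local] Opaque tchange christoffel_mx.

Section FrameCurves.
Context {R : realType} (S : spacetime R).
Implicit Types (c : chart S) (D : set R) (u : R -> frame S).

Lemma mulmx1_invmx n (A B : 'M[R]_n) : A *m B = 1%:M -> invmx A = B.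
Proof.
move=> AB; have uA := (mulmx1_unit AB).1.
by rewrite -[RHS]mul1mx -(mulVmx uA) -mulmxA AB mulmx1.
Qed.

Lemma invmx_mul n (A B : 'M[R]_n) : A \in unitmx -> B \in unitmx ->
  invmx (A *m B) = invmx B *m invmx A.
Proof.
move=> uA uB; apply: mulmx1_invmx.
by rewrite mulmxA -[A *m B *m _]mulmxA mulmxV// mulmx1 mulmxV.
Qed.

Lemma fcomp_unit c (f : frame S) : chart_dom c (fpt f) -> fcomp c f \in unitmx.
Proof. by move=> cf; rewrite /fcomp unitmx_mul fmat_unit tchange_unit. Qed.

Lemma fcomp_self (f : frame S) : fcomp (chart_at (fpt f)) f = fmat f.
Proof. by rewrite /fcomp tchange_self mulmx1. Qed.

Lemma fcomp_trans c c' (f : frame S) : chart_dom c (fpt f) -> chart_dom c' (fpt f) ->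
  fcomp c' f = fcomp c f *m Jac c c' (chart_map c (fpt f)).
Proof. by move=> cf c'f; rewrite /fcomp (tchange_cocycle cf c'f) mulmxA. Qed.

Definition om D u t : 'M[R]_4 := omega (u t) (frame_velocity D u t).
Definition th D u t : 'rV[R]_4 := theta (u t) (frame_velocity D u t).

(** The pointwise form of [C1_frame_curve]. A curve glued from two pieces can be checked at each
    parameter, where it agrees locally with one of them. *)
Definition C1f_at D u t : Prop :=
  fpt (u s) @[s --> within D (nbhs t)] --> fpt (u t) /\
  forall c, chart_dom c (fpt (u t)) ->
    C1_within_at D (chart_map c \o (@fpt _ S \o u)) t /\ C1_within_at D (fcomp c \o u) t.

Lemma C1_frame_curveP D u : C1_frame_curve D u <-> forall t, D t -> C1f_at D u t.
Proof.
split=> [[[uc ux] ue] t Dt|uC].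
  split; first by move/subspace_continuousP : uc; exact.
  by move=> c cu; split; [exact: ux|exact: ue].
split; [split|].
- by apply/subspace_continuousP => t Dt; have [] := uC t Dt.
- by move=> c t Dt cu; have [_ /(_ c cu)[]] := uC t Dt.
- by move=> c t Dt cu; have [_ /(_ c cu)[]] := uC t Dt.
Qed.

Lemma near_dom D u t c : C1f_at D u t -> chart_dom c (fpt (u t)) ->
  \forall s \near within D (nbhs t), chart_dom c (fpt (u s)).
Proof. by move=> [uc _] cu; exact: (uc _ (chart_dom_nbhs cu)). Qed.

Definition xdot D u c t : 'rV[R]_4 := deriv_within D (chart_map c \o (@fpt _ S \o u)) t.
Definition edot D u c t : 'M[R]_4 := deriv_within D (fcomp c \o u) t.

Section Transition.
Variables (D : set R) (u : R -> frame S) (t : R) (c c' : chart S).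
Variables (x' : 'rV[R]_4) (E' : 'M[R]_4).
Hypotheses (Dt : D t) (cu : chart_dom c (fpt (u t))) (cu' : chart_dom c' (fpt (u t))).
Hypothesis uc : fpt (u s) @[s --> within D (nbhs t)] --> fpt (u t).
Hypothesis dx : dw D (chart_map c \o (@fpt _ S \o u)) t x'.
Hypothesis dE : dw D (fcomp c \o u) t E'.
Let x := chart_map c (fpt (u t)).

Lemma dw_xtrans : dw D (chart_map c' \o (@fpt _ S \o u)) t (x' *m Jac c c' x).
Proof.
have tx := tdom_map cu cu'; have td := trans_diff tx.
have H : dw D (trans c c' \o (chart_map c \o (@fpt _ S \o u))) t ('d (trans c c') x x').
  exact: dw_diff.
have E : 'd (trans c c') x x' = x' *m Jac c c' x.
  exact: etrans (esym (deriveE x' td)) (deriveEjacobian x' td).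
rewrite -E; apply: dw_near H => //.
apply: (@filterS _ (within D (nbhs t)) _ _ _ _ (uc (chart_dom_nbhs cu))) => s cs.
by rewrite /= (trans_map c' cs).
Qed.

(** The Leibniz rule for the frame components times the Jacobian. The term with [dJac] is the one
    that the transformation law of the Christoffel symbols compensates. *)
Lemma dw_etrans : dw D (fcomp c' \o u) t
  (E' *m Jac c c' x + fcomp c (u t) *m dJac c c' x x').
Proof.
have tx := tdom_map cu cu'; have [Jd JE] := Jac_diff tx.
have H : dw D (Jac c c' \o (chart_map c \o (@fpt _ S \o u))) t ('d (Jac c c') x x').
  exact: dw_diff.
rewrite JE in H; have := dw_mulmx Dt dE H.
apply: dw_near => //.
have N1 : \forall s \near within D (nbhs t), chart_dom c (fpt (u s)) by exact: uc (chart_dom_nbhs cu).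
have N2 : \forall s \near within D (nbhs t), chart_dom c' (fpt (u s)) by exact: uc (chart_dom_nbhs cu').
apply: filterS2 N1 N2 => s cs cs'.
by rewrite /= (fcomp_trans cs cs').
Qed.

End Transition.

(** The connection form in an arbitrary chart: E holds the components of the frame, G is the
    Christoffel matrix contracted with the velocity, and E' is the derivative of E. *)
Definition omf (E G E' : 'M[R]_4) : 'M[R]_4 := ((E' + E *m G) *m invmx E)^T.

(** The inhomogeneous terms in the derivative of the frame and in the Christoffel matrix cancel, so
    both forms may be computed in any chart around the point. With c fixed near t the expressions
    become continuous in t. *)
Lemma om_th_chart D u t c : perfect_in D -> D t -> C1f_at D u t -> chart_dom c (fpt (u t)) ->
  om D u t = omf (fcomp c (u t)) (christoffel_mx c (chart_map c (fpt (u t))) (xdot D u c t))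
    (edot D u c t) /\
  th D u t = xdot D u c t *m invmx (fcomp c (u t)).
Proof.
move=> pD Dt uC cu; have PF := pD t Dt.
set p := fpt (u t); pose c0 := chart_at p.
have c0u : chart_dom c0 (fpt (u t)) by exact: chart_atP.
have [uc H] := uC; have [/C1_within_at_dw dx0 /C1_within_at_dw de0] := H c0 c0u.
have [/C1_within_at_dw dx /C1_within_at_dw de] := H c cu.
rewrite -/(xdot D u c t) in dx; rewrite -/(edot D u c t) in de.
rewrite -/(xdot D u c0 t) in dx0; rewrite -/(edot D u c0 t) in de0.
have Ex := dw_unique PF dx (dw_xtrans Dt c0u cu uc dx0).
have Ee := dw_unique PF de (dw_etrans Dt c0u cu uc dx0 de0).
have tx := tdom_map c0u cu.
have CT := christoffel_trans (xdot D u c0 t) tx.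
rewrite (trans_map c c0u) in CT.
have uJ := Jac_unit c0u cu.
have uE := fmat_unit (u t).
have Ef : fcomp c (u t) = fmat (u t) *m Jac c0 c (chart_map c0 p).
  by rewrite (fcomp_trans c0u cu) fcomp_self.
have -> : om D u t = ((edot D u c0 t + fmat (u t) *m christoffel_mx c0 (chart_map c0 p) (xdot D u c0 t)) *m
  invmx (fmat (u t)))^T by [].
have -> : th D u t = xdot D u c0 t *m invmx (fmat (u t)) by [].
rewrite Ex Ee Ef /omf (invmx_mul uE uJ) fcomp_self.
move: CT uJ uE; move: (Jac c0 c _) (dJac c0 c _ _) (christoffel_mx c0 _ _) (christoffel_mx c _ _).
move: (fmat (u t)) (xdot D u c0 t) (edot D u c0 t) => E x' E' J dJ G0 G1 CT uJ uE.
split; last by rewrite !mulmxA -[x' *m J *m _]mulmxA mulmxV// mulmx1.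
congr (_^T); rewrite -[E *m J *m G1]mulmxA -addrA -mulmxDr -CT mulmxA -mulmxDl.
by rewrite mulmxA -[_ *m J *m invmx J]mulmxA mulmxV// mulmx1.
Qed.

Lemma om_th_cts D u t : perfect_in D -> D t -> C1_frame_curve D u ->
  om D u s @[s --> within D (nbhs t)] --> om D u t /\
  th D u s @[s --> within D (nbhs t)] --> th D u t.
Proof.
move=> pD Dt /C1_frame_curveP uC; pose c := chart_at (fpt (u t)).
have cu : chart_dom c (fpt (u t)) by exact: chart_atP.
have N : \forall s \near within D (nbhs t), D s /\ chart_dom c (fpt (u s)).
  by apply: filterI; [exact: withinT|exact: near_dom (uC t Dt) cu].
have [uc /(_ c cu)[xC eC]] := uC t Dt.
have xc := dw_continuous Dt (C1_within_at_dw xC).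
have ec := dw_continuous Dt (C1_within_at_dw eC).
have [_ x'c] := xC; have [_ e'c] := eC.
rewrite -/(xdot D u c) -/(xdot D u c t) in x'c; rewrite -/(edot D u c) -/(edot D u c t) in e'c.
have [omE thE] := om_th_chart pD Dt (uC t Dt) cu.
have ei : invmx (fcomp c (u s)) @[s --> within D (nbhs t)] --> invmx (fcomp c (u t)).
  exact: (cvg_invmx (fcomp_unit cu) ec).
have Gc : christoffel_mx c (chart_map c (fpt (u s))) (xdot D u c s) @[s --> within D (nbhs t)] -->
    christoffel_mx c (chart_map c (fpt (u t))) (xdot D u c t).
  exact: (christoffel_mx_cvg _ (cimg_map cu) xc x'c).
have eGc : edot D u c s + fcomp c (u s) *m
    christoffel_mx c (chart_map c (fpt (u s))) (xdot D u c s) @[s --> within D (nbhs t)] -->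
    edot D u c t + fcomp c (u t) *m christoffel_mx c (chart_map c (fpt (u t))) (xdot D u c t).
  by apply: cvgD => //; exact: cvg_mulmx ec Gc.
split.
  rewrite omE; apply: (@cvg_congr_near _ _ (within D (nbhs t)) _ (fun s => omf (fcomp c (u s))
    (christoffel_mx c (chart_map c (fpt (u s))) (xdot D u c s)) (edot D u c s))).
    apply: filterS N => s [Ds cs]; exact: esym (om_th_chart pD Ds (uC s Ds) cs).1.
  exact: (cvg_trmx (cvg_mulmx eGc ei)).
rewrite thE; apply: (@cvg_congr_near _ _ (within D (nbhs t)) _
  (fun s => xdot D u c s *m invmx (fcomp c (u s)))).
  apply: filterS N => s [Ds cs]; exact: esym (om_th_chart pD Ds (uC s Ds) cs).2.
exact: (cvg_mulmx x'c ei).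
Qed.

End FrameCurves.

(** * Reparametrization of curves of frames *)

Section Reparametrization.
Context {R : realType}.

Lemma deriv_within_near (V : normedModType R) (D : set R) (f g : R -> V) t : D t ->
  (\forall r \near within D (nbhs t), f r = g r) -> deriv_within D f t = deriv_within D g t.
Proof.
move=> Dt fg; have tt := fg; rewrite near_withinE in tt.
have e := nbhs_singleton tt Dt.
rewrite /deriv_within; congr (lim _).
have H : \forall r \near within D t^', diff_quot f t r = diff_quot g t r.
  rewrite near_withinE near_withinE; move: fg; rewrite near_withinE.
  by apply: filterS => r H _ Dr; rewrite /diff_quot H// e.
rewrite eqEsubset; split; apply: near_eq_cvg; first exact: H.
by apply: filterS H => r ->.
Qed.

Lemma C1_reparam (V : normedModType R) (D D' : set R) (psi psi' : R -> R) (f : R -> V) t :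
  perfect_in D -> perfect_in D' -> D' t -> (forall s, D' s -> D (psi s)) ->
  (forall s, D' s -> dw D' psi s (psi' s)) ->
  psi' s @[s --> within D' (nbhs t)] --> psi' t ->
  (\forall s \near within D (nbhs (psi t)), C1_within_at D f s) ->
  C1_within_at D' (f \o psi) t /\
  deriv_within D' (f \o psi) t = psi' t *: deriv_within D f (psi t).
Proof.
move=> pD pD' D't DD' psid psic fC.
have pc := cvg_within_comp D't DD' (dw_continuous D't (psid _ D't)).
have fCt : C1_within_at D f (psi t).
  by move: fC; rewrite near_withinE => /nbhs_singleton; apply; exact: DD'.
have dn : \forall s \near within D' (nbhs t),
    dw D' (f \o psi) s (psi' s *: deriv_within D f (psi s)).
  have N1 : \forall s \near within D' (nbhs t), C1_within_at D f (psi s) by exact: pc fC.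
  have N2 : \forall s \near within D' (nbhs t), D' s by exact: withinT.
  apply: filterS2 N1 N2 => s Cs D's.
  by apply: (dw_comp D's DD' (psid s D's)); exact: C1_within_at_dw.
have dt : dw D' (f \o psi) t (psi' t *: deriv_within D f (psi t)).
  by move: dn; rewrite near_withinE => /nbhs_singleton; apply.
split; last by rewrite (deriv_withinE (pD' _ D't) dt).
apply: (C1_within_atI pD' D't dn); apply: cvgZ => //.
by case: fCt => _ fc; exact: (cvg_comp psi (deriv_within D f) pc fc).
Qed.

End Reparametrization.

Section CurveReparametrization.
Context {R : realType} (S : spacetime R).
Implicit Types (c : chart S) (D : set R) (u v : R -> frame S).

Lemma omegaZ (f : frame S) a (X : @frame_tangent R) :
  omega f (a *: X.1, a *: X.2) = a *: omega f X.
Proof.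
rewrite /omega /= christoffel_mxZ -scalemxAr -scalerDr -scalemxAl linearZ.
by [].
Qed.

Lemma thetaZ (f : frame S) a (X : @frame_tangent R) :
  theta f (a *: X.1, a *: X.2) = a *: theta f X.
Proof. by rewrite /theta /frame_components /= -scalemxAl. Qed.

Lemma C1f_at_near D u v t : perfect_in D -> D t ->
  (\forall s \near t, \forall r \near within D (nbhs s), u r = v r) ->
  C1f_at D u t -> C1f_at D v t.
Proof.
move=> pD Dt uv [uc uC].
have uvt : \forall r \near within D (nbhs t), u r = v r by exact: nbhs_singleton uv.
have et : u t = v t by move: uvt; rewrite near_withinE => /nbhs_singleton; exact.
split.
  rewrite -et; apply: cvg_congr_near uc.
  by apply: filterS uvt => s ->.
move=> c; rewrite -et => /uC[uC1 uC2].
split.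
  apply: (C1_within_at_near pD Dt _ uC1); apply: filterS uv => s; apply: filterS => r.
  by rewrite /= => ->.
apply: (C1_within_at_near pD Dt _ uC2); apply: filterS uv => s; apply: filterS => r.
by rewrite /= => ->.
Qed.

Lemma om_th_near D u v t : D t -> (\forall r \near within D (nbhs t), u r = v r) ->
  om D u t = om D v t /\ th D u t = th D v t.
Proof.
move=> Dt uv.
have et : u t = v t by move: uv; rewrite near_withinE => /nbhs_singleton; exact.
have fv : frame_velocity D u t = frame_velocity D v t.
  have H1 : \forall s \near within D (nbhs t),
      (chart_map (chart_at (fpt (v t))) \o (@fpt _ S \o u)) s =
      (chart_map (chart_at (fpt (v t))) \o (@fpt _ S \o v)) s.
    by apply: filterS uv => s; rewrite /= => ->.
  have H2 : \forall s \near within D (nbhs t),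
      (fcomp (chart_at (fpt (v t))) \o u) s = (fcomp (chart_at (fpt (v t))) \o v) s.
    by apply: filterS uv => s; rewrite /= => ->.
  have E1 := deriv_within_near Dt H1; have E2 := deriv_within_near Dt H2.
  rewrite /frame_velocity /velocity /= et; exact: (congr2 pair E1 E2).
by split; [exact: (congr2 (@omega R S) et fv)|exact: (congr2 (@theta R S) et fv)].
Qed.

Section Reparam.
Variables (D D' : set R) (psi psi' : R -> R).
Hypotheses (pD : perfect_in D) (pD' : perfect_in D').
Hypothesis DD' : forall s, D' s -> D (psi s).
Hypothesis psid : forall s, D' s -> dw D' psi s (psi' s).
Hypothesis psic : forall t, D' t -> psi' s @[s --> within D' (nbhs t)] --> psi' t.

Lemma near_chart_C1 (gamma : R -> S) c t : C1_curve D gamma -> D t -> chart_dom c (gamma t) ->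
  \forall s \near within D (nbhs t), C1_within_at D (chart_map c \o gamma) s.
Proof.
move=> [/subspace_continuousP gc gC] Dt ct.
have N1 : \forall s \near within D (nbhs t), D s by exact: withinT.
have N2 : \forall s \near within D (nbhs t), chart_dom c (gamma s).
  exact: (gc t Dt _ (chart_dom_nbhs ct)).
by apply: filterS2 N1 N2 => s; exact: gC.
Qed.

Lemma C1_curve_reparam (gamma : R -> S) : C1_curve D gamma ->
  C1_curve D' (gamma \o psi) /\
  forall t, D' t -> velocity D' (gamma \o psi) t = psi' t *: velocity D gamma (psi t).
Proof.
move=> gC; have [/subspace_continuousP gc _] := gC.
have H c t : D' t -> chart_dom c (gamma (psi t)) ->
    C1_within_at D' (chart_map c \o (gamma \o psi)) t /\
    deriv_within D' (chart_map c \o (gamma \o psi)) t =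
      psi' t *: deriv_within D (chart_map c \o gamma) (psi t).
  move=> D't ct; apply: (@C1_reparam _ _ D D' psi psi' (chart_map c \o gamma)) => //.
    exact: psic.
  by apply: near_chart_C1 => //; exact: DD'.
split; last first.
  move=> t D't; have [|_ E] := H (chart_at (gamma (psi t))) t D't; first exact: chart_atP.
  exact: E.
split; last by move=> c t D't ct; have [] := H c t D't ct.
apply/subspace_continuousP => t D't.
exact: (cvg_comp psi gamma (cvg_within_comp D't DD' (dw_continuous D't (psid D't))) (gc _ (DD' D't))).
Qed.

Lemma C1_frame_reparam u : C1_frame_curve D u ->
  C1_frame_curve D' (u \o psi) /\
  forall t, D' t -> om D' (u \o psi) t = psi' t *: om D u (psi t) /\
                    th D' (u \o psi) t = psi' t *: th D u (psi t).
Proof.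
move=> [gC eC]; have [gC' gV] := C1_curve_reparam gC.
have [/subspace_continuousP gc _] := gC.
have H c t : D' t -> chart_dom c (fpt (u (psi t))) ->
    C1_within_at D' (fcomp c \o (u \o psi)) t /\
    deriv_within D' (fcomp c \o (u \o psi)) t = psi' t *: deriv_within D (fcomp c \o u) (psi t).
  move=> D't ct; apply: (@C1_reparam _ _ D D' psi psi' (fcomp c \o u)) => //.
    exact: psic.
  have N1 : \forall s \near within D (nbhs (psi t)), D s by exact: withinT.
  have N2 : \forall s \near within D (nbhs (psi t)), chart_dom c (fpt (u s)).
    exact: (gc _ (DD' D't) _ (chart_dom_nbhs ct)).
  by apply: filterS2 N1 N2 => s; exact: eC.
split; first by split => // c t D't ct; have [] := H c t D't ct.
move=> t D't; have [|_ E] := H (chart_at (fpt (u (psi t)))) t D't; first exact: chart_atP.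
have V : frame_velocity D' (u \o psi) t =
    (psi' t *: (frame_velocity D u (psi t)).1, psi' t *: (frame_velocity D u (psi t)).2).
  exact: (congr2 pair (gV t D't) E).
split; first exact: (etrans (congr1 (@omega R S _) V) (omegaZ _ _ _)).
exact: (etrans (congr1 (@theta R S _) V) (thetaZ _ _ _)).
Qed.

End Reparam.

Definition gn D u t : R := `|om D u t| + `|th D u t|.

Lemma gn_cts D u : perfect_in D -> C1_frame_curve D u -> {within D, continuous (gn D u)}.
Proof.
move=> pD uC; apply/subspace_continuousP => t Dt.
have [oc tc] := om_th_cts pD Dt uC.
by apply: cvgD; apply: cvg_norm.
Qed.

(* L is the arc length for |omega| + |theta| in the sup norms.  It is comparable with the
   length for any natural metric, so what is built from conn works for all of them. *)
Definition conn (x y : OplusM S) (l : R) : Prop :=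
  exists (s t : R) (u : R -> OplusM S) (L : R -> R),
  [/\ s < t, C1_frame_curve `[s, t]%classic (@Oframe _ S \o u), u s = x, u t = y &
    (forall r, s <= r <= t -> dw `[s, t]%classic L r (gn `[s, t]%classic (@Oframe _ S \o u) r)) /\
    l = L t - L s].

Lemma conn_ge0 x y l : conn x y l -> 0 <= l.
Proof.
move=> [s [t [u [L [st uC _ _ [Ld ->]]]]]].
have := @dw_le _ (cst 0) (cst 0) L _ s t (ltW st) (fun r _ => @dw_cst R R _ 0 r) Ld.
by rewrite subrr; apply => r _; rewrite addr_ge0.
Qed.

(* The monotone reparametrizations below have zero derivative outside a compact interval, so
   that curves can be concatenated without losing the C^1 regularity. *)
Definition sqmax (r : R) : R := Num.max 0 r ^+ 2.

Lemma sqmax_is_derive (r : R) : is_derive r (1 : R) sqmax (2 * Num.max 0 r).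
Proof.
apply: (@dw_is_derive _ _ setT); first exact: filterT.
have [r0|r0|->] : [\/ r < 0, 0 < r | r = 0] by case: (ltgtP r 0) => h; [apply: Or31|apply: Or32|apply: Or33].
- rewrite max_l ?(ltW r0)// mulr0; apply: (@dw_near _ _ _ (cst 0)) => //; last exact: dw_cst.
  rewrite near_withinE; apply: filterS (lt_nbhsl r0) => s /= s0 _.
  by rewrite /sqmax max_l ?(ltW s0)// expr0n.
- rewrite max_r ?(ltW r0)//; apply: (@dw_near _ _ _ (fun s => s * s)) => //.
    rewrite near_withinE; apply: filterS (lt_nbhsr r0) => s /= s0 _.
    by rewrite /sqmax max_r ?(ltW s0)// expr2.
  have := dwM I (dw_id (D := setT) (t := r) I) (dw_id (D := setT) (t := r) I).
  by have -> : 1 * id r + id r * 1 = 2 * r by rewrite /=; ring.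
(* At 0 the Caratheodory quotient of [sqmax] is [Num.max 0 s] itself, which tends to 0. *)
- rewrite maxxx mulr0; apply/dwP => //; exists (fun s => Num.max 0 s).
    move=> s _; rewrite /sqmax maxxx expr0n /= !subr0.
    have [s0|s0] := leP s 0; first by rewrite expr0n /= scaler0.
    by rewrite expr2.
  rewrite withinET -[X in _ --> X](@maxxx _ R 0).
  apply: (@continuous_max R R (cst 0) id); first exact: cst_continuous.
  exact: cvg_id.
Qed.

Lemma max0_cts (r : R) : Num.max 0 s @[s --> r] --> Num.max 0 r.
Proof.
apply: (@continuous_max R R (cst 0) id); first exact: cst_continuous.
exact: cvg_id.
Qed.

End CurveReparametrization.

(** * Lengths of curves in the frame bundle *)

#[local] Opaque om th.

Section Connections.
Context {R : realType} (S : spacetime R).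
Implicit Types (D : set R) (u v : R -> OplusM S) (L : R -> R).

Notation Of := (@Oframe R S).

(** L is an arc length function along u. Keeping it as data makes reparametrization an instance of
    the chain rule. *)
Definition arc D u L : Prop := C1_frame_curve D (Of \o u) /\
  forall r, D r -> dw D L r (gn D (Of \o u) r).

Lemma segmentP (s t r : R) : `[s, t]%classic r <-> s <= r <= t.
Proof. by rewrite /= in_itv. Qed.

Lemma arc_conn (s t : R) u L : s < t -> arc `[s, t]%classic u L -> conn (u s) (u t) (L t - L s).
Proof.
move=> st [uC Ld]; exists s, t, u, L; split => //.
Qed.

Lemma conn_arc (x y : OplusM S) l : conn x y l ->
  exists s t u L, [/\ s < t, arc `[s, t]%classic u L, u s = x, u t = y & l = L t - L s].
Proof.
move=> [s [t [u [L [st uC us ut [Ld lE]]]]]]; exists s, t, u, L; split => //.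
Qed.

Lemma arc_exists (s t : R) u : s < t -> C1_frame_curve `[s, t]%classic (Of \o u) ->
  exists L, arc `[s, t]%classic u L.
Proof.
move=> st uC; have [L [Ld _]] := primitive st (gn_cts (perfect_segment st) uC).
by exists L; split => // r /segmentP rst; apply: is_derive_dw; exact: Ld.
Qed.

Lemma gn_near D (u v : R -> frame S) t : D t -> (\forall r \near within D (nbhs t), u r = v r) ->
  gn D u t = gn D v t.
Proof. by move=> Dt uv; have [eo et] := om_th_near Dt uv; rewrite /gn eo et. Qed.

Section Reparam.
Variables (D D' : set R) (psi psi' : R -> R).
Hypotheses (pD : perfect_in D) (pD' : perfect_in D').
Hypothesis DD' : forall s, D' s -> D (psi s).
Hypothesis psid : forall s, D' s -> dw D' psi s (psi' s).
Hypothesis psic : forall t, D' t -> psi' s @[s --> within D' (nbhs t)] --> psi' t.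

Lemma gn_reparam (u : R -> frame S) : C1_frame_curve D u -> forall t, D' t ->
  gn D' (u \o psi) t = `|psi' t| * gn D u (psi t).
Proof.
move=> uC t D't; have [_ /(_ t D't)[oE tE]] := C1_frame_reparam pD pD' DD' psid psic uC.
by rewrite /gn oE tE !normrZ mulrDr.
Qed.

#[local] Opaque gn.

Lemma arc_reparam u L : (forall r, D' r -> 0 <= psi' r) -> arc D u L ->
  arc D' (u \o psi) (L \o psi).
Proof.
move=> psi0 [uC Ld]; have [uC' _] := C1_frame_reparam pD pD' DD' psid psic uC.
split; first exact: uC'.
move=> r D'r; have E := gn_reparam uC D'r; rewrite (ger0_norm (psi0 r D'r)) in E.
have := dw_comp D'r DD' (psid D'r) (Ld _ (DD' D'r)).
by rewrite -[_ *: _]E.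
Qed.

Lemma arc_reparam_rev u L : (forall r, D' r -> psi' r <= 0) -> arc D u L ->
  arc D' (u \o psi) (fun r => - L (psi r)).
Proof.
move=> psi0 [uC Ld]; have [uC' _] := C1_frame_reparam pD pD' DD' psid psic uC.
split; first exact: uC'.
move=> r D'r; have E := gn_reparam uC D'r; rewrite (ler0_norm (psi0 r D'r)) mulNr in E.
have := dwN (dw_comp D'r DD' (psid D'r) (Ld _ (DD' D'r))).
by rewrite -[- (_ *: _)]E.
Qed.

End Reparam.

Lemma arc_sub D D' u L : perfect_in D -> perfect_in D' -> D' `<=` D -> arc D u L -> arc D' u L.
Proof.
move=> pD pD' DD'; apply: (@arc_reparam D D' id (cst 1)) => //.
- by move=> s D's; exact: dw_id.
- by move=> t _; exact: cvg_cst.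
Qed.

Lemma conn_sym (x y : OplusM S) l : conn x y l -> conn y x l.
Proof.
move=> /conn_arc[s [t [u [L [st uA <- <- ->]]]]].
pose psi r := s + t - r.
have psid r : dw `[s, t]%classic psi r (-1).
  by rewrite -[- 1]add0r; apply: dwB; [exact: dw_cst|apply: is_derive_dw; exact: is_derive_id].
have psist r : `[s, t]%classic r -> `[s, t]%classic (psi r).
  by move=> /segmentP rst; apply/segmentP; rewrite /psi; lra.
have A : arc `[s, t]%classic (u \o psi) (fun r => - L (psi r)).
  apply: (arc_reparam_rev (perfect_segment st) (perfect_segment st) psist (fun r _ => psid r) _ _ uA).
    by move=> r _; exact: cvg_cst.
  by move=> r _; exact: lerN10.
have := arc_conn st A; rewrite /= /psi.
have -> : s + t - s = t by ring.
have -> : s + t - t = s by ring.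
by rewrite opprK addrC.
Qed.

(** On [0, 3] the first curve is run during [0, 1] and the second during [2, 3]; in between the
    point rests at y. Before 2 the new curve is [u1 \o p1] and after 1 it is [u2 \o p2]. These two
    ranges overlap in an open interval, so every parameter has a neighbourhood where one smooth
    description holds. *)
Lemma conn_trans (x y z : OplusM S) l m : conn x y l -> conn y z m -> conn x z (l + m).
Proof.
move=> /conn_arc[s1 [t1 [u1 [L1 [st1 A1 <- u1t ->]]]]] /conn_arc[s2 [t2 [u2 [L2 [st2 A2 u2s <- ->]]]]].
pose D : set R := `[0, 3]%classic.
have pD : perfect_in D by apply: perfect_segment; rewrite ltr0n.
(* [sqmax (1 - r)] falls from 1 to 0 on [0, 1] and vanishes afterwards with its derivative, so [p1]
   goes from s1 to t1 and stops without a corner; [p2] starts in the same way at 2. *)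
pose p1 r := t1 - (t1 - s1) * sqmax (1 - r).
pose p1' (r : R) : R := (t1 - s1) * (2 * Num.max 0 (1 - r)).
pose p2 r := s2 + (t2 - s2) * sqmax (r - 2).
pose p2' (r : R) : R := (t2 - s2) * (2 * Num.max 0 (r - 2)).
have d1 : 0 < t1 - s1 by rewrite subr_gt0.
have d2 : 0 < t2 - s2 by rewrite subr_gt0.
have sq01 (r : R) : r <= 1 -> 0 <= sqmax r <= 1.
  move=> r1; rewrite /sqmax; have [r0|r0] := leP r 0; first by rewrite expr0n /= lexx ler01.
  by rewrite exprn_ge0 ?(ltW r0)//= expr_le1// ltW.
have sq0 (r : R) : r <= 0 -> sqmax r = 0 by move=> r0; rewrite /sqmax max_l// expr0n.
have D1 r : D r -> `[s1, t1]%classic (p1 r).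
  move=> /segmentP /andP[r0 r3]; apply/segmentP.
  have /andP[a0 a1] : 0 <= sqmax (1 - r) <= 1 by apply: sq01; lra.
  by rewrite /p1; nra.
have D2 r : D r -> `[s2, t2]%classic (p2 r).
  move=> /segmentP /andP[r0 r3]; apply/segmentP.
  have /andP[a0 a1] : 0 <= sqmax (r - 2) <= 1 by apply: sq01; lra.
  by rewrite /p2; nra.
have sqd (f : R -> R) r (e : R) : dw D f r e -> D r -> dw D (sqmax \o f) r (e * (2 * Num.max 0 (f r))).
  move=> fd Dr; apply: (@dw_comp _ _ setT D f sqmax) => //.
  by apply: is_derive_dw; exact: sqmax_is_derive.
have idd r : dw D id r 1 by apply: is_derive_dw; exact: is_derive_id.
have p1d r : D r -> dw D p1 r (p1' r).
  move=> Dr; have h := sqd _ r _ (dwB (dw_cst D (1 : R) r) (idd r)) Dr.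
  have := dwB (dw_cst D (t1 : R) r) (dwM Dr (dw_cst D (t1 - s1 : R) r) h).
  by rewrite /p1' /=; congr (dw _ _ _ _); ring.
have p2d r : D r -> dw D p2 r (p2' r).
  move=> Dr; have h := sqd _ r _ (dwB (idd r) (dw_cst D (2 : R) r)) Dr.
  have := dwD (dw_cst D (s2 : R) r) (dwM Dr (dw_cst D (t2 - s2 : R) r) h).
  by rewrite /p2' /=; congr (dw _ _ _ _); ring.
have mx (f : R -> R) (r : R) : f s @[s --> within D (nbhs r)] --> f r ->
    Num.max 0 (f s) @[s --> within D (nbhs r)] --> Num.max 0 (f r).
  by move=> fc; apply: (@cvg_comp _ _ _ f (fun s => Num.max 0 s) _ _ _ fc); exact: max0_cts.
have idc (r : R) : s @[s --> within D (nbhs r)] --> r by exact: cvg_within.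
have p1c (r : R) : D r -> p1' s @[s --> within D (nbhs r)] --> p1' r.
  move=> _; apply: cvgM; first exact: cvg_cst.
  apply: cvgM; first exact: cvg_cst.
  by apply: (mx (fun s => 1 - s)); apply: cvgB; [exact: cvg_cst|exact: idc].
have p2c (r : R) : D r -> p2' s @[s --> within D (nbhs r)] --> p2' r.
  move=> _; apply: cvgM; first exact: cvg_cst.
  apply: cvgM; first exact: cvg_cst.
  by apply: (mx (fun s => s - 2)); apply: cvgB; [exact: idc|exact: cvg_cst].
have max0 r : (0 : R) <= Num.max 0 r by rewrite le_max lexx.
have p10 r : D r -> 0 <= p1' r by move=> _; rewrite !mulr_ge0// ltW.
have p20 r : D r -> 0 <= p2' r by move=> _; rewrite !mulr_ge0// ltW.
have [C1 G1] := arc_reparam (perfect_segment st1) pD D1 p1d p1c p10 A1.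
have [C2 G2] := arc_reparam (perfect_segment st2) pD D2 p2d p2c p20 A2.
(* Any switching point strictly between 1 and 2 would do, since both curves rest at y there. *)
pose u r := if r <= 3 / 2 then u1 (p1 r) else u2 (p2 r).
have e1 r : r < 2 -> u r = (u1 \o p1) r.
  move=> r2; rewrite /u; case: ifP => //= /negbT; rewrite -ltNge => r32.
  by rewrite /p1 /p2 !sq0 ?mulr0 ?subr0 ?addr0 ?u1t ?u2s//; lra.
have e2 r : 1 < r -> u r = (u2 \o p2) r.
  move=> r1; rewrite /u; case: ifP => //= r32.
  by rewrite /p1 /p2 !sq0 ?mulr0 ?subr0 ?addr0 ?u1t ?u2s//; lra.
have n1 (r : R) : r < 2 -> \forall s \near r, \forall q \near within D (nbhs s), Of (u1 (p1 q)) = Of (u q).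
  move=> r2; have : nbhs r [set q | q < 2] by exact: lt_nbhsl.
  move=> /nbhs_interior; apply: filterS => s; rewrite /interior => h.
  by rewrite near_withinE; apply: filterS h => q q2 _; rewrite e1.
have n2 (r : R) : 1 < r -> \forall s \near r, \forall q \near within D (nbhs s), Of (u2 (p2 q)) = Of (u q).
  move=> r2; have : nbhs r [set q | 1 < q] by exact: lt_nbhsr.
  move=> /nbhs_interior; apply: filterS => s; rewrite /interior => h.
  by rewrite near_withinE; apply: filterS h => q q2 _; rewrite e2.
have uA : arc D u (fun r => L1 (p1 r) + L2 (p2 r)).
  split.
    apply/C1_frame_curveP => r Dr; have [r2|r2] := ltP r 2.
      by apply: (C1f_at_near pD Dr (n1 r r2)); move/C1_frame_curveP : C1; apply.
    have r1 : 1 < r by apply: lt_le_trans r2; rewrite ltr1n.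
    by apply: (C1f_at_near pD Dr (n2 r r1)); move/C1_frame_curveP : C2; apply.
  move=> r Dr; have := dwD (G1 r Dr) (G2 r Dr).
  have g1 := gn_reparam (perfect_segment st1) pD D1 p1d p1c A1.1 Dr.
  have g2 := gn_reparam (perfect_segment st2) pD D2 p2d p2c A2.1 Dr.
  have [r2|r2] := ltP r 2.
    have E := gn_near Dr (nbhs_singleton (n1 r r2)).
    (* The second curve is still at rest, so its share of the arc length function has derivative
       zero. *)
    have gz : gn D (Of \o (u2 \o p2)) r = 0.
      apply: etrans g2 _; have -> : p2' r = 0.
        by rewrite /p2' max_l ?mulr0// subr_le0 ltW.
      by rewrite normr0 mul0r.
    by rewrite gz addr0 -[gn D (Of \o u) r]E.
  have r1 : 1 < r by apply: lt_le_trans r2; rewrite ltr1n.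
  have E := gn_near Dr (nbhs_singleton (n2 r r1)).
  have gz : gn D (Of \o (u1 \o p1)) r = 0.
    apply: etrans g1 _; have -> : p1' r = 0.
      by rewrite /p1' max_l ?mulr0// subr_le0 ltW.
    by rewrite normr0 mul0r.
  by rewrite gz add0r -[gn D (Of \o u) r]E.
have o3 : (0 : R) < 3 by rewrite ltr0n.
have := arc_conn o3 uA.
have sq1 : sqmax (1 : R) = 1 by rewrite /sqmax max_r// expr1n.
have -> : u 0 = u1 s1.
  by rewrite e1 ?ltr0n//= /p1 subr0 sq1 mulr1; congr u1; ring.
have -> : u 3 = u2 t2.
  have h13 : (1 : R) < 3 by rewrite ltr1n.
  have e31 : (3 - 2 : R) = 1 by ring.
  by rewrite (e2 3 h13) /= /p2 e31 sq1 mulr1; congr u2; ring.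
have -> : p1 0 = s1 by rewrite /p1 subr0 sq1; ring.
have -> : p1 3 = t1 by rewrite /p1 sq0; lra.
have -> : p2 0 = s2 by rewrite /p2 sq0; lra.
have -> : p2 3 = t2 by rewrite /p2 (_ : 3 - 2 = 1) ?sq1; ring.
by congr (conn _ _ _); ring.
Qed.

End Connections.

(** * Comparison with the natural distances *)

#[local] Transparent gn.

Section QuadraticForms.
Context {R : realType}.

Definition qform n (B : 'I_n -> 'I_n -> R) (v : 'rV[R]_n) : R :=
  \sum_(k < n) \sum_(l < n) v 0 k * v 0 l * B k l.

Lemma qform_cvg n (B : 'I_n -> 'I_n -> R) (T : Type) (F : set_system T) {FF : Filter F}
    (f : T -> 'rV[R]_n) v : f x @[x --> F] --> v -> qform B (f x) @[x --> F] --> qform B v.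
Proof.
move=> fv; apply: cvg_sumr => k _; apply: cvg_sumr => l _.
apply: cvgM; last exact: cvg_cst.
by apply: cvgM; exact: cvg_entry.
Qed.

Lemma qformZ n (B : 'I_n -> 'I_n -> R) a v : qform B (a *: v) = a ^+ 2 * qform B v.
Proof.
rewrite /qform mulr_sumr; apply: eq_bigr => k _; rewrite mulr_sumr; apply: eq_bigr => l _.
by rewrite !mxE; ring.
Qed.

Lemma qform_le n (B : 'I_n -> 'I_n -> R) :
  exists2 K, 0 < K & forall v, qform B v <= K * `|v| ^+ 2.
Proof.
exists (\sum_(k < n) \sum_(l < n) `|B k l| + 1) => [|v].
  by rewrite ltr_pwDr// sumr_ge0// => k _; rewrite sumr_ge0.
rewrite mulrDl mul1r ler_wpDr ?exprn_ge0// mulr_suml; apply: ler_sum => k _.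
rewrite mulr_suml; apply: ler_sum => l _; apply: le_trans (ler_norm _) _.
rewrite normrM mulrC ler_wpM2l// normrM expr2.
by rewrite ler_pM// mx_entry_le.
Qed.

(** The constant is the minimum of the form on the compact unit sphere of the sup norm. In dimension
    zero the sphere is empty, and this case is settled first. *)
Lemma qform_ge n (B : 'I_n -> 'I_n -> R) : (forall v, v != 0 -> 0 < qform B v) ->
  exists2 k, 0 < k & forall v, k * `|v| ^+ 2 <= qform B v.
Proof.
move=> Bp.
have [[w w0]|H] := pselect (exists w : 'rV[R]_n, w != 0); last first.
  exists 1 => // v; have -> : v = 0.
    by apply/eqP; apply: contrapT => v0; apply: H; exists v; exact/negP.
  rewrite normr0 expr0n /= mulr0 -(scale0r (0 : 'rV[R]_n)) qformZ expr0n /= mul0r.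
  exact: lexx.
pose A := [set v : 'rV[R]_n | `|v| = 1].
have normA (v : 'rV[R]_n) : v != 0 -> A (`|v|^-1 *: v).
  by move=> v0; rewrite /A /= normrZ normfV normr_id mulVf// normr_eq0.
have cA : compact A.
  apply: bounded_closed_compact.
    exists 1; split => // x x1 v /= ->; exact: ltW.
  by apply: (preimage_closed _ (@closed_eq R 1)) => v _; exact: norm_continuous.
have A0 : A !=set0 by exists (`|w|^-1 *: w); exact: normA.
have Bc : {within A, continuous (qform B)}.
  apply: continuous_subspaceT => v; apply: (@qform_cvg n B _ (nbhs v) _ id v).
  exact: cvg_id.
have [v] := compact_EVT_min A0 cA Bc; rewrite inE => vA vmin.
have v0 : v != 0 by apply/eqP => v0; move: vA; rewrite /A /= v0 normr0 => /eqP; rewrite eq_sym oner_eq0.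
exists (qform B v); first exact: Bp.
move=> x; have [->|x0] := eqVneq x 0.
  by rewrite normr0 expr0n /= mulr0 -(scale0r (0 : 'rV[R]_n)) qformZ expr0n /= mul0r.
have nx : `|x| != 0 by rewrite normr_eq0.
have -> : x = `|x| *: (`|x|^-1 *: x) by rewrite scalerA mulfV// scale1r.
rewrite qformZ normrZ normr_id (normA x x0 : _ = _) mulr1 mulrC ler_wpM2l ?exprn_ge0//.
by apply: vmin; rewrite inE; exact: normA.
Qed.

Section Forms.
Variables (n : nat) (U : lmodType R) (b : {dot U for idfun}).

Let dotDl (x y z : U) : b (x + y) z = b x z + b y z.
Proof. exact: linearDl. Qed.
Let dotZl (a : R) (x z : U) : b (a *: x) z = a * b x z.
Proof. exact: linearZl_LR. Qed.
Let dotC (x y : U) : b x y = b y x.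
Proof. by rewrite hermC expr0 mul1r. Qed.

Lemma dot_sum (e : 'I_n -> U) (v : 'rV[R]_n) :
  b (\sum_k v 0 k *: e k) (\sum_k v 0 k *: e k) = qform (fun k l => b (e k) (e l)) v.
Proof.
have L z : b (\sum_k v 0 k *: e k) z = \sum_k v 0 k * b (e k) z.
  elim/big_ind2 : _ => [|x1 x2 y1 y2 <- <-|k _]; last exact: dotZl.
    by rewrite -(scale0r (0 : U)) dotZl mul0r.
  exact: dotDl.
rewrite L; apply: eq_bigr => k _; rewrite dotC L mulr_sumr; apply: eq_bigr => l _.
by rewrite mulrA [b (e l) _]dotC.
Qed.

(** Coordinates turn an inner product into a quadratic form on rows. One statement thus serves for
    matrices, through [mxvec], and for vectors. *)
Lemma dot_bounds (coord : U -> 'rV[R]_n) (e : 'I_n -> U) :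
  (forall x, x = \sum_k coord x 0 k *: e k) -> (forall v : 'rV[R]_n, coord (\sum_k v 0 k *: e k) = v) ->
  exists k K, [/\ 0 < k, 0 < K & forall x, k * `|coord x| ^+ 2 <= b x x <= K * `|coord x| ^+ 2].
Proof.
move=> ce ec; pose B k l := b (e k) (e l).
have [K K0 HK] := qform_le B.
have [|k k0 Hk] := @qform_ge _ B.
  move=> v v0; rewrite -dot_sum; apply: neq0_dnorm_gt0.
  by apply: contraNneq v0 => E; rewrite -(ec v) E -(ec 0) big1 // => k _; rewrite mxE scale0r.
exists k, K; split => // x.
have -> : b x x = qform B (coord x) by rewrite {1 2}(ce x) dot_sum.
by rewrite Hk HK.
Qed.

Lemma dot_cvg (coord : U -> 'rV[R]_n) (e : 'I_n -> U) (T : Type) (F : set_system T)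
    {FF : Filter F} (f : T -> U) x :
  (forall x, x = \sum_k coord x 0 k *: e k) ->
  coord (f s) @[s --> F] --> coord x -> b (f s) (f s) @[s --> F] --> b x x.
Proof.
move=> ce fx.
have E y : qform (fun k l => b (e k) (e l)) (coord y) = b y y.
  by rewrite {2 3}(ce y) dot_sum.
rewrite -E.
apply: (@cvg_congr_near _ _ F _ (fun s => qform (fun k l => b (e k) (e l)) (coord (f s)))).
  by near=> s; rewrite E.
exact: qform_cvg.
Unshelve. all: by end_near. Qed.

End Forms.

Lemma mxvec_norm m n (A : 'M[R]_(m, n)) : `|mxvec A| = `|A|.
Proof.
apply/eqP; rewrite eq_le; apply/andP; split.
  by apply: mx_norm_le => // i k; rewrite ord1; case/mxvec_indexP : k => a c; rewrite mxvecE mx_entry_le.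
by apply: mx_norm_le => // i j; rewrite -mxvecE mx_entry_le.
Qed.

Lemma mxvec_cvg (T : Type) (F : set_system T) {FF : Filter F} m n (f : T -> 'M[R]_(m, n)) (A : 'M[R]_(m, n)) :
  f x @[x --> F] --> A -> mxvec (f x) @[x --> F] --> mxvec A.
Proof.
move=> fA; apply: cvg_mx => i k; rewrite ord1; case/mxvec_indexP : k => a c.
rewrite mxvecE; apply: (@cvg_congr_near _ _ F _ (fun x => f x a c)).
  by near=> x; rewrite mxvecE.
exact: cvg_entry.
Unshelve. all: by end_near. Qed.

Lemma mx_vec_sum m n (A : 'M[R]_(m, n)) :
  A = \sum_k mxvec A 0 k *: vec_mx (delta_mx 0 k).
Proof.
rewrite -[LHS]mxvecK {1}(row_sum_delta (mxvec A)) linear_sum.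
by apply: eq_bigr => k _; rewrite linearZ.
Qed.

Lemma vec_mx_sum m n (v : 'rV[R]_(m * n)) :
  mxvec (\sum_k v 0 k *: vec_mx (delta_mx 0 k) : 'M[R]_(m, n)) = v.
Proof.
rewrite linear_sum [RHS](row_sum_delta v).
by apply: eq_bigr => k _; rewrite linearZ /= vec_mxK.
Qed.

Lemma rV_sum_delta n (v : 'rV[R]_n) : (\sum_k v 0 k *: delta_mx 0 k) = v.
Proof. by rewrite [RHS]row_sum_delta. Qed.

End QuadraticForms.

Section NaturalDistance.
Context {R : realType} (S : spacetime R).
Variables (bgl : {dot 'M[R]_4 for idfun}) (bR : {dot 'rV[R]_4 for idfun}).
Notation Of := (@Oframe R S).

Definition nspeed (D : set R) (u : R -> OplusM S) (r : R) : R :=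
  Num.sqrt (bgl (om D (Of \o u) r) (om D (Of \o u) r) + bR (th D (Of \o u) r) (th D (Of \o u) r)).

Lemma natural_lengthE s t (u : R -> OplusM S) : natural_length bgl bR s t u =
  (\int[lebesgue_measure]_(r in `[s, t]) (nspeed `[s, t]%classic u r)%:E)%E.
Proof. by []. Qed.

Lemma nspeed_bounds : exists k K, [/\ 0 < k, 0 < K & forall D u r,
  k * gn D (Of \o u) r <= nspeed D u r <= K * gn D (Of \o u) r].
Proof.
have [k1 [K1 [k10 K10 H1]]] := dot_bounds bgl (@mx_vec_sum R 4 4) (@vec_mx_sum R 4 4).
have [k2 [K2 [k20 K20 H2]]] := dot_bounds bR (fun v => esym (@rV_sum_delta R 4 v)) (@rV_sum_delta R 4).
pose k := Num.min k1 k2; pose K := Num.max K1 K2.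
have k0 : 0 < k by rewrite lt_min k10.
have K0 : 0 < K by rewrite lt_max K10.
(* The halving comes from [(x + y)^2 <= 2 (x^2 + y^2)]; for the upper constant
   [x^2 + y^2 <= (x + y)^2] with nonnegative x and y is enough. *)
exists (Num.sqrt (k / 2)), (Num.sqrt K); split; [by rewrite sqrtr_gt0 divr_gt0|by rewrite sqrtr_gt0|].
move=> D u r; rewrite /nspeed /gn.
set A := om D _ r; set v := th D _ r.
have /andP[a1 a2] := H1 A; have /andP[b1 b2] := H2 v.
rewrite mxvec_norm in a1 a2.
have kk1 : k <= k1 by rewrite ge_min lexx.
have kk2 : k <= k2 by rewrite ge_min lexx orbT.
have KK1 : K1 <= K by rewrite le_max lexx.
have KK2 : K2 <= K by rewrite le_max lexx orbT.
have A0 : 0 <= `|A| by []; have v0 : 0 <= `|v| by [].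
move: a1 a2 b1 b2; move: (bgl A A) (bR v v) => qa qb.
move: `|A| `|v| A0 v0 => na nv A0 v0 a1 a2 b1 b2.
have g0 : 0 <= na + nv by rewrite addr_ge0.
have sqg : Num.sqrt ((na + nv) ^+ 2) = na + nv by rewrite sqrtr_sqr ger0_norm.
have sqc c : 0 <= c -> Num.sqrt c * (na + nv) = Num.sqrt (c * (na + nv) ^+ 2).
  by move=> c0; rewrite sqrtrM// sqg.
have k20' : 0 <= k / 2 by rewrite divr_ge0// ltW.
rewrite (sqc _ k20') (sqc _ (ltW K0)).
have na2 : 0 <= na ^+ 2 by rewrite exprn_ge0.
have nv2 : 0 <= nv ^+ 2 by rewrite exprn_ge0.
have c1 : k * na ^+ 2 <= qa by apply: le_trans a1; rewrite ler_wpM2r.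
have c2 : k * nv ^+ 2 <= qb by apply: le_trans b1; rewrite ler_wpM2r.
have c3 : qa <= K * na ^+ 2 by apply: le_trans a2 _; rewrite ler_wpM2r.
have c4 : qb <= K * nv ^+ 2 by apply: le_trans b2 _; rewrite ler_wpM2r.
apply/andP; split; apply: ler_wsqrtr.
  apply: le_trans (lerD c1 c2); rewrite -mulrDr -mulrA ler_wpM2l ?(ltW k0)//.
  have := sqr_ge0 (na - nv); rewrite sqrrB sqrrD; lra.
apply: le_trans (lerD c3 c4) _; rewrite -mulrDr ler_wpM2l ?(ltW K0)//.
by rewrite sqrrD lerD2r lerDl mulrn_wge0// mulr_ge0.
Qed.

Lemma nspeed_cts D u : perfect_in D -> C1_frame_curve D (Of \o u) ->
  {within D, continuous (nspeed D u)}.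
Proof.
move=> pD uC; apply/subspace_continuousP => t Dt.
have [oc tc] := om_th_cts pD Dt uC.
have voc : mxvec (om D (Of \o u) s) @[s --> within D (nbhs t)] --> mxvec (om D (Of \o u) t).
  exact: mxvec_cvg oc.
have H1 : bgl (om D (Of \o u) s) (om D (Of \o u) s) @[s --> within D (nbhs t)] -->
    bgl (om D (Of \o u) t) (om D (Of \o u) t).
  exact: (dot_cvg (b := bgl) (@mx_vec_sum R 4 4) voc).
have H2 : bR (th D (Of \o u) s) (th D (Of \o u) s) @[s --> within D (nbhs t)] -->
    bR (th D (Of \o u) t) (th D (Of \o u) t).
  exact: (dot_cvg (b := bR) (fun v => esym (@rV_sum_delta R 4 v)) tc).
exact: (cvg_comp _ Num.sqrt (cvgD H1 H2) (@sqrt_continuous R _)).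
Qed.

(** Everything used later to compare [conn] with the natural distances. The converse bound starts
    from a strict inequality because the infimum need not be attained. *)
Lemma natural_dist_bounds : exists k K, [/\ 0 < k, 0 < K,
  forall (x y : OplusM S) l, conn x y l -> (natural_dist bgl bR x y <= (K * l)%:E)%E &
  forall (x y : OplusM S) (d : R), (natural_dist bgl bR x y < d%:E)%E -> exists2 l, conn x y l & k * l < d].
Proof.
have [k [K [k0 K0 H]]] := nspeed_bounds.
exists k, K; split => //.
  move=> x y l [s [t [u [L [st uC us ut [Ld ->]]]]]].
  have [N [Nd NE]] := primitive st (nspeed_cts (perfect_segment st) uC).
  apply: (@le_trans _ _ (natural_length bgl bR s t u)).
    by apply: ereal_inf_lbound; exists s, t, u.
  rewrite natural_lengthE NE// lee_fin mulrBr.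
  apply: (@dw_le _ N (nspeed `[s, t]%classic u) (fun r => K * L r)
    (fun r => K * gn `[s, t]%classic (Of \o u) r)) => //; first exact: ltW.
  - by move=> r rst; apply: is_derive_dw; exact: Nd.
  - move=> r rst; have Dr : `[s, t]%classic r by rewrite /= in_itv.
    have := dwM Dr (dw_cst _ (K : R) r) (Ld r rst).
    by rewrite mul0r add0r.
  - by move=> r _; have /andP[] := H `[s, t]%classic u r.
move=> x y d /ereal_inf_lt[_ [s [t [u [st uC us ut ->]]]]].
have [N [Nd NE]] := primitive st (nspeed_cts (perfect_segment st) uC).
rewrite natural_lengthE NE// lte_fin => Nlt.
have [L [_ Ld]] := arc_exists st uC.
exists (L t - L s).
  by rewrite -us -ut; apply: arc_conn.
apply: le_lt_trans Nlt; rewrite mulrBr.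
apply: (@dw_le _ (fun r => k * L r) (fun r => k * gn `[s, t]%classic (Of \o u) r)
  N (nspeed `[s, t]%classic u)) => //; first exact: ltW.
- move=> r rst; have Dr : `[s, t]%classic r by rewrite /= in_itv.
  have := dwM Dr (dw_cst _ (k : R) r) (Ld r Dr).
  by rewrite mul0r add0r.
- by move=> r rst; apply: is_derive_dw; exact: Nd.
- by move=> r _; have /andP[] := H `[s, t]%classic u r.
Qed.

End NaturalDistance.

(** * Short curves project to small sets *)

#[local] Opaque fcomp.

Section LowerBound.
Context {R : realType}.

(** Continuous induction. Let [tau] be the supremum of the r such that P holds on [s, r]. The limit
    hypothesis gives P at [tau], and if [tau < t] the step hypothesis reaches beyond it. *)
Lemma segment_ind (P : R -> Prop) (s t : R) : s <= t -> P s ->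
  (forall r, s <= r < t -> (forall q, s <= q <= r -> P q) ->
    exists2 e, 0 < e & forall q, r <= q < r + e -> q <= t -> P q) ->
  (forall r, s < r <= t -> (forall q, s <= q < r -> P q) -> P r) ->
  forall r, s <= r <= t -> P r.
Proof.
move=> st Ps Pstep Plim.
pose A := [set r | s <= r <= t /\ forall q, s <= q <= r -> P q].
have As : A s.
  split; first by rewrite lexx.
  by move=> q sq; have -> : q = s by apply/eqP; rewrite eq_le andbC.
have ubA : ubound A t by move=> r [/andP[]].
have hsA : has_sup A by split; [exists s|exists t].
pose tau := sup A.
have stau : s <= tau by apply: ub_le_sup => //; exists t.
have taut : tau <= t by apply: ge_sup => //; exists s.
have lt_tau q : s <= q < tau -> P q.
  move=> /andP[sq qt]; have [r Ar qr] := sup_gt (ex_intro _ s As) qt.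
  by case: Ar => _; apply; rewrite sq ltW.
have Ptau : P tau.
  move: stau; rewrite le_eqVlt => /predU1P[<-//|stau].
  by apply: Plim => //; rewrite stau.
have le_tau q : s <= q <= tau -> P q.
  move=> /andP[sq]; rewrite le_eqVlt => /predU1P[->//|qt].
  by apply: lt_tau; rewrite sq.
move: taut; rewrite le_eqVlt => /predU1P[<-//|taut].
have [|e e0 He] := Pstep tau _ le_tau; first by rewrite stau.
(* Strictly less than e, so that P is known up to [tau + m], and without passing t. *)
pose m := Num.min (e / 2) (t - tau).
have m0 : 0 < m by rewrite lt_min divr_gt0// subr_gt0.
have me : m <= e / 2 by rewrite ge_min lexx.
have mt : m <= t - tau by rewrite ge_min lexx orbT.
have Am : A (tau + m).
  split; first by rewrite (le_trans stau) ?lerDl ?(ltW m0)//= -lerBrDl.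
  move=> q /andP[sq qm]; have [qt|tq] := leP q tau; first by apply: le_tau; rewrite sq.
  apply: He; last by lra.
  by rewrite ltW//=; lra.
have : tau + m <= tau by apply: ub_le_sup => //; exists t.
by rewrite gerDl leNgt m0.
Qed.

Lemma left_closed (T : topologicalType) (f : R -> T) (K : set T) (s t tau : R) :
  closed K -> s < tau <= t -> {within `[s, t], continuous f} ->
  (forall q, s <= q < tau -> K (f q)) -> K (f tau).
Proof.
move=> cK /andP[stau taut] /subspace_continuousP fc fK.
apply: contrapT => nK.
have oK : nbhs (f tau) (~` K).
  by apply: open_nbhs_nbhs; split => //; exact: closed_openC.
have Dt : `[s, t]%classic tau by rewrite /= in_itv /= ltW.
have := fc tau Dt _ oK; rewrite /within /= => -[e /= e0 He].
pose m := Num.min (e / 2) (tau - s).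
have m0 : 0 < m by rewrite lt_min divr_gt0// subr_gt0.
have me : m <= e / 2 by rewrite ge_min lexx.
have ms : m <= tau - s by rewrite ge_min lexx orbT.
apply: (He (tau - m)).
- rewrite /ball_ /= opprB addrCA subrr addr0 gtr0_norm//; lra.
- by rewrite /= in_itv /=; apply/andP; split; lra.
- by apply: fK; apply/andP; split; lra.
Qed.

Context (S : spacetime R).
Implicit Types (c : chart S).

Lemma christoffel_bound c x0 : cimg c x0 ->
  exists2 K, 0 <= K & \forall y \near x0, forall xi, `|christoffel_mx c y xi| <= K * `|xi|.
Proof.
move=> cx.
have Hi i : \forall y \near x0, `|Gam c y i| <= `|Gam c x0 i| + 1.
  have G : Gam c y i @[y --> x0] --> Gam c x0 i by exact: (Gam_cts (i := i) cx).
  by apply: (@cvgr_norm_le _ _ _ (nbhs x0) _ (fun y => Gam c y i) _ G); rewrite ltrDl.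
exists (\sum_(i < 4) (`|Gam c x0 i| + 1)); first by apply: sumr_ge0 => i _; rewrite addr_ge0.
have : \forall y \near x0, forall i, `|Gam c y i| <= `|Gam c x0 i| + 1.
  exact: (@filter_forall _ _ _ (nbhs x0) _ Hi).
apply: filterS => y Hy xi; rewrite christoffel_mxE mulr_suml.
apply: le_trans (ler_norm_sum _ _ _) _; apply: ler_sum => i _.
by rewrite normrZ mulrC ler_pM// mx_entry_le.
Qed.

Lemma mul4_le m n (A : 'M[R]_(m, 4)) (B : 'M[R]_(4, n)) (a b : R) :
  `|A| <= a -> `|B| <= b -> `|A *m B| <= 4 * (a * b).
Proof.
move=> Aa Bb; apply: le_trans (mx_norm_mul A B) _.
by rewrite ler_wpM2l// ler_pM.
Qed.

(** The definitions of the forms are solved for the velocity: [x' = th E] and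
    [E' = om^T E - E Gamma(x')]. The factors 4 and 16 are one or two uses of [mul4_le]. *)
Lemma dot_bound c (D : set R) (u : R -> frame S) t (Eb Kg : R) : perfect_in D -> D t ->
  C1f_at D u t -> chart_dom c (fpt (u t)) ->
  `|fcomp c (u t)| <= Eb -> 0 <= Kg ->
  (forall xi, `|christoffel_mx c (chart_map c (fpt (u t))) xi| <= Kg * `|xi|) ->
  `|xdot D u c t| <= (4 * Eb + 16 * Eb ^+ 2 * Kg) * gn D u t /\
  `|edot D u c t| <= (4 * Eb + 16 * Eb ^+ 2 * Kg) * gn D u t.
Proof.
move=> pD Dt uC cu EEb Kg0 HG.
have Eb0 : 0 <= Eb by apply: le_trans EEb.
have [oE tE] := om_th_chart pD Dt uC cu.
have uE := fcomp_unit cu.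
have xE : xdot D u c t = th D u t *m fcomp c (u t) by rewrite tE mulmxKV.
have eE : edot D u c t = (om D u t)^T *m fcomp c (u t) -
    fcomp c (u t) *m christoffel_mx c (chart_map c (fpt (u t))) (xdot D u c t).
  by rewrite oE /omf trmxK mulmxKV// addrK.
have o0 : 0 <= `|om D u t| by []; have t0 : 0 <= `|th D u t| by [].
have g0 : 0 <= gn D u t by rewrite addr_ge0.
have og : `|om D u t| <= gn D u t by rewrite /gn lerDl.
have tg : `|th D u t| <= gn D u t by rewrite /gn lerDr.
have bx : `|xdot D u c t| <= 4 * (gn D u t * Eb).
  by rewrite xE; exact: (mul4_le tg EEb).
have be : `|edot D u c t| <= 4 * (gn D u t * Eb) + 4 * (Eb * (Kg * (4 * (gn D u t * Eb)))).
  rewrite eE; apply: le_trans (ler_normB _ _) _; apply: lerD.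
    by apply: (mul4_le _ EEb); rewrite mx_norm_tr.
  apply: (mul4_le EEb _).
  by apply: le_trans (HG _) _; rewrite ler_wpM2l.
have z0 : 0 <= 16 * Eb ^+ 2 * Kg * gn D u t by rewrite !mulr_ge0// exprn_ge0.
split.
  by apply: le_trans bx _; rewrite mulrDl; lra.
by apply: le_trans be _; rewrite mulrDl; lra.
Qed.

(** While the curve stays in a chart, with coordinates and frame components within [rho] of those of
    x, both change at a rate of at most K times the speed. A length below [rho / K] then keeps them
    strictly within [rho], and continuous induction shows that the curve never gets out. *)
Lemma conn_lower (x : OplusM S) (N : set S) : nbhs (Opi x) N ->
  exists2 d, 0 < d & forall y l, conn x y l -> l < d -> N (Opi y).
Proof.
move=> Nx; pose c := chart_at (Opi x).
have cx : chart_dom c (Opi x) by exact: chart_atP.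
pose x0 := chart_map c (Opi x); pose E0 := fcomp c (Oframe x).
have cx0 : cimg c x0 by exact: cimg_map.
have [Kg Kg0 HKg] := christoffel_bound cx0.
have N1 : \forall y \near x0, N (chart_inv c y).
  by apply: (chart_inv_cts cx0); rewrite /x0 chart_mapK.
have /nbhs_ballP[e /= e0 He] : \forall y \near x0, cimg c y /\ N (chart_inv c y) /\
    forall xi, `|christoffel_mx c y xi| <= Kg * `|xi|.
  exact: (filterI (cimg_nbhs cx0) (filterI N1 HKg)).
pose rho := e / 2.
have rho0 : 0 < rho by rewrite divr_gt0.
have Hrho y : `|y - x0| <= rho -> cimg c y /\ N (chart_inv c y) /\
    forall xi, `|christoffel_mx c y xi| <= Kg * `|xi|.
  move=> yr; apply: He; rewrite -ball_normE /ball_ /= distrC.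
  by apply: le_lt_trans yr _; rewrite ltr_pdivrMr// ltr_pMr// ltr1n.
pose Eb := `|E0| + rho.
have Eb0 : 0 <= Eb by rewrite addr_ge0// ltW.
(* The constant of [dot_bound], increased by 1 to be positive. *)
pose K := 4 * Eb + 16 * Eb ^+ 2 * Kg + 1.
have K0 : 0 < K by rewrite ltr_pwDr// addr_ge0// !mulr_ge0// exprn_ge0.
exists (rho / K); first by rewrite divr_gt0.
move=> y l /conn_arc[s [t [u [L [st [uC Ld] us <- ->]]]]] Llt.
set D : set R := `[s, t]%classic in uC Ld.
have pD : perfect_in D by exact: perfect_segment.
pose f := @Oframe _ S \o u.
have fC r : D r -> C1f_at D f r by move/C1_frame_curveP : uC; apply.
have gc : {within D, continuous (@fpt _ S \o f)} by case: uC => -[].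
pose B := [set v : 'rV[R]_4 | `|v - x0| <= rho].
have cB : compact B.
  apply: bounded_closed_compact.
    exists (`|x0| + rho); split => [|M HM v /= vB]; first exact: num_real.
    rewrite -(subrK x0 v); apply: le_trans (ler_normD _ _) _.
    by apply: le_trans (ltW HM); rewrite addrC lerD2l.
  apply: (preimage_closed _ (@closed_le R rho)) => v _.
  by apply: (@cvg_norm _ _ _ (nbhs v)); apply: (@cvgB _ _ _ (nbhs v)); [exact: cvg_id|exact: cvg_cst].
(* The image of the closed coordinate ball is compact, hence closed as the manifold is Hausdorff.
   This prevents the curve from leaving the domain of the chart in the limit. *)
have cK : closed (chart_inv c @` B).
  apply: compact_closed; first exact: mhausdorff.
  apply: continuous_compact cB.
  apply: continuous_subspaceW (@chart_inv_continuous _ S c) => v vB.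
  by have [] := Hrho v vB.
(* P is an open condition, which serves the step of the induction; its closed version Q survives
   limits, and the length estimate leads from Q back to P. *)
pose P r := [/\ chart_dom c (fpt (f r)), `|chart_map c (fpt (f r)) - x0| < rho &
  `|fcomp c (f r) - E0| < rho].
pose Q r := [/\ chart_dom c (fpt (f r)), `|chart_map c (fpt (f r)) - x0| <= rho &
  `|fcomp c (f r) - E0| <= rho].
have PQ r : P r -> Q r by move=> [h1 /ltW h2 /ltW h3].
have fs : f s = Oframe x by rewrite /f /= us.
have Ps : P s.
  by rewrite /P fs; split => //; rewrite subrr normr0.
have Dsub r : s <= r <= t -> D r by move=> rst; rewrite /D /= in_itv.
have nx r : D r -> chart_dom c (fpt (f r)) ->
    chart_map c (fpt (f q)) @[q --> within D (nbhs r)] --> chart_map c (fpt (f r)) /\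
    fcomp c (f q) @[q --> within D (nbhs r)] --> fcomp c (f r).
  move=> Dr cr; have [_ /(_ c cr)[xC eC]] := fC r Dr.
  by split; [exact: dw_continuous Dr (C1_within_at_dw xC)|exact: dw_continuous Dr (C1_within_at_dw eC)].
have Pt : P t; last first.
  have [ct xt _] := Pt; have [_ [Nt _]] := Hrho _ (ltW xt).
  by move: Nt; rewrite chart_mapK.
apply: (@segment_ind P s t (ltW st) Ps) => [r rst HP|r rst HP|]; last by rewrite lexx ltW.
  have Dr : D r by apply: Dsub; case/andP: rst => -> /ltW.
  have [|cr xr er] := HP r; first by rewrite lexx andbT; case/andP: rst.
  have [xc ec] := nx r Dr cr.
  have n1 := near_dom (fC r Dr) cr.
  have n2 : \forall q \near within D (nbhs r), `|chart_map c (fpt (f q)) - x0| < rho.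
    have h : chart_map c (fpt (f q)) - x0 @[q --> within D (nbhs r)] --> chart_map c (fpt (f r)) - x0.
      apply: cvgB; [exact: xc|exact: cvg_cst].
    exact: (cvgr_norm_lt _ h).
  have n3 : \forall q \near within D (nbhs r), `|fcomp c (f q) - E0| < rho.
    have h : fcomp c (f q) - E0 @[q --> within D (nbhs r)] --> fcomp c (f r) - E0.
      apply: cvgB; [exact: ec|exact: cvg_cst].
    exact: (cvgr_norm_lt _ h).
  have [d /= d0 Hd] : \forall q \near within D (nbhs r), P q.
    apply: filterS3 n1 n2 n3 => q h1 h2 h3; exact: And3 h1 h2 h3.
  exists d; first exact: d0.
  move=> q /andP[rq qr] qt.
  have H1 : ball_ (fun x => `|x|) r d q by rewrite /ball_ /= distrC ger0_norm ?subr_ge0// ltrBlDl.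
  have H2 : D q by apply: Dsub; rewrite qt andbT; case/andP: rst => + _; move/le_trans; apply.
  exact: (Hd q H1 H2).
have srt : s <= r <= t by case/andP: rst => /ltW-> ->.
have Dr : D r := Dsub r srt.
have [v vB vE] : (chart_inv c @` B) ((@fpt _ S \o f) r).
  apply: (@left_closed _ _ _ s t r cK rst gc) => q sq.
  have [cq xq _] := HP q sq.
  by exists (chart_map c (fpt (f q))); [exact: ltW|rewrite chart_mapK].
have [cv _] := Hrho v vB; have [dv mv] := cimg_inv cv.
rewrite vE in dv mv.
have cr : chart_dom c (fpt (f r)) by exact: dv.
have xr : `|chart_map c (fpt (f r)) - x0| <= rho.
  by rewrite (_ : chart_map c _ = v); [exact: vB|exact: mv].
have [xc ec] := nx r Dr cr.
have er : `|fcomp c (f r) - E0| <= rho.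
  rewrite leNgt; apply/negP => er.
  have h : fcomp c (f q) - E0 @[q --> within D (nbhs r)] --> fcomp c (f r) - E0.
    apply: cvgB; [exact: ec|exact: cvg_cst].
  have [d /= d0 Hd] : \forall q \near within D (nbhs r), rho < `|fcomp c (f q) - E0|.
    exact: (cvgr_norm_gt _ h).
  have sr : s < r by case/andP: rst.
  pose m := Num.min (d / 2) (r - s).
  have m0 : 0 < m by rewrite lt_min divr_gt0// subr_gt0.
  have md : m <= d / 2 by rewrite ge_min lexx.
  have ms : m <= r - s by rewrite ge_min lexx orbT.
  have rt : r <= t by case/andP: rst.
  have I1 : s <= r - m < r by apply/andP; split; clear -m0 ms; lra.
  have [_ _ h3] := HP _ I1.
  have H1 : ball_ (fun x => `|x|) r d (r - m).
    rewrite /ball_ /= opprB addrCA subrr addr0 gtr0_norm//; clear -md d0; lra.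
  have H2 : D (r - m) by apply: Dsub; case/andP: I1 => -> /ltW/le_trans; apply.
  have := Hd _ H1 H2; rewrite ltNge => /negP; apply; exact: ltW.
have Qr : Q r := And3 cr xr er.
have HQ q : s <= q <= r -> Q q.
  move=> /andP[sq]; rewrite le_eqVlt => /predU1P[->|qr]; first exact: Qr.
  by apply: PQ; apply: HP; rewrite sq.
have Dr' : `[s, r]%classic `<=` D.
  move=> q; rewrite /= in_itv /= => /andP[sq qr]; apply: Dsub; rewrite sq /=.
  by apply: le_trans qr _; case/andP: srt.
have gd q : s <= q <= r -> dw `[s, r]%classic (fun q => K * L q) q (K * gn D f q).
  move=> sqr; have Dq : `[s, r]%classic q by rewrite /= in_itv.
  have := dwM Dq (dw_cst _ (K : R) q) (dw_subset Dr' (Ld q (Dr' q Dq))).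
  by rewrite mul0r add0r.
have bd q : s <= q <= r -> `|xdot D f c q| <= K * gn D f q /\ `|edot D f c q| <= K * gn D f q.
  move=> sqr; have Dq : D q by apply: Dr'; rewrite /= in_itv.
  have [cq xq eq] := HQ q sqr.
  have eEb : `|fcomp c (f q)| <= Eb.
    by rewrite -(subrK E0 (fcomp c (f q))); apply: le_trans (ler_normD _ _) _; rewrite addrC lerD2l.
  have [_ [_ HG]] := Hrho _ xq.
  have [b1 b2] := dot_bound pD Dq (fC q Dq) cq eEb Kg0 HG.
  have g0 : 0 <= gn D f q by rewrite addr_ge0.
  by split; [apply: le_trans b1 _|apply: le_trans b2 _]; rewrite ler_wpM2r// lerDl.
have sr : s <= r by case/andP: srt.
have xd q : s <= q <= r -> dw `[s, r]%classic (chart_map c \o (@fpt _ S \o f)) q (xdot D f c q).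
  move=> sqr; have Dq : D q by apply: Dr'; rewrite /= in_itv.
  have [cq _ _] := HQ q sqr; have [_ /(_ c cq)[/C1_within_at_dw h _]] := fC q Dq.
  exact: dw_subset Dr' h.
have ed q : s <= q <= r -> dw `[s, r]%classic (fcomp c \o f) q (edot D f c q).
  move=> sqr; have Dq : D q by apply: Dr'; rewrite /= in_itv.
  have [cq _ _] := HQ q sqr; have [_ /(_ c cq)[_ /C1_within_at_dw h]] := fC q Dq.
  exact: dw_subset Dr' h.
(* L is nondecreasing, so the length up to r is at most the whole length, which is below
   [rho / K]. *)
have Lr : K * L r - K * L s < rho.
  have LL : L r <= L t.
    have Drt : `[r, t]%classic `<=` D.
      move=> q; rewrite /= in_itv /= => /andP[rq qt]; apply: Dsub; rewrite qt andbT.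
      exact: le_trans rq.
    have rt : r <= t by case/andP: srt.
    have := @dw_le _ (cst 0) (cst 0) L (gn D f) r t rt (fun r _ => @dw_cst R R _ 0 r).
    rewrite subrr subr_ge0; apply => q rqt.
      by apply: (dw_subset Drt); apply: Ld; apply: Drt; rewrite /= in_itv.
    by rewrite addr_ge0.
  rewrite -mulrBr -ltr_pdivlMl// mulrC; apply: le_lt_trans Llt.
  by rewrite lerD2r.
have fx : chart_map c (fpt (f s)) = x0 by rewrite fs.
have fe : fcomp c (f s) = E0 by rewrite fs.
split; first exact: cr.
  have := dw_norm_le sr xd gd (fun q h => (bd q h).1).
  rewrite [(chart_map c \o _) s]fx => h; exact: le_lt_trans h Lr.
have := dw_norm_le sr ed gd (fun q h => (bd q h).2).
rewrite [(fcomp c \o f) s]fe => h; exact: le_lt_trans h Lr.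
Qed.

End LowerBound.

(** * Orthonormal frames along curves *)

#[local] Transparent fcomp.

Section ChartCurves.
Context {R : realType} (S : spacetime R).
Implicit Types (c : chart S) (D : set R) (u : R -> frame S).

Lemma cvg_row (T : Type) (F : set_system T) {FF : Filter F} m n (f : T -> 'M[R]_(m, n))
    (A : 'M[R]_(m, n)) i : f x @[x --> F] --> A -> row i (f x) @[x --> F] --> row i A.
Proof.
move=> fA; apply: cvg_mx => a j; rewrite mxE.
by under eq_cvg do rewrite mxE; exact: cvg_entry.
Qed.

Lemma frame_eq c (f g : frame S) : chart_dom c (fpt f) -> fpt f = fpt g ->
  fcomp c f = fcomp c g -> f = g.
Proof.
case: f g => [p A uA] [q B uB] /= cp pq; rewrite -pq in uB *.
have uT := tchange_unit cp.
rewrite /fcomp /= => AB.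
have {}AB : A = B by rewrite -(mulmxK uT A) AB mulmxK.
move: uA uB; rewrite -AB => uA uB; congr Frame; exact: eq_irrelevance.
Qed.

Lemma fcompE c (f : frame S) : fcomp c f = fmat f *m tchange c (fpt f).
Proof. by []. Qed.

#[local] Opaque fcomp.

(** Curves of frames are constructed in a single chart, while [C1_frame_curve] speaks of all charts;
    the transition rules [dw_xtrans] and [dw_etrans] carry the regularity over. *)
Lemma chart_curve c D u (x x' : R -> 'rV[R]_4) (E E' : R -> 'M[R]_4) : perfect_in D ->
  (forall t, D t -> cimg c (x t) /\ fpt (u t) = chart_inv c (x t) /\ fcomp c (u t) = E t) ->
  (forall t, D t -> dw D x t (x' t) /\ x' s @[s --> within D (nbhs t)] --> x' t) ->
  (forall t, D t -> dw D E t (E' t) /\ E' s @[s --> within D (nbhs t)] --> E' t) ->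
  C1_frame_curve D u /\ forall t, D t ->
    om D u t = omf (E t) (christoffel_mx c (x t) (x' t)) (E' t) /\
    th D u t = x' t *m invmx (E t).
Proof.
move=> pD H Hx HE.
have cu t : D t -> chart_dom c (fpt (u t)).
  by move=> Dt; have [cx [-> _]] := H t Dt; case: (cimg_inv cx).
have xE t : D t -> chart_map c (fpt (u t)) = x t.
  by move=> Dt; have [cx [-> _]] := H t Dt; case: (cimg_inv cx).
have uc t : D t -> fpt (u s) @[s --> within D (nbhs t)] --> fpt (u t).
  move=> Dt; have [cx [-> _]] := H t Dt.
  apply: (@cvg_congr_near _ _ (within D (nbhs t)) _ (fun s => chart_inv c (x s))).
    by rewrite near_withinE; near=> s => Ds; have [_ [-> _]] := H s Ds.
  apply: (@cvg_comp _ _ _ x (chart_inv c) _ _ _ (dw_continuous Dt (Hx t Dt).1)).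
  exact: chart_inv_cts.
have dx t : D t -> dw D (chart_map c \o (@fpt _ S \o u)) t (x' t).
  move=> Dt; apply: (dw_near Dt _ (Hx t Dt).1).
  by rewrite near_withinE; near=> s => Ds; exact: esym (xE s Ds).
have dE t : D t -> dw D (fcomp c \o u) t (E' t).
  move=> Dt; apply: (dw_near Dt _ (HE t Dt).1).
  by rewrite near_withinE; near=> s => Ds; have [_ [_ h]] := H s Ds; exact: esym h.
have uC t : D t -> C1f_at D u t.
  move=> Dt; split; first exact: uc.
  move=> c' c't.
  have N : \forall s \near within D (nbhs t), D s /\ chart_dom c' (fpt (u s)).
    by apply: filterI; [exact: withinT|exact: (uc t Dt _ (chart_dom_nbhs c't))].
  have tx := tdom_map (cu t Dt) c't.
  have xc : chart_map c (fpt (u s)) @[s --> within D (nbhs t)] --> chart_map c (fpt (u t)).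
    exact: (dw_continuous Dt (dx t Dt)).
  have Ec : fcomp c (u s) @[s --> within D (nbhs t)] --> fcomp c (u t).
    exact: (dw_continuous Dt (dE t Dt)).
  have Jc : Jac c c' (chart_map c (fpt (u s))) @[s --> within D (nbhs t)] -->
      Jac c c' (chart_map c (fpt (u t))).
    apply: (@cvg_comp _ _ _ (fun s => chart_map c (fpt (u s))) (Jac c c') _ _ _ xc).
    by apply: differentiable_continuous; have [] := Jac_diff tx.
  have x'c := (Hx t Dt).2; have E'c := (HE t Dt).2.
  split.
    apply: (@C1_within_atI _ _ _ _ (fun s => x' s *m Jac c c' (chart_map c (fpt (u s)))) t pD Dt).
      apply: filterS N => s [Ds c's].
      exact: (dw_xtrans Ds (cu s Ds) c's (uc s Ds) (dx s Ds)).
    exact: (cvg_mulmx x'c Jc).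
  apply: (@C1_within_atI _ _ _ _ (fun s => E' s *m Jac c c' (chart_map c (fpt (u s))) +
      fcomp c (u s) *m dJac c c' (chart_map c (fpt (u s))) (x' s)) t pD Dt).
    apply: filterS N => s [Ds c's].
    exact: (dw_etrans Ds (cu s Ds) c's (uc s Ds) (dx s Ds) (dE s Ds)).
  have h1 := cvg_mulmx E'c Jc.
  have h2 : dJac c c' (chart_map c (fpt (u s))) (x' s) @[s --> within D (nbhs t)] -->
      dJac c c' (chart_map c (fpt (u t))) (x' t).
    exact: (dJac_cts _ tx xc x'c).
  have h3 := cvg_mulmx Ec h2.
  by apply: cvgD; [exact: h1|exact: h3].
split; first exact/C1_frame_curveP.
move=> t Dt; have [oE tE] := om_th_chart pD Dt (uC t Dt) (cu t Dt).
have [_ [_ eE]] := H t Dt.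
have x'E : xdot D u c t = x' t by exact: (deriv_withinE (pD t Dt) (dx t Dt)).
have e'E : edot D u c t = E' t by exact: (deriv_withinE (pD t Dt) (dE t Dt)).
by rewrite oE tE (xE t Dt) eE x'E e'E.
Unshelve. all: by end_near. Qed.

Definition orthonormal (f : frame S) : Prop :=
  fmat f *m metric (fpt f) *m (fmat f)^T = Defs.minkowski R.

Lemma fcomp_gram c (f : frame S) : chart_dom c (fpt f) ->
  fcomp c f *m metric_in c (chart_map c (fpt f)) *m (fcomp c f)^T =
  fmat f *m metric (fpt f) *m (fmat f)^T.
Proof.
move=> cf; rewrite (metric_chart cf).
by rewrite fcompE trmx_mul !mulmxA.
Qed.

Lemma never0_sign D (f : R -> R) s t : D s -> D t ->
  (forall x y r, D x -> D y -> x <= r <= y -> D r) ->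
  {within D, continuous f} -> (forall r, D r -> f r != 0) -> 0 < f s -> 0 < f t.
Proof.
move=> Ds Dt iD fc f0 fs.
rewrite lt_def f0//= leNgt; apply/negP => ft.
have [st|ts] := leP s t.
  have [||r rst fr] := @IVT _ f s t 0 st.
  - apply: continuous_subspaceW fc => r; rewrite /= in_itv /=; exact: iD.
  - by rewrite ge_min (ltW ft) orbT le_max (ltW fs).
  have Dr : D r by apply: (iD s t) => //; move: rst; rewrite in_itv.
  by have := f0 r Dr; rewrite fr eqxx.
have [||r rst fr] := @IVT _ f t s 0 (ltW ts).
- apply: continuous_subspaceW fc => r; rewrite /= in_itv /=; exact: iD.
- by rewrite ge_min (ltW ft) le_max (ltW fs) orbT.
have Dr : D r by apply: (iD t s) => //; move: rst; rewrite in_itv.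
by have := f0 r Dr; rewrite fr eqxx.
Qed.

(** Two timelike vectors are never orthogonal. In the orthonormal frame f the product is, up to
    sign, the last component of the time field; if it were zero, only nonnegative terms would remain
    in the square of the time field. *)
Lemma timelike_neq0 (f : frame S) : orthonormal f ->
  (row ord_max (fmat f) *m metric (fpt f) *m (time_field (fpt f))^T) 0 0 != 0.
Proof.
move=> oF; set E := fmat f; set g := metric (fpt f); set T := time_field (fpt f).
have uE := fmat_unit f.
pose k := T *m invmx E.
have Tk : T = k *m E by rewrite mulmxKV.
have gE : E *m g *m T^T = Defs.minkowski R *m k^T.
  by rewrite Tk trmx_mul !mulmxA oF.
have rE : (row ord_max E *m g *m T^T) 0 0 = - k 0 ord_max.
  rewrite -!row_mul gE mxE /Defs.minkowski mul_diag_mx !mxE eqxx mulN1r.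
  by [].
have TT : (T *m g *m T^T) 0 0 = \sum_(i < 4) k 0 i * ((if i == ord_max then -1 else 1) * k 0 i).
  have -> : T *m g *m T^T = k *m Defs.minkowski R *m k^T.
    by rewrite Tk trmx_mul -oF !mulmxA.
  rewrite mxE; apply: eq_bigr => i _.
  by rewrite /Defs.minkowski mul_mx_diag !mxE mulrA.
rewrite rE oppr_eq0; apply/eqP => k0.
have := time_field_timelike (fpt f); rewrite -/T -/g TT ltNge => /negP; apply.
apply: sumr_ge0 => i _; case: eqVneq => [->|_]; first by rewrite k0 !mul0r.
by rewrite mul1r -expr2 sqr_ge0.
Qed.

(** The orientation number and the product with the time field vary continuously and never vanish on
    orthonormal frames, so their signs are constant. Continuity is checked in a chart, where
    [orientation] and [time_field] are continuous by definition. *)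
Lemma positive_along D u s : perfect_in D -> (forall t, D t -> C1f_at D u t) ->
  (forall x y r, D x -> D y -> x <= r <= y -> D r) ->
  (forall t, D t -> orthonormal (u t)) -> D s -> positive_frame (u s) ->
  forall t, D t -> positive_frame (u t).
Proof.
move=> pD uC iD uo Ds [_ os ts] t Dt.
have cE r : D r -> let c := chart_at (fpt (u r)) in
    [/\ fpt (u q) @[q --> within D (nbhs r)] --> fpt (u r),
        fcomp c (u q) @[q --> within D (nbhs r)] --> fcomp c (u r),
        chart_dom c (fpt (u r)) &
        \forall q \near within D (nbhs r), chart_dom c (fpt (u q))].
  move=> Dr c; have cu : chart_dom c (fpt (u r)) by exact: chart_atP.
  have [uc /(_ c cu)[_ /C1_within_at_dw eC]] := uC r Dr.
  split => //; first exact: (dw_continuous Dr eC).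
  exact: near_dom (uC r Dr) cu.
split; first exact: uo.
  apply: (@never0_sign D (fun r => orientation (fpt (u r)) * \det (fmat (u r))) s t) => //.
    apply/subspace_continuousP => r Dr; have [gc ec cr nr] := cE r Dr.
    set c := chart_at (fpt (u r)) in ec cr nr.
    have E q : chart_dom c (fpt (u q)) -> orientation (fpt (u q)) / \det (tchange c (fpt (u q))) *
        \det (fcomp c (u q)) = orientation (fpt (u q)) * \det (fmat (u q)).
      move=> cq; have := tchange_unit cq; rewrite unitmxE unitfE => dT.
      rewrite (fcompE c (u q)).
      by rewrite det_mulmx; field.
    suff G : orientation (fpt (u q)) * \det (fmat (u q)) @[q --> within D (nbhs r)] -->
        orientation (fpt (u r)) / \det (tchange c (fpt (u r))) * \det (fcomp c (u r)).
      by rewrite (E r cr) in G; exact: G.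
    apply: (@cvg_congr_near _ _ (within D (nbhs r)) _ (fun q =>
      orientation (fpt (u q)) / \det (tchange c (fpt (u q))) * \det (fcomp c (u q)))).
      by apply: filterS nr => q; exact: E.
    apply: cvgM; last exact: cvg_det.
    apply: (@cvg_comp _ _ _ (fun q => fpt (u q)) (fun p => orientation p / \det (tchange c p)) _ _ _ gc).
    have := @orientation_continuous _ S c.
    by rewrite (continuous_open_subspace _ (@chart_dom_open _ S c)); apply; rewrite inE.
  move=> r Dr; rewrite mulf_neq0 ?orientation_neq0//.
  by have := fmat_unit (u r); rewrite unitmxE unitfE.
rewrite -oppr_gt0.
apply: (@never0_sign D (fun r => - (row ord_max (fmat (u r)) *m metric (fpt (u r)) *m
  (time_field (fpt (u r)))^T) 0 0) s t) => //; last by rewrite oppr_gt0.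
  apply/subspace_continuousP => r Dr; have [gc ec cr nr] := cE r Dr.
  set c := chart_at (fpt (u r)) in ec cr nr.
  have E q : chart_dom c (fpt (u q)) ->
      - (row ord_max (fcomp c (u q)) *m metric_in c (chart_map c (fpt (u q))) *m
        (time_field (fpt (u q)) *m tchange c (fpt (u q)))^T) 0 0 =
      - (row ord_max (fmat (u q)) *m metric (fpt (u q)) *m (time_field (fpt (u q)))^T) 0 0.
    move=> cq; rewrite (metric_chart cq).
    rewrite (fcompE c (u q)).
    by rewrite row_mul trmx_mul !mulmxA.
  suff G : - (row ord_max (fmat (u q)) *m metric (fpt (u q)) *m (time_field (fpt (u q)))^T) 0 0
      @[q --> within D (nbhs r)] -->
      - (row ord_max (fcomp c (u r)) *m metric_in c (chart_map c (fpt (u r))) *m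
        (time_field (fpt (u r)) *m tchange c (fpt (u r)))^T) 0 0.
    by rewrite (E r cr) in G; exact: G.
  apply: (@cvg_congr_near _ _ (within D (nbhs r)) _ (fun q =>
     - (row ord_max (fcomp c (u q)) *m metric_in c (chart_map c (fpt (u q))) *m
        (time_field (fpt (u q)) *m tchange c (fpt (u q)))^T) 0 0)).
    by apply: filterS nr => q; exact: E.
  have r1 : row ord_max (fcomp c (u q)) @[q --> within D (nbhs r)] -->
    row ord_max (fcomp c (u r)) by exact: cvg_row.
  have r2 : metric_in c (chart_map c (fpt (u q))) @[q --> within D (nbhs r)] -->
      metric_in c (chart_map c (fpt (u r))).
    apply: (@cvg_comp _ _ _ (fun q => chart_map c (fpt (u q))) (metric_in c)); last first.
      by apply: metric_in_cts; exact: cimg_map.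
    apply: (@cvg_comp _ _ _ (fun q => fpt (u q)) (chart_map c) _ _ _ gc).
    exact: chart_map_cts.
  have r3 : time_field (fpt (u q)) *m tchange c (fpt (u q)) @[q --> within D (nbhs r)] -->
      time_field (fpt (u r)) *m tchange c (fpt (u r)).
    apply: (@cvg_comp _ _ _ (fun q => fpt (u q)) (fun p => time_field p *m tchange c p) _ _ _ gc).
    have := @time_field_continuous _ S c.
    by rewrite (continuous_open_subspace _ (@chart_dom_open _ S c)); apply; rewrite inE.
  have r4 := cvg_mulmx (cvg_mulmx r1 r2) (cvg_trmx r3).
  by apply: cvgN; apply: cvg_entry; exact: r4.
move=> r Dr; rewrite oppr_eq0; exact: timelike_neq0 (uo r Dr).
Unshelve. all: by end_near. Qed.

End ChartCurves.

(** * Short curves reaching all nearby frames *)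

Section Families.
Context {R : realType} (Z : normedModType R) (z0 : Z).

Notation I := (`[0%R, 1%R]%classic : set R).

(* Such families give curves of length O(z - z0) once they are lifted to O+M. *)
Definition fam (V : normedModType R) (f : Z -> R -> V) (v0 : V) : Prop :=
  exists f' : Z -> R -> V, exists2 C : R, 0 <= C &
    \forall z \near z0, f z 0 = v0 /\
      forall t, I t -> [/\ dw I (f z) t (f' z t), `|f' z t| <= C * `|z - z0| &
                          f' z s @[s --> within I (nbhs t)] --> f' z t].

Lemma pI : perfect_in I.
Proof. exact: perfect_segment ltr01. Qed.

Lemma norm_near (e : R) : 0 < e -> \forall z \near z0, `|z - z0| < e.
Proof.
move=> e0; apply/nbhs_ballP; exists e => // z; rewrite -ball_normE /ball_ /= distrC.
by [].
Qed.

Lemma fam_eq (V : normedModType R) (f g : Z -> R -> V) v0 :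
  (\forall z \near z0, forall t, I t -> f z t = g z t) -> fam f v0 -> fam g v0.
Proof.
move=> fg [f' [C C0 fH]]; exists f', C => //.
apply: filterS2 fg fH => z fgz [fz0 H]; split.
  by rewrite -fgz// /= in_itv /= lexx ler01.
move=> t It; have [h1 h2 h3] := H t It; split => //.
apply: (dw_near It _ h1); rewrite near_withinE; near=> s => Is; exact: fgz.
Unshelve. all: by end_near. Qed.

Lemma fam_cst (V : normedModType R) (v : V) : fam (fun _ _ => v) v.
Proof.
exists (fun _ _ => 0), 0 => //; near=> z; split => // t It; split.
- exact: dw_cst.
- by rewrite normr0 mul0r.
- exact: cvg_cst.
Unshelve. all: by end_near. Qed.

Lemma fam_entry m n (f : Z -> R -> 'M[R]_(m, n)) A i j :
  fam f A -> fam (fun z t => f z t i j) (A i j).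
Proof.
move=> [f' [C C0 fH]]; exists (fun z t => f' z t i j), C => //.
apply: filterS fH => z [fz0 H]; split; first by rewrite fz0.
move=> t It; have [h1 h2 h3] := H t It; split.
- exact: dw_entry.
- exact: le_trans (mx_entry_le _ _ _) h2.
- exact: cvg_entry.
Qed.

Lemma fam_mx m n (f : Z -> R -> 'I_m -> 'I_n -> R) (A : 'I_m -> 'I_n -> R) :
  (forall i j, fam (fun z t => f z t i j) (A i j)) ->
  fam (fun z t => \matrix_(i, j) f z t i j) (\matrix_(i, j) A i j).
Proof.
move=> H.
have H' (ij : 'I_m * 'I_n) : exists fC : (Z -> R -> R) * R, 0 <= fC.2 /\
    \forall z \near z0, f z 0 ij.1 ij.2 = A ij.1 ij.2 /\
      forall t, I t -> [/\ dw I (fun t => f z t ij.1 ij.2) t (fC.1 z t), `|fC.1 z t| <= fC.2 * `|z - z0| &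
                          fC.1 z s @[s --> within I (nbhs t)] --> fC.1 z t].
  by have [f' [C C0 h]] := H ij.1 ij.2; exists (f', C).
have [F FH] := choice H'.
exists (fun z t => \matrix_(i, j) (F (i, j)).1 z t), (\sum_ij (F ij).2).
  by apply: sumr_ge0 => ij _; have [] := FH ij.
have : \forall z \near z0, forall ij, f z 0 ij.1 ij.2 = A ij.1 ij.2 /\
      forall t, I t -> [/\ dw I (fun t => f z t ij.1 ij.2) t ((F ij).1 z t), `|(F ij).1 z t| <= (F ij).2 * `|z - z0| &
                          (F ij).1 z s @[s --> within I (nbhs t)] --> (F ij).1 z t].
  by apply: (@filter_forall _ _ _ (nbhs z0)) => ij; have [] := FH ij.
apply: filterS => z Hz; split.
  by apply/matrixP => i j; rewrite !mxE; have [] := Hz (i, j).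
move=> t It; split.
- apply: dw_mx => i j; rewrite mxE; have [_ /(_ t It)[h _ _]] := Hz (i, j).
  by apply: (dw_near It _ h); near=> s; rewrite mxE.
- apply: mx_norm_le => [|i j].
    by rewrite mulr_ge0// sumr_ge0// => ij _; have [] := FH ij.
  rewrite mxE; have [_ /(_ t It)[_ h _]] := Hz (i, j).
  apply: le_trans h _; rewrite ler_wpM2r// (bigD1 (i, j))//= lerDl.
  by apply: sumr_ge0 => ij _; have [] := FH ij.
- by apply: cvg_matrix => i j; have [_ /(_ t It)[_ _ h]] := Hz (i, j).
Unshelve. all: by end_near. Qed.

(** By the mean value inequality on [0, t] the deviation from A is at most [C * |z - z0|], uniformly
    in t. *)
Lemma fam_bound m n (f : Z -> R -> 'M[R]_(m, n)) A (e : R) : 0 < e -> fam f A ->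
  \forall z \near z0, forall t, I t -> `|f z t - A| <= e.
Proof.
move=> e0 [f' [C C0 fH]].
have eC : 0 < e / (C + 1) by rewrite divr_gt0// ltr_pwDr.
apply: filterS2 (norm_near eC) fH => z ze [fz0 H] t It.
have It' : 0 <= t <= 1 by move: It; rewrite /= in_itv.
have /andP[t0 t1] := It'.
have sub : `[0, t]%classic `<=` I.
  move=> r; rewrite /= !in_itv /= => /andP[r0 rt]; rewrite r0 /=; exact: le_trans t1.
have fd r : 0 <= r <= t -> dw `[0, t]%classic (f z) r (f' z r).
  move=> rt; have Ir : I r by apply: sub; rewrite /= in_itv.
  by have [h _ _] := H r Ir; exact: dw_subset h.
have gd r : 0 <= r <= t -> dw `[0, t]%classic (fun r => C * `|z - z0| * r) r (C * `|z - z0|).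
  move=> rt; have Dr : `[0, t]%classic r by rewrite /= in_itv.
  have := dwM Dr (dw_cst _ (C * `|z - z0| : R) r) (dw_id Dr).
  by rewrite mul0r add0r mulr1.
have := dw_norm_le t0 fd gd; rewrite fz0 mulr0 subr0 => h.
apply: le_trans (h _) _.
  move=> r rt; have Ir : I r by apply: sub; rewrite /= in_itv.
  by have [] := H r Ir.
apply: (@le_trans _ _ (C * `|z - z0|)); first by rewrite ler_piMr// mulr_ge0.
apply: (@le_trans _ _ ((C + 1) * (e / (C + 1)))).
  by rewrite ler_pM// ?lerDl// ltW.
by rewrite mulrC divfK// gt_eqF// ltr_pwDr.
Qed.

(** Scalars are treated as 1 by 1 matrices. *)
Lemma fam_bound1 (f : Z -> R -> R) a (e : R) : 0 < e -> fam f a ->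
  \forall z \near z0, forall t, I t -> `|f z t - a| <= e.
Proof.
move=> e0 fa.
have fM : fam (fun z t => \matrix_(i < 1, j < 1) f z t) (\matrix_(i < 1, j < 1) a).
  by apply: (@fam_mx 1 1 (fun z t _ _ => f z t) (fun _ _ => a)).
apply: filterS (fam_bound e0 fM) => z H t It; apply: le_trans (H t It).
by have := mx_entry_le (\matrix_(i < 1, j < 1) f z t - \matrix_(i < 1, j < 1) a) 0 0; rewrite !mxE.
Qed.

Lemma fam_mulmx m n p (f : Z -> R -> 'M[R]_(m, n)) (g : Z -> R -> 'M[R]_(n, p)) A B :
  fam f A -> fam g B -> fam (fun z t => f z t *m g z t) (A *m B).
Proof.
move=> fA gB; have bf := fam_bound ltr01 fA; have bg := fam_bound ltr01 gB.
move: fA gB => [f' [C C0 fH]] [g' [K K0 gH]].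
exists (fun z t => f' z t *m g z t + f z t *m g' z t),
  (n%:R * (C * (`|B| + 1)) + n%:R * ((`|A| + 1) * K)).
  by rewrite addr_ge0// !mulr_ge0// addr_ge0.
apply: filterS2 (filterI bf bg) (filterI fH gH) => z [bfz bgz] [[fz0 Hf] [gz0 Hg]].
split; first by rewrite fz0 gz0.
move=> t It; have [f1 f2 f3] := Hf t It; have [g1 g2 g3] := Hg t It.
have fA : `|f z t| <= `|A| + 1.
  by rewrite -(subrK A (f z t)); apply: le_trans (ler_normD _ _) _; rewrite addrC lerD2l bfz.
have gB : `|g z t| <= `|B| + 1.
  by rewrite -(subrK B (g z t)); apply: le_trans (ler_normD _ _) _; rewrite addrC lerD2l bgz.
split.
- exact: dw_mulmx.
- rewrite mulrDl; apply: le_trans (ler_normD _ _) _; apply: lerD.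
    apply: le_trans (mx_norm_mul _ _) _; rewrite -mulrA ler_wpM2l// mulrAC.
    by rewrite ler_pM.
  apply: le_trans (mx_norm_mul _ _) _; rewrite -!mulrA ler_wpM2l//.
  by rewrite ler_pM.
- have fc := dw_continuous It f1; have gc := dw_continuous It g1.
  by apply: cvgD; exact: cvg_mulmx.
Qed.

Lemma fam_trmx m n (f : Z -> R -> 'M[R]_(m, n)) A : fam f A -> fam (fun z t => (f z t)^T) A^T.
Proof.
move=> [f' [C C0 fH]]; exists (fun z t => (f' z t)^T), C => //.
apply: filterS fH => z [fz0 H]; split; first by rewrite fz0.
move=> t It; have [h1 h2 h3] := H t It; split.
- exact: dw_trmx.
- by rewrite mx_norm_tr.
- exact: cvg_trmx.
Qed.

Lemma fam_mul (f g : Z -> R -> R) a b : fam f a -> fam g b ->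
  fam (fun z t => f z t * g z t) (a * b).
Proof.
move=> fa gb.
have fM : fam (fun z t => \matrix_(i < 1, j < 1) f z t) (\matrix_(i < 1, j < 1) a).
  by apply: (@fam_mx 1 1 (fun z t _ _ => f z t) (fun _ _ => a)).
have gM : fam (fun z t => \matrix_(i < 1, j < 1) g z t) (\matrix_(i < 1, j < 1) b).
  by apply: (@fam_mx 1 1 (fun z t _ _ => g z t) (fun _ _ => b)).
have := fam_entry 0 0 (fam_mulmx fM gM).
rewrite mxE big_ord1 !mxE; apply: fam_eq; near=> z => t It.
by rewrite mxE big_ord1 !mxE.
Unshelve. all: by end_near. Qed.

Lemma fam_fun (phi phi' : R -> R) (f : Z -> R -> R) a : fam f a ->
  (\forall y \near a, is_derive y (1 : R) phi (phi' y)) ->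
  (\forall y \near a, {for y, continuous phi'}) ->
  fam (fun z t => phi (f z t)) (phi a).
Proof.
move=> fa pd pc.
have pb : \forall y \near a, `|phi' y| <= `|phi' a| + 1.
  have h : phi' y @[y --> a] --> phi' a by exact: nbhs_singleton pc.
  by apply: (@cvgr_norm_le _ _ _ (nbhs a) _ phi' _ h); rewrite ltrDl.
have [e /= e0 He] := filterI pd (filterI pc pb).
have e2 : 0 < e / 2 by rewrite divr_gt0.
have fb := fam_bound1 e2 fa.
move: fa => [f' [C C0 fH]].
exists (fun z t => phi' (f z t) * f' z t), ((`|phi' a| + 1) * C).
  by rewrite mulr_ge0// addr_ge0.
apply: filterS2 fb fH => z fbz [fz0 H]; split; first by rewrite fz0.
move=> t It; have [h1 h2 h3] := H t It.
have [d [c b]] : is_derive (f z t) (1 : R) phi (phi' (f z t)) /\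
    {for (f z t), continuous phi'} /\ `|phi' (f z t)| <= `|phi' a| + 1.
  apply: He; rewrite /ball_ /= distrC; apply: le_lt_trans (fbz t It) _.
  by rewrite ltr_pdivrMr// ltr_pMr// ltr1n.
split.
- have := @dw_comp R _ setT I (f z) phi t _ _ It (fun _ _ => Logic.I) h1 (is_derive_dw setT d).
  by rewrite -[_ *: _]/(_ * _) mulrC.
- by rewrite normrM -mulrA ler_pM.
- apply: cvgM => //; apply: (@cvg_comp _ _ _ (f z) phi' _ _ _ (dw_continuous It h1)); exact: c.
Qed.

End Families.

(** * Gram-Schmidt orthonormalisation for the Lorentz metric *)

Section GramSchmidt.
Context {R : realType}.

Notation eta := (Defs.minkowski R).

Lemma minkowskiE i j : eta i j = if i == j then (if i == ord_max then -1 else 1) else 0.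
Proof.
rewrite /Defs.minkowski !mxE; by case: (eqVneq i j) => [->|ij].
Qed.

Lemma minkowski_diag_sq k : eta k k * eta k k = 1.
Proof. by rewrite minkowskiE eqxx; case: ifP => _; rewrite ?mulrNN mulr1. Qed.

(* Left multiplication by [pivot k G] normalizes the k-th vector of a family with Gram
   matrix G and makes the other vectors orthogonal to it. *)
Definition pivot (k : 'I_4) (G : 'M[R]_4) : 'M[R]_4 :=
  \matrix_(i, j) if j == k then (if i == k then (Num.sqrt (eta k k * G k k))^-1
                                 else (-1) * (G i k * (G k k)^-1))
                 else (i == j)%:R.

Lemma pivot_mul k G (B : 'M[R]_4) i j : (pivot k G *m B) i j =
  if i == k then (Num.sqrt (eta k k * G k k))^-1 * B k j
  else B i j - G i k * (G k k)^-1 * B k j.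
Proof.
rewrite mxE (bigD1 k)//= mxE eqxx; case: (eqVneq i k) => [->|ik].
  rewrite big1 ?addr0// => a ak; rewrite mxE (negbTE ak) eq_sym (negbTE ak) mul0r.
  by [].
rewrite (bigD1 i)//= mxE (negbTE ik) eqxx mul1r big1 => [|a /andP[ak ai]].
  by rewrite mulN1r mulNr addr0 addrC.
by rewrite mxE (negbTE ak) eq_sym (negbTE ai) mul0r.
Qed.

Lemma pivot_eta k : pivot k eta = 1%:M.
Proof.
apply/matrixP => i j; rewrite [LHS]mxE [RHS]mxE; case: (eqVneq j k) => [->|jk] //.
case: (eqVneq i k) => [_|ik]; first by rewrite minkowski_diag_sq sqrtr1 invr1.
by rewrite minkowskiE (negbTE ik) mul0r mulr0.
Qed.

(** Pivoting at k makes row k of the Gram matrix correct and keeps any row l that already is, since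
    the l-th vector is then orthogonal to the k-th. The factor [eta k k] makes the number under the
    root positive for the timelike vector too. *)
Lemma pivot_gram k (G : 'M[R]_4) l : G^T = G -> 0 < eta k k * G k k ->
  (l != k -> forall j, G l j = eta l j) ->
  forall j, (pivot k G *m G *m (pivot k G)^T) l j = eta l j.
Proof.
move=> Gs Gk Gl j.
have -> : (pivot k G *m G *m (pivot k G)^T) l j = (pivot k G *m (pivot k G *m G)^T) j l.
  by rewrite -[in LHS](trmxK (pivot k G *m G)) -trmx_mul mxE.
have E a : (pivot k G *m G)^T a l = (pivot k G *m G) l a by rewrite mxE.
rewrite pivot_mul !E !pivot_mul.
have Gk0 : G k k != 0.
  by apply/eqP => G0; move: Gk; rewrite G0 mulr0 ltxx.
have Gsym a b : G a b = G b a by rewrite -[in LHS]Gs mxE.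
set s := (Num.sqrt _)^-1.
have [->|lk] := eqVneq l k.
  have [->|jk] := eqVneq j k.
    rewrite mulrA -expr2 /s exprVn sqr_sqrtr ?(ltW Gk)//.
    rewrite invfM -mulrA mulVf// mulr1.
    have := minkowski_diag_sq k => h.
    have e0 : eta k k != 0 by apply/eqP => e0; move: h; rewrite e0 mul0r => /eqP; rewrite eq_sym oner_eq0.
    by apply: (mulfI e0); rewrite mulfV// h.
  rewrite (Gsym j k) minkowskiE eq_sym (negbTE jk).
  by rewrite mulrCA -mulrA mulVf// mulr1 [s * _]mulrC subrr.
have G0 : G l k = 0 by rewrite Gl// minkowskiE (negbTE lk).
rewrite G0 !mul0r !subr0.
have [->|jk] := eqVneq j k; first by rewrite mulr0 minkowskiE (negbTE lk).
by rewrite mulr0 subr0 Gl.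
Qed.

Context (Z : normedModType R) (z0 : Z).
Notation I := (`[0%R, 1%R]%classic : set R).

Lemma near_pos (a : R) : 0 < a -> \forall y \near a, 0 < y.
Proof. exact: lt_nbhsr. Qed.

Lemma fam_inv (f : Z -> R -> R) a : 0 < a -> fam z0 f a -> fam z0 (fun z t => (f z t)^-1) a^-1.
Proof.
move=> a0 fa; apply: (@fam_fun R Z z0 (fun y => y^-1) (fun y => - y ^- 2) f a fa).
  apply: filterS (near_pos a0) => y y0.
  have y0' : y != 0 by rewrite gt_eqF.
  have dy : derivable (fun x : R => x) y 1 by exact: derivable_id.
  apply: DeriveDef; first exact: (derivableV y0' dy).
  by rewrite (deriveV y0' dy) derive_id -[_ *: 1]/(_ * 1) mulr1.
apply: filterS (near_pos a0) => y y0.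
have y0' : y ^+ 2 != 0 by rewrite expf_neq0// gt_eqF.
apply: (@cvgN _ _ _ (nbhs y)); apply: (@cvgV _ _ (nbhs y)) => //.
exact: exprn_continuous.
Qed.

Lemma fam_sqrt (f : Z -> R -> R) a : 0 < a -> fam z0 f a ->
  fam z0 (fun z t => Num.sqrt (f z t)) (Num.sqrt a).
Proof.
move=> a0 fa; apply: (@fam_fun R Z z0 Num.sqrt (fun y => (2 * Num.sqrt y)^-1) f a fa).
  by apply: filterS (near_pos a0) => y y0; exact: is_derive1_sqrt.
apply: filterS (near_pos a0) => y y0.
apply: (@cvgV _ _ (nbhs y)).
  by rewrite mulf_neq0// ?pnatr_eq0// gt_eqF// sqrtr_gt0.
by apply: (@cvgM _ _ (nbhs y)); [exact: cvg_cst|exact: sqrt_continuous].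
Qed.

Lemma fam_inv_neq0 (f : Z -> R -> R) a : a != 0 -> fam z0 f a ->
  fam z0 (fun z t => (f z t)^-1) a^-1.
Proof.
rewrite neq_lt => /orP[a0|a0]; last exact: fam_inv.
move=> fa; have Na : 0 < (-1) * a by rewrite mulN1r oppr_gt0.
have := fam_mul (fam_cst z0 (-1 : R)) (fam_inv Na (fam_mul (fam_cst z0 (-1 : R)) fa)).
have E (b : R) : -1 * (-1 * b)^-1 = b^-1 by rewrite !mulN1r invrN opprK.
by rewrite E; apply: fam_eq; near=> z => t _; rewrite E.
Unshelve. all: by end_near. Qed.

Lemma fam_pivot k (G : Z -> R -> 'M[R]_4) : fam z0 G eta -> fam z0 (fun z t => pivot k (G z t)) 1%:M.
Proof.
move=> fG; rewrite -(pivot_eta k) /pivot.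
have ek0 : eta k k != 0.
  by apply/eqP => e0; have := minkowski_diag_sq k; rewrite e0 mul0r => /eqP; rewrite eq_sym oner_eq0.
have ekk : 0 < eta k k * eta k k by rewrite minkowski_diag_sq.
apply: fam_mx => i j; case: (j == k); last exact: fam_cst.
case: (i == k).
  apply: fam_inv; first by rewrite sqrtr_gt0.
  apply: fam_sqrt; first exact: ekk.
  by apply: fam_mul; [exact: fam_cst|exact: fam_entry].
apply: fam_mul; first exact: fam_cst.
by apply: fam_mul; [exact: fam_entry|apply: fam_inv_neq0 => //; exact: fam_entry].
Qed.

(** One pivot is added per index. The pivot of [eta] is the identity, so all correction factors
    start at the identity. The clause that an orthonormal family is left unchanged later makes the
    lifted path end exactly at a prescribed orthonormal frame. *)
Lemma gram_schmidt_seq (G0 : Z -> R -> 'M[R]_4) (ks : seq 'I_4) : fam z0 G0 eta ->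
  (forall z t, (G0 z t)^T = G0 z t) ->
  exists A : Z -> R -> 'M[R]_4, [/\ fam z0 A 1%:M, forall z t, G0 z t = eta -> A z t = 1%:M &
    \forall z \near z0, forall t, I t -> forall l, l \in ks -> forall j,
      (A z t *m G0 z t *m (A z t)^T) l j = eta l j].
Proof.
move=> fG Gs; elim: ks => [|k ks [A [fA A1 HA]]].
  by exists (fun _ _ => 1%:M); split => //; [exact: fam_cst|near=> z].
pose G1 z t := A z t *m G0 z t *m (A z t)^T.
have fG1 : fam z0 G1 eta.
  have := fam_mulmx (fam_mulmx fA fG) (fam_trmx fA).
  by rewrite trmx1 mulmx1 mul1mx.
have G1s z t : (G1 z t)^T = G1 z t by rewrite /G1 !trmx_mul trmxK Gs mulmxA.
exists (fun z t => pivot k (G1 z t) *m A z t); split.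
- by have := fam_mulmx (fam_pivot k fG1) fA; rewrite mul1mx.
- by move=> z t E; rewrite /G1 (A1 z t E) E trmx1 mulmx1 !mul1mx mulmx1 pivot_eta.
(* The diagonal entries of [eta] are 1 or -1; Gram matrices within 1/2 of it therefore have pivots
   of the right sign. *)
have e2 : (0 : R) < 2^-1 by rewrite invr_gt0.
apply: filterS2 HA (fam_bound e2 fG1) => z HAz bz t It l lks j.
have Gk : 0 < eta k k * G1 z t k k.
  have := le_trans (mx_entry_le (G1 z t - eta) k k) (bz t It).
  have -> : (G1 z t - eta) k k = G1 z t k k - eta k k by rewrite [LHS]mxE [X in _ + X]mxE.
  rewrite minkowskiE eqxx; move: (G1 z t k k) => g; rewrite ler_norml => /andP[b1 b2].
  by move: b1 b2; case: ifP => _ b1 b2; lra.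
have := @pivot_gram k (G1 z t) l (G1s z t) Gk _ j.
rewrite !trmx_mul !mulmxA => -> // lk j'.
by apply: HAz => //; move: lks; rewrite in_cons (negbTE lk).
Unshelve. all: by end_near. Qed.

Lemma gram_schmidt (G0 : Z -> R -> 'M[R]_4) : fam z0 G0 eta ->
  (forall z t, (G0 z t)^T = G0 z t) ->
  exists A : Z -> R -> 'M[R]_4, [/\ fam z0 A 1%:M, forall z t, G0 z t = eta -> A z t = 1%:M &
    \forall z \near z0, forall t, I t -> A z t *m G0 z t *m (A z t)^T = eta].
Proof.
move=> fG Gs; have [A [fA A1 HA]] := gram_schmidt_seq (enum 'I_4) fG Gs.
exists A; split => //; apply: filterS HA => z HAz t It.
by apply/matrixP => l j; apply: HAz => //; rewrite mem_enum.
Qed.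

End GramSchmidt.

(** * Short curves in the orthonormal bundle from straight lines in a chart *)

Section UpperBound.
Context {R : realType} (S : spacetime R).
Notation Z := ('rV[R]_4 * 'M[R]_4)%type.
Notation I := (`[0%R, 1%R]%classic : set R).
Notation eta := (Defs.minkowski R).

Lemma cvg_eq_lim (T : Type) (V : normedModType R) (F : set_system T) (f : T -> V) (l l' : V) :
  f x @[x --> F] --> l -> l = l' -> f x @[x --> F] --> l'.
Proof. by move=> fl <-. Qed.

Lemma gram_tr n (A g : 'M[R]_n) : g^T = g -> (A *m g *m A^T)^T = A *m g *m A^T.
Proof. by move=> gs; rewrite !trmx_mul trmxK gs mulmxA. Qed.

Lemma gram_mul n (A B g : 'M[R]_n) :
  (A *m B) *m g *m (A *m B)^T = A *m (B *m g *m B^T) *m A^T.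
Proof. by rewrite trmx_mul !mulmxA. Qed.

Lemma fst_norm_le (z : Z) : `|z.1| <= `|z|.
Proof. by rewrite [leRHS]prod_normE le_max lexx. Qed.

Lemma snd_norm_le (z : Z) : `|z.2| <= `|z|.
Proof. by rewrite [leRHS]prod_normE le_max lexx orbT. Qed.

Lemma dw_line (V : normedModType R) (D : set R) (v w : V) t : D t ->
  dw D (fun s => v + s *: w) t w.
Proof.
move=> Dt; have := dwD (dw_cst D v t) (dwZ Dt (dw_id Dt) (dw_cst D w t)).
by rewrite scale1r scaler0 addr0 add0r.
Qed.

Lemma fam_fst (z0 : Z) : fam z0 (fun z t => z0.1 + t *: (z.1 - z0.1)) z0.1.
Proof.
exists (fun z t => z.1 - z0.1), 1 => //; near=> z; split.
  by rewrite scale0r addr0.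
move=> t It; split.
- exact: dw_line.
- by rewrite mul1r; exact: (fst_norm_le (z - z0)).
- exact: cvg_cst.
Unshelve. all: by end_near. Qed.

Lemma fam_snd (z0 : Z) : fam z0 (fun z t => z0.2 + t *: (z.2 - z0.2)) z0.2.
Proof.
exists (fun z t => z.2 - z0.2), 1 => //; near=> z; split.
  by rewrite scale0r addr0.
move=> t It; split.
- exact: dw_line.
- by rewrite mul1r; exact: (snd_norm_le (z - z0)).
- exact: cvg_cst.
Unshelve. all: by end_near. Qed.

Let mul4_ac (k n b : R) : 4 * (k * n * b) <= 4 * (k * b) * n.
Proof. by have -> : 4 * (k * n * b) = 4 * (k * b) * n by ring. Qed.

Variable c : chart S.

Lemma fam_metric (z0 : Z) : cimg c z0.1 ->
  fam z0 (fun z t => metric_in c (z0.1 + t *: (z.1 - z0.1))) (metric_in c z0.1).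
Proof.
move=> cz; set x0 := z0.1.
have Hi (i : 'I_4) : \forall y \near x0, `|'D_(delta_mx 0 i) (metric_in c) y| <=
    `|'D_(delta_mx 0 i) (metric_in c) x0| + 1.
  have G : 'D_(delta_mx 0 i) (metric_in c) y @[y --> x0] --> 'D_(delta_mx 0 i) (metric_in c) x0.
    exact: (metric_in_dcts (v := delta_mx 0 i) cz).
  by apply: (@cvgr_norm_le _ _ _ (nbhs x0) _ _ _ G); rewrite ltrDl.
have /nbhs_ballP[e /= e0 He] : \forall y \near x0, cimg c y /\
    forall i, `|'D_(delta_mx 0 i) (metric_in c) y| <= `|'D_(delta_mx 0 i) (metric_in c) x0| + 1.
  exact: (filterI (cimg_nbhs cz) (@filter_forall _ _ _ (nbhs x0) _ Hi)).
have e2 : 0 < e / 2 by rewrite divr_gt0.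
exists (fun z t => 'd (metric_in c) (x0 + t *: (z.1 - x0)) (z.1 - x0)),
  (\sum_(i < 4) (`|'D_(delta_mx 0 i) (metric_in c) x0| + 1)).
  by apply: sumr_ge0 => i _; rewrite addr_ge0.
apply: filterS (fam_bound e2 (fam_fst z0)) => z Hz; split; first by rewrite scale0r addr0.
move=> t It.
have [cy Hy] : cimg c (x0 + t *: (z.1 - x0)) /\ forall i,
    `|'D_(delta_mx 0 i) (metric_in c) (x0 + t *: (z.1 - x0))| <= `|'D_(delta_mx 0 i) (metric_in c) x0| + 1.
  apply: He; rewrite -ball_normE /ball_ /= distrC; apply: le_lt_trans (Hz t It) _.
  by rewrite ltr_pdivrMr// ltr_pMr// ltr1n.
split.
- apply: (@dw_diff _ _ _ _ (fun s => x0 + s *: (z.1 - x0)) (metric_in c)) => //.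
    exact: dw_line.
  exact: metric_in_diff.
- apply: (@le_trans _ _ `|\sum_(i < 4) (z.1 - x0) 0 i *: 'D_(delta_mx 0 i) (metric_in c) (x0 + t *: (z.1 - x0))|).
    by rewrite -(diff_sum_delta _ (metric_in_diff cy)).
  rewrite mulr_suml; apply: le_trans (ler_norm_sum _ _ _) _; apply: ler_sum => i _.
  rewrite normrZ mulrC ler_pM//.
  by apply: le_trans (mx_entry_le _ _ _) _; exact: (fst_norm_le (z - z0)).
- have lc : x0 + s *: (z.1 - x0) @[s --> within I (nbhs t)] --> x0 + t *: (z.1 - x0).
    have dl : dw I (fun s : R => x0 + s *: (z.1 - x0)) t (z.1 - x0) by exact: dw_line.
    exact: (dw_continuous It dl).
  apply: (cvg_eq_lim _ (esym (diff_sum_delta (z.1 - x0) (metric_in_diff cy)))).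
  apply: (@cvg_congr_near _ _ (within I (nbhs t)) _ (fun s => \sum_(i < 4)
    (z.1 - x0) 0 i *: 'D_(delta_mx 0 i) (metric_in c) (x0 + s *: (z.1 - x0)))).
    apply: (@filterS _ (within I (nbhs t)) _ _ _ _ (lc _ (cimg_nbhs cy))) => s cs.
    exact: esym (diff_sum_delta (z.1 - x0) (metric_in_diff cs)).
  apply: cvg_sumr => i _; apply: cvgZ; first exact: cvg_cst.
  apply: (@cvg_comp _ _ _ (fun s => x0 + s *: (z.1 - x0)) ('D_(delta_mx 0 i) (metric_in c)) _ _ _ lc).
  exact: metric_in_dcts.
Qed.

(** Every derivative along the corrected path H is of order [|z - z0|], and the inverse of H is
    bounded because H is orthonormal; so both forms, and the length, are of this order. For an
    orthonormal z.2 no correction takes place at time 1. For other z the path still ends over the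
    point with coordinates z.1. *)
Lemma conn_upper (u0 : OplusM S) (eps : R) : chart_dom c (Opi u0) -> 0 < eps ->
  \forall z \near frame_coord c (Oframe u0), exists (w : OplusM S) (l : R),
    [/\ conn u0 w l, l < eps, chart_dom c (Opi w), Opi w = chart_inv c z.1 &
        z.2 *m metric_in c z.1 *m z.2^T = eta -> fcomp c (Oframe w) = z.2].
Proof.
move=> cu0 eps0; set z0 := frame_coord c (Oframe u0).
have cz0 : cimg c z0.1 by exact: cimg_map.
have [po0 _ _] := set_valP u0.
have Eg0 : z0.2 *m metric_in c z0.1 *m z0.2^T = eta.
  by rewrite /z0 /= (fcomp_gram cu0).
pose x (z : Z) t := z0.1 + t *: (z.1 - z0.1).
pose F (z : Z) t := z0.2 + t *: (z.2 - z0.2).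
pose g (z : Z) t := metric_in c (x z t).
pose G (z : Z) t := F z t *m g z t *m (F z t)^T.
have fG : fam z0 G eta.
  rewrite -Eg0; apply: fam_mulmx; last exact: (fam_trmx (fam_snd z0)).
  by apply: fam_mulmx; [exact: fam_snd|exact: fam_metric].
have Gs z t : (G z t)^T = G z t.
  exact: gram_tr (metric_in_sym c (x z t)).
have [A [fA A1 HA]] := gram_schmidt fG Gs.
pose H z t := A z t *m F z t.
have fH : fam z0 H z0.2.
  by have := fam_mulmx fA (fam_snd z0); rewrite mul1mx.
have [Kg Kg0 HKg] := christoffel_bound cz0.
have /nbhs_ballP[e /= e0 He] : \forall y \near z0.1, cimg c y /\
    forall xi, `|christoffel_mx c y xi| <= Kg * `|xi|.
  exact: (filterI (cimg_nbhs cz0) HKg).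
have e2 : 0 < e / 2 by rewrite divr_gt0.
have bx := fam_bound e2 (fam_fst z0).
have bH := fam_bound ltr01 fH.
have bg := fam_bound ltr01 (fam_metric cz0).
move: fH => [H' [CH CH0 HH]].
pose Eb := `|z0.2| + 1; pose gb := `|metric_in c z0.1| + 1.
have Eb0 : 0 <= Eb by rewrite addr_ge0.
have gb0 : 0 <= gb by rewrite addr_ge0.
(* A bound for the inverse of H, which orthonormality gives explicitly as [g H^T eta]. *)
pose ib := 4 * (4 * (gb * Eb) * `|eta|).
pose C := 4 * ((CH + 4 * (Eb * Kg)) * ib) + 4 * ib.
have C0 : 0 <= C by rewrite addr_ge0// !mulr_ge0// addr_ge0// !mulr_ge0.
have eC : 0 < eps / (C + 1) by rewrite divr_gt0// ltr_pwDr.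
have fI := @filterI _ (nbhs z0) (nbhs_filter z0).
have N := fI _ _ (norm_near z0 eC) (fI _ _ (fI _ _ bx bH) (fI _ _ bg (fI _ _ HA HH))).
apply: (@filterS _ (nbhs z0) (nbhs_filter z0) _ _ _ N) => z [ze [[bxz bHz] [bgz [HAz [Hz0 Hz]]]]].
have xz t : I t -> cimg c (x z t) /\ forall xi, `|christoffel_mx c (x z t) xi| <= Kg * `|xi|.
  move=> It; apply: He; rewrite -ball_normE /ball_ /= distrC.
  by apply: le_lt_trans (bxz t It) _; rewrite ltr_pdivrMr// ltr_pMr// ltr1n.
have Hor t : I t -> H z t *m g z t *m (H z t)^T = eta.
  by move=> It; exact: etrans (gram_mul _ _ _) (HAz t It).
have etaE : eta *m eta = 1%:M by exact: minkowski_sq.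
have Hinv t : I t -> H z t *m (g z t *m (H z t)^T *m eta) = 1%:M.
  move=> It; have := Hor t It; move: (H z t) (g z t) => h k hk.
  by rewrite !mulmxA hk.
have Hu t : I t -> H z t \in unitmx by move=> It; exact: (mulmx1_unit (Hinv t It)).1.
(* Outside [0, 1] the frame is a placeholder: only values on the interval matter for the curve. *)
have /choice[v Hv] : forall t, exists f : frame S, I t ->
    fpt f = chart_inv c (x z t) /\ fcomp c f = H z t.
  move=> t; have [It|nI] := pselect (I t); last by exists (Oframe u0).
  have [cx _] := xz t It; have [dx mx] := cimg_inv cx.
  have uT := tchange_unit dx.
  have uf : H z t *m invmx (tchange c (chart_inv c (x z t))) \in unitmx.
    by rewrite unitmx_mul (Hu t It) unitmx_inv.
  by exists (@Frame _ S (chart_inv c (x z t)) _ uf) => _; split; [exact: erefl|rewrite fcompE; exact: (mulmxKV uT)].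
have dxz t : I t -> dw I (x z) t (z.1 - z0.1) /\
    (z.1 - z0.1) @[s --> within I (nbhs t)] --> (z.1 - z0.1).
  by move=> It; split; [exact: dw_line|exact: cvg_cst].
have dHz t : I t -> dw I (H z) t (H' z t) /\ H' z s @[s --> within I (nbhs t)] --> H' z t.
  by move=> It; have [h1 _ h2] := Hz t It.
(* Stated for any curve that agrees with v on the interval, because [chart_curve] is used twice: for
   v, to propagate positivity, and then for the curve u in [OplusM] that positivity makes
   possible. *)
have cc (f : R -> frame S) : (forall t, I t -> f t = v t) -> forall t, I t ->
    cimg c (x z t) /\ fpt (f t) = chart_inv c (x z t) /\ fcomp c (f t) = H z t.
  by move=> fv t It; rewrite (fv t It); have [cx _] := xz t It; have [h1 h2] := Hv t It.
have [vC _] := @chart_curve R S c I v (x z) (fun _ => z.1 - z0.1) (H z) (H' z) (@pI R)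
  (cc v (fun _ _ => erefl)) dxz dHz.
have I0 : I 0 by rewrite /= in_itv /= lexx ler01.
have I1 : I 1 by rewrite /= in_itv /= lexx ler01.
have cv t : I t -> chart_dom c (fpt (v t)).
  by move=> It; have [cx [-> _]] := cc v (fun _ _ => erefl) t It; have [] := cimg_inv cx.
have mv t : I t -> chart_map c (fpt (v t)) = x z t.
  by move=> It; have [cx [-> _]] := cc v (fun _ _ => erefl) t It; have [] := cimg_inv cx.
have v0 : v 0 = Oframe u0.
  apply: (@frame_eq _ _ c); first exact: cv.
    have [-> _] := Hv 0 I0; rewrite /x scale0r addr0 /z0 /=.
    by rewrite chart_mapK.
  by have [_ ->] := Hv 0 I0; rewrite Hz0.
have vo t : I t -> orthonormal (v t).
  move=> It; rewrite /orthonormal -(fcomp_gram (cv t It)) (mv t It).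
  by have [_ ->] := Hv t It; exact: Hor.
have vP t : I t -> positive_frame (v t).
  apply: (@positive_along _ _ I v 0 (@pI R)) => //.
  - by move/C1_frame_curveP : vC.
  - move=> a b r; rewrite /= !in_itv /= => /andP[a0 a1] /andP[b0 b1] /andP[ar rb].
    by rewrite (le_trans a0 ar) (le_trans rb b1).
  - by rewrite v0; exact: set_valP.
have /choice[u Hu'] : forall t, exists w : OplusM S, I t -> Oframe w = v t.
  move=> t; have [It|nI] := pselect (I t); last by exists u0.
  by exists (exist _ (v t) (mem_set (vP t It))).
have [uC uE] := @chart_curve R S c I (@Oframe _ S \o u) (x z) (fun _ => z.1 - z0.1) (H z) (H' z) (@pI R)
  (cc (@Oframe _ S \o u) Hu') dxz dHz.
have [L [_ Ld]] := arc_exists ltr01 uC.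
exists (u 1), (L 1 - L 0); split.
- have -> : u0 = u 0 by apply: val_inj; exact: esym (etrans (Hu' 0 I0) v0).
  exact: (arc_conn ltr01 (conj uC Ld)).
- have gnC t : 0 <= t <= 1 -> gn I (@Oframe _ S \o u) t <= C * `|z - z0|.
    move=> t01; have It : I t by rewrite /= in_itv.
    have [oE tE] := uE t It.
    have [_ hH' _] := Hz t It.
    have [_ hG] := xz t It.
    have hH : `|H z t| <= Eb.
      by rewrite -(subrK z0.2 (H z t)); apply: le_trans (ler_normD _ _) _; rewrite addrC lerD2l bHz.
    have hg : `|g z t| <= gb.
      by rewrite -(subrK (metric_in c z0.1) (g z t)); apply: le_trans (ler_normD _ _) _; rewrite addrC lerD2l bgz.
    have hi : `|invmx (H z t)| <= ib.
      rewrite (mulmx1_invmx (Hinv t It)); apply: mul4_le => //.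
      by apply: mul4_le => //; rewrite mx_norm_tr.
    have hx : `|z.1 - z0.1| <= `|z - z0| by exact: (fst_norm_le (z - z0)).
    rewrite /gn oE tE /omf mx_norm_tr.
    rewrite /C mulrDl; apply: lerD; last first.
      apply: le_trans (mul4_le hx hi) _; rewrite -mulrA [ib * _]mulrC.
      exact: lexx.
    have hs : `|H' z t + H z t *m christoffel_mx c (x z t) (z.1 - z0.1)| <=
        (CH + 4 * (Eb * Kg)) * `|z - z0|.
      apply: le_trans (ler_normD _ _) _; rewrite mulrDl; apply: lerD => //.
      have hK : `|christoffel_mx c (x z t) (z.1 - z0.1)| <= Kg * `|z - z0|.
        by apply: le_trans (hG _) _; rewrite ler_wpM2l.
      by apply: le_trans (mul4_le hH hK) _; rewrite !mulrA.
    apply: le_trans (mul4_le hs hi) _; exact: mul4_ac.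
  have gd (r : R) : 0 <= r <= 1 -> dw I (fun r => C * `|z - z0| * r) r (C * `|z - z0|).
    move=> rt; have Dr : I r by rewrite /= in_itv.
    have := dwM Dr (dw_cst _ (C * `|z - z0| : R) r) (dw_id Dr).
    by rewrite mul0r add0r mulr1.
  have Ld' (r : R) : 0 <= r <= 1 -> dw I L r (gn I (@Oframe _ S \o u) r).
    by move=> r01; apply: Ld; rewrite /= in_itv.
  have := @dw_le R L _ _ _ 0 1 ler01 Ld' gd gnC; rewrite mulr1 mulr0 subr0.
  move/le_lt_trans; apply.
  apply: (@le_lt_trans _ _ ((C + 1) * `|z - z0|)); first by rewrite ler_wpM2r// lerDl.
  by rewrite mulrC -ltr_pdivlMr// ltr_pwDr.
- by rewrite /Opi (Hu' 1 I1); exact: cv.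
- rewrite /Opi (Hu' 1 I1); have [-> _] := Hv 1 I1.
  by rewrite /x scale1r addrC subrK.
- move=> Ez; rewrite (Hu' 1 I1); have [_ ->] := Hv 1 I1.
  have F1 : F z 1 = z.2 by rewrite /F scale1r addrC subrK.
  have x1 : x z 1 = z.1 by rewrite /x scale1r addrC subrK.
  by rewrite /H A1 ?mul1mx// /G /g F1 x1.
Qed.

End UpperBound.

(** * Parallel frames along an incomplete curve *)

Section ParallelFrames.
Context {R : realType} (S : spacetime R).
Notation eta := (Defs.minkowski R).

(** The equation of parallel transport in a chart. *)
Lemma omf_eq0 (E G E' : 'M[R]_4) : E \in unitmx -> omf E G E' = 0 <-> E' = - (E *m G).
Proof.
move=> uE; split=> [|->]; last by rewrite /omf addNr mul0mx trmx0.
rewrite /omf => /(congr1 trmx); rewrite trmxK trmx0 => H.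
by apply/eqP; rewrite -addr_eq0 -[_ + _](mulmxKV uE) H mul0mx.
Qed.

Lemma gram_compat (E g G : 'M[R]_4) : g^T = g ->
  (- (E *m G) *m g + E *m (G *m g + (G *m g)^T)) *m E^T + E *m g *m (- (E *m G))^T = 0.
Proof.
move=> gs; rewrite linearN /= !trmx_mul gs mulmxN mulNmx mulmxDr !mulmxA addKr.
by rewrite subrr.
Qed.

(** Parallel transport preserves inner products: by the transport equation and metric compatibility
    the three Leibniz terms cancel. *)
Lemma parallel_gram (D : set R) (e : R -> frame S) t : perfect_in D -> D t -> C1f_at D e t ->
  om D e t = 0 ->
  dw D (fun s => fmat (e s) *m metric (fpt (e s)) *m (fmat (e s))^T) t 0.
Proof.
move=> pD Dt eC o0; pose c := chart_at (fpt (e t)).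
have ct : chart_dom c (fpt (e t)) by exact: chart_atP.
have [oE _] := om_th_chart pD Dt eC ct.
rewrite o0 in oE; have /(omf_eq0 _ _ (fcomp_unit ct)) e'E := esym oE.
have [_ /(_ c ct)[/C1_within_at_dw xd /C1_within_at_dw ed]] := eC.
rewrite -/(xdot D e c t) in xd; rewrite -/(edot D e c t) in ed.
have cx := cimg_map ct.
have gd : dw D (metric_in c \o (chart_map c \o (@fpt _ S \o e))) t
    ('d (metric_in c) (chart_map c (fpt (e t))) (xdot D e c t)).
  apply: (@dw_diff _ _ _ _ (chart_map c \o (@fpt _ S \o e)) (metric_in c)) => //.
  exact: metric_in_diff.
have P := dw_mulmx Dt (dw_mulmx Dt ed gd) (dw_trmx ed).
apply: (dw_near Dt _ (_ : dw D _ t 0)); last first.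
  have := P; rewrite (christoffel_metric _ cx) e'E.
  rewrite (gram_compat (fcomp c (e t)) _ (metric_in_sym c (chart_map c (fpt (e t))))).
  exact.
by apply: filterS (near_dom eC ct) => s cs; exact: (fcomp_gram cs).
Qed.

(** Start from an orthonormal frame and change signs: [d3] on the last vector corrects the time
    orientation, then [d0] on the first vector corrects the orientation. The determinant in [w]
    already contains [d3]. *)
Lemma positive_frame_exists (p : S) : exists2 f : frame S, fpt f = p & positive_frame f.
Proof.
have [P uP PE] := metric_lorentz p.
pose f0 := @Frame _ S p P uP.
have o0 : orthonormal f0 by exact: PE.
have tau0 := timelike_neq0 o0; rewrite /= in tau0.
set tau := (row ord_max P *m metric p *m (time_field p)^T) 0 0 in tau0.
have dP : \det P != 0 by have := uP; rewrite unitmxE unitfE.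
pose d3 : R := if tau < 0 then 1 else -1.
have d3s : d3 * d3 = 1 by rewrite /d3; case: ifP => _; rewrite ?mulrNN mulr1.
have d3t : d3 * tau < 0.
  rewrite /d3; case: ifPn => [h|]; first by rewrite mul1r.
  by rewrite -leNgt mulN1r oppr_lt0 lt_def tau0.
pose w := orientation p * (d3 * \det P).
have d30 : d3 != 0 by apply/eqP => h; move: d3s; rewrite h mul0r => /eqP; rewrite eq_sym oner_eq0.
have w0 : w != 0 by rewrite !mulf_neq0// orientation_neq0.
pose d0 : R := if 0 < w then 1 else -1.
have d0s : d0 * d0 = 1 by rewrite /d0; case: ifP => _; rewrite ?mulrNN mulr1.
have d0w : 0 < d0 * w.
  rewrite /d0; case: ifPn => [h|]; first by rewrite mul1r.
  by rewrite -leNgt mulN1r oppr_gt0 lt_neqAle w0.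
pose dg : 'rV[R]_4 := \row_j if j == ord0 then d0 else if j == ord_max then d3 else 1.
have dgs j : dg 0 j * dg 0 j = 1.
  by rewrite mxE; case: ifP => // _; case: ifP => // _; rewrite mulr1.
have ddet : \det (diag_mx dg) = d0 * d3.
  by rewrite det_diag !big_ord_recl big_ord0 !mxE /= !mulr1 !mul1r.
have uQ : diag_mx dg *m P \in unitmx.
  rewrite unitmx_mul uP andbT unitmxE ddet unitfE mulf_neq0//.
  by apply/eqP => h; move: d0s; rewrite h mul0r => /eqP; rewrite eq_sym oner_eq0.
exists (@Frame _ S p _ uQ); first by [].
split => /=.
- rewrite gram_mul PE tr_diag_mx; apply/matrixP => i j.
  rewrite mul_mx_diag mxE mul_diag_mx mxE.
  rewrite minkowskiE; case: (eqVneq i j) => [->|_]; last by rewrite mulr0 mul0r.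
  by rewrite mulrAC dgs mul1r.
- by rewrite det_mulmx ddet mulrA mulrA -/w [_ * d0]mulrC -!mulrA.
- have -> : row ord_max (diag_mx dg *m P) = d3 *: row ord_max P.
    by rewrite row_mul row_diag_mx mxE /= -scalemxAl -rowE.
  by rewrite -!scalemxAl mxE.
Qed.

End ParallelFrames.

(** * The positive lift and the generalised affine parameter *)

Section Lift.
Context {R : realType} (S : spacetime R) (a : \bar R) (a_gt0 : (0 < a)%E) (gamma : R -> S) (e : R -> frame S).
Notation D := (ico 0 a).
Hypothesis pe : parallel_frame D gamma e.
Notation Of := (@Oframe R S).

Let pD : perfect_in D. Proof. exact: perfect_ico. Qed.
Let D0 : D 0. Proof. by split. Qed.
Let eC t : D t -> C1f_at D e t.
Proof. by case: pe => _ /C1_frame_curveP + _; apply. Qed.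
Let eC1 : C1_frame_curve D e. Proof. by case: pe. Qed.
Let eg t : D t -> fpt (e t) = gamma t. Proof. by case: pe => + _ _; apply. Qed.
Let eo t : D t -> om D e t = 0. Proof. by case: pe => _ _; apply. Qed.

Lemma gram_constant t : D t ->
  fmat (e t) *m metric (fpt (e t)) *m (fmat (e t))^T =
  fmat (e 0) *m metric (fpt (e 0)) *m (fmat (e 0))^T.
Proof.
move=> Dt; have t0 : 0 <= t by case: Dt.
have sub : `[0, t]%classic `<=` D.
  by move=> r; rewrite /= in_itv /=; exact: ico_interval.
apply/matrixP => i j.
apply: (@dw_cst_eq R (fun s => (fmat (e s) *m metric (fpt (e s)) *m (fmat (e s))^T) i j) 0 t t0).
move=> r rt; have Dr : D r by apply: sub; rewrite /= in_itv.
have H := dw_subset sub (parallel_gram pD Dr (eC Dr) (eo Dr)).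
have z : (0 : 'M[R]_4) i j = 0 by rewrite mxE.
rewrite -[X in dw _ _ _ X]z; exact: (@dw_entry R _ _ _ _ _ _ i j H).
Qed.

(* A constant change of frame turns e into a positive frame, which stays parallel. *)
Lemma positive_lift : exists (u : R -> OplusM S) (K : R),
  [/\ 0 < K, forall t, D t -> Opi (u t) = gamma t, C1_frame_curve D (Of \o u) &
      forall t, D t -> gn D (Of \o u) t <= K * `|th D e t|].
Proof.
have [f0 f0p f0P] := positive_frame_exists (fpt (e 0)).
(* Left multiplication recombines the vectors of a frame, independently of charts; Q takes the frame
   [e 0] to the positive frame [f0]. *)
pose Q := fmat f0 *m invmx (fmat (e 0)).
have uQ : Q \in unitmx by rewrite unitmx_mul (fmat_unit f0) unitmx_inv fmat_unit.
have uQe t : Q *m fmat (e t) \in unitmx by rewrite unitmx_mul uQ fmat_unit.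
pose v t := @Frame _ S (fpt (e t)) _ (uQe t).
have vc c t : fcomp c (v t) = Q *m fcomp c (e t) by rewrite !fcompE /= mulmxA.
have Qcts (T : Type) (F : set_system T) (FF : Filter F) (g : T -> 'M[R]_4) (l : 'M[R]_4) :
    g x @[x --> F] --> l -> Q *m g x @[x --> F] --> Q *m l.
  by move=> gl; apply: cvg_mulmx => //; exact: cvg_cst.
have Qdw (g : R -> 'M[R]_4) t l : D t -> dw D g t l -> dw D (fun s => Q *m g s) t (Q *m l).
  by move=> Dt gl; have := dw_mulmx Dt (dw_cst D Q t) gl; rewrite mul0mx add0r.
have dv c t : D t -> chart_dom c (fpt (e t)) ->
    dw D (fcomp c \o v) t (Q *m edot D e c t).
  move=> Dt ct; have [_ /(_ c ct)[_ /C1_within_at_dw ed]] := eC Dt.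
  apply: (dw_near Dt _ (Qdw _ _ _ Dt ed)).
  by near=> s; exact: esym (vc c s).
have vC t : D t -> C1f_at D v t.
  move=> Dt; have [ec eC'] := eC Dt; split; first exact: ec.
  move=> c ct; have [xC [_ ed]] := eC' c ct; split; first exact: xC.
  apply: (@C1_within_atI _ _ _ _ (fun s => Q *m edot D e c s) t pD Dt); last exact: (Qcts _ _ _ _ _ ed).
  have N1 : \forall s \near within D (nbhs t), D s by exact: withinT.
  by apply: filterS2 N1 (near_dom (eC Dt) ct) => s Ds cs; exact: dv.
(* The Gram matrix of e is constant, so that of v is the one at 0, where v is [f0]. *)
have vo t : D t -> orthonormal (v t).
  move=> Dt; have [fo _ _] := f0P.
  rewrite /orthonormal /= gram_mul (gram_constant Dt) -gram_mul /Q mulmxKV ?fmat_unit//.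
  by rewrite -f0p.
have v0 : v 0 = f0.
  have c0 := chart_atP (fpt (e 0)); apply: (@frame_eq _ _ (chart_at (fpt (e 0))) (v 0) f0 c0 (esym f0p)).
  rewrite vc !fcompE f0p mulmxA; apply: (congr1 (mulmx^~ _)).
  exact: (mulmxKV (fmat_unit (e 0)) (fmat f0)).
have vP t : D t -> positive_frame (v t).
  apply: (@positive_along _ _ D v 0 pD vC _ vo D0); last by rewrite v0.
  exact: ico_interval.
have [w0 _] : exists w0 : OplusM S, True.
  by exists (exist _ (v 0) (mem_set (vP 0 D0))).
have /choice[u Hu] : forall t, exists w : OplusM S, D t -> Of w = v t.
  move=> t; have [Dt|nD] := pselect (D t); last by exists w0.
  by exists (exist _ (v t) (mem_set (vP t Dt))).
have uv (t : R) : \forall s \near t, \forall r \near within D (nbhs s), v r = (Of \o u) r.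
  by near=> s; rewrite near_withinE; near=> r => Dr; exact: esym (Hu r Dr).
exists u, (4 * `|invmx Q| + 1); split.
- by rewrite ltr_pwDr// mulr_ge0.
- by move=> t Dt; rewrite /Opi (Hu t Dt) /= eg.
- by apply/C1_frame_curveP => t Dt; exact: (C1f_at_near pD Dt (uv t) (vC t Dt)).
move=> t Dt; rewrite -(gn_near Dt (nbhs_singleton (uv t))).
pose c := chart_at (fpt (e t)); have ct : chart_dom c (fpt (e t)) by exact: chart_atP.
have [oE tE] := om_th_chart pD Dt (eC Dt) ct.
have [oE' tE'] := om_th_chart pD Dt (vC t Dt) (ct : chart_dom c (fpt (v t))).
have ev : edot D v c t = Q *m edot D e c t by exact: (deriv_withinE (pD Dt) (dv c t Dt ct)).
have xv : xdot D v c t = xdot D e c t by [].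
have uE := fcomp_unit ct.
rewrite (eo Dt) in oE; have /(omf_eq0 _ _ uE) e'E := esym oE.
(* The transport equation is linear in the frame, so the constant factor Q on the left preserves
   it. *)
have o0 : om D v t = 0.
  rewrite oE'; apply/omf_eq0; first exact: fcomp_unit (ct : chart_dom c (fpt (v t))).
  by rewrite ev e'E (vc c t) xv mulmxN mulmxA.
have tv : th D v t = th D e t *m invmx Q.
  by rewrite tE' xv (vc c t) (invmx_mul uQ uE) mulmxA -tE.
rewrite /gn o0 normr0 add0r tv; apply: le_trans (mx_norm_mul _ _) _.
have aux (k x y : R) : 0 <= x -> k * (x * y) <= (k * y + 1) * x.
  by move=> x0; rewrite mulrDl mul1r [x * y]mulrC mulrA lerDl.
exact: (aux _ _ _ (normr_ge0 _)).
Unshelve. all: by end_near. Qed.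

(** The integrand of the generalised affine parameter, expressed through the canonical form of the
    curve of frames. *)
Definition espeed t : R := Num.sqrt (\sum_(i < 4) (th D e t) 0 i ^+ 2).

Lemma th_le_espeed t : `|th D e t| <= espeed t.
Proof.
apply: mx_norm_le => [|i j]; first exact: sqrtr_ge0.
rewrite ord1 -sqrtr_sqr ler_wsqrtr// (bigD1 j)//= lerDl.
by apply: sumr_ge0 => k _; exact: sqr_ge0.
Qed.

Lemma espeed_cts : {within D, continuous espeed}.
Proof.
apply/subspace_continuousP => t Dt; have [_ tc] := om_th_cts pD Dt eC1.
have sc : \sum_(i < 4) (th D e s) 0 i ^+ 2 @[s --> within D (nbhs t)] --> \sum_(i < 4) (th D e t) 0 i ^+ 2.
  apply: cvg_sumr => i _; rewrite expr2; under eq_cvg do rewrite expr2.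
  by apply: cvgM; exact: cvg_entry.
exact: (cvg_comp _ Num.sqrt sc (@sqrt_continuous R _)).
Qed.

Lemma gen_affine_paramE t : D t ->
  gen_affine_param a gamma e t = (\int[lebesgue_measure]_(s in `[0%R, t]) (espeed s)%:E)%E.
Proof.
move=> Dt; apply: eq_integral => s; rewrite inE /= in_itv /= => st.
have Ds : D s by exact: ico_interval st.
suff -> : frame_components (e s) (velocity D gamma s) = th D e s by [].
have V : velocity D (@fpt _ S \o e) s = velocity D gamma s.
  rewrite /velocity /= (eg Ds); apply: (deriv_within_near Ds).
  by rewrite near_withinE; near=> r => Dr; rewrite /= (eg Dr).
exact: (congr1 (frame_components (e s)) (esym V)).
Unshelve. all: by end_near. Qed.

Lemma affine_primitive t : D t -> 0 < t -> exists L : R -> R,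
  (forall r, 0 <= r <= t -> is_derive r (1 : R) L (espeed r)) /\
  forall r, 0 <= r <= t -> gen_affine_param a gamma e r = (L r - L 0)%:E.
Proof.
move=> Dt t0.
have vc : {within `[0, t], continuous espeed}.
  apply: continuous_subspaceW espeed_cts => r; rewrite /= in_itv /=; exact: ico_interval.
have [L [Ld LE]] := primitive t0 vc; exists L; split => // r /[dup] r0t /andP[r0 rt].
rewrite gen_affine_paramE; last exact: ico_interval r0t.
move: r0; rewrite le_eqVlt => /predU1P[<-|r0]; last by rewrite LE.
by rewrite set_itv1 integral_set1 subrr.
Qed.

Definition Lam t : R := fine (gen_affine_param a gamma e t).

Lemma gen_affine_fin t : D t -> gen_affine_param a gamma e t = (Lam t)%:E.
Proof.
move=> Dt; have := Dt.1; rewrite le_eqVlt => /predU1P[<-|t0]; last first.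
  have [L [_ LE]] := affine_primitive Dt t0.
  by rewrite /Lam LE ?lexx ?(ltW t0).
by rewrite /Lam gen_affine_paramE// set_itv1 integral_set1.
Qed.

Lemma Lam_sub s t : D s -> D t -> s < t -> exists2 L : R -> R,
  forall r, s <= r <= t -> is_derive r (1 : R) L (espeed r) & Lam t - Lam s = L t - L s.
Proof.
move=> Ds Dt st; have s0 : 0 <= s by case: Ds.
have t0 : 0 < t by exact: le_lt_trans st.
have [L [Ld LE]] := affine_primitive Dt t0; exists L.
  by move=> r /andP[sr rt]; apply: Ld; rewrite rt (le_trans s0).
rewrite /Lam !LE ?lexx ?(ltW t0) ?s0 ?(ltW st)//= .
by rewrite opprB addrA subrK.
Qed.

(** The sup norm of [th] is at most its Euclidean norm [espeed], so the two primitives compare. *)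
Lemma affine_conn (u : R -> OplusM S) (K : R) : 0 < K -> C1_frame_curve D (Of \o u) ->
  (forall t, D t -> gn D (Of \o u) t <= K * `|th D e t|) ->
  forall s t, D s -> D t -> s < t -> exists2 l, conn (u s) (u t) l & l <= K * (Lam t - Lam s).
Proof.
move=> K0 uC ug s t Ds Dt st.
have sub r : `[s, t]%classic r -> D r by rewrite /= in_itv /=; exact: ico_interval.
have pst := perfect_segment st.
have idd r : `[s, t]%classic r -> dw `[s, t]%classic id r 1 by exact: dw_id.
have c1 r : `[s, t]%classic r -> cst (1 : R) x @[x --> within `[s, t]%classic (nbhs r)] --> (1 : R).
  by move=> _; exact: cvg_cst.
have [uC' _] := @C1_frame_reparam R S D `[s, t]%classic id (cst 1) pD pst sub idd c1 _ uC.
have [L LA] := arc_exists st (uC' : C1_frame_curve _ (Of \o u)).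
exists (L t - L s); first exact: arc_conn.
have [M Md ->] := Lam_sub Ds Dt st; rewrite mulrBr.
apply: (@dw_le _ L (gn `[s, t]%classic (Of \o u)) (fun r => K * M r) (fun r => K * espeed r) s t (ltW st)).
- by move=> r rst; apply: LA.2; rewrite /= in_itv.
- move=> r rst; have Dr : `[s, t]%classic r by rewrite /= in_itv.
  have := dwM Dr (dw_cst _ (K : R) r) (is_derive_dw `[s, t]%classic (Md r rst)).
  by rewrite mul0r add0r.
move=> r rst; have Ir : `[s, t]%classic r by rewrite /= in_itv.
have Dr := sub r Ir.
have E := @gn_reparam R S D `[s, t]%classic id (cst 1) pD pst sub idd c1 _ uC r Ir.
rewrite [gn _ _ r]E /= normr1 mul1r; apply: le_trans (ug r Dr) _.
by rewrite ler_wpM2l ?(ltW K0)// th_le_espeed.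
Qed.

(** Treats a finite and an infinite end of the parameter interval alike. *)
Lemma nbhs_ereal_ico (b : \bar R) (A : set (\bar R)) : (0 < b)%E -> nbhs b A ->
  exists2 T, ico 0 b T & forall t, ico 0 b t -> T <= t -> A t%:E.
Proof.
case: b => [r||] //.
- rewrite lte_fin => r0 /= [d /= d0 dA]; exists (Num.max 0 (r - d / 2)).
    split; first by rewrite le_max lexx.
    by rewrite lte_fin gt_max r0 gtrBl divr_gt0.
  move=> t [t0]; rewrite lte_fin ge_max => tr /andP[_ Tt]; apply: (dA t).
  by rewrite /ball_ /= ger0_norm ?subr_ge0 ?(ltW tr)//; lra.
- move=> _ /= [M [Mr MA]]; exists (Num.max 0 (M + 1)).
    by split; [rewrite le_max lexx|exact: ltry].
  by move=> t [t0 _]; rewrite ge_max => /andP[_ Mt]; apply: MA; rewrite lte_fin; lra.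
Qed.

Lemma Lam_cvg l : gen_affine_param a gamma e (fine x)
    @[x --> within [set x : \bar R | (0 <= x < a)%E] (nbhs a)] --> l%:E ->
  forall eps, 0 < eps -> exists2 T, D T & forall t, D t -> T <= t -> `|Lam t - l| < eps.
Proof.
move=> H eps eps0.
have N : nbhs l%:E [set y : \bar R | `|fine y - l| < eps].
  exists eps => //= y; rewrite /ball_ /= distrC.
  by [].
have := H _ N; rewrite /within /= => /(nbhs_ereal_ico a_gt0)[T DT HT].
exists T => // t Dt Tt; apply: (HT t Dt Tt).
by rewrite lee_fin; case: Dt => -> ->.
Qed.

End Lift.

(** * Translation of the parameter *)

Section Shift.
Context {R : realType} (S : spacetime R) (a : \bar R) (gamma : R -> S) (T : R).
Hypothesis DT : ico 0 a T.
Notation D := (ico 0 a).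
Notation a' := (a - T%:E)%E.
Notation D' := (ico 0 a').
Let psi (r : R) : R := r + T.

Let a0 : (0 < a)%E.
Proof. by case: DT => T0; apply: le_lt_trans; rewrite lee_fin. Qed.
Let pD : perfect_in D. Proof. exact: perfect_ico. Qed.
Let pD' : perfect_in D'. Proof. exact: perfect_ico. Qed.

Lemma ico_shift r : 0 <= r -> D (r + T) -> D' r.
Proof. by move=> r0 [_ rT]; split => //; rewrite lteBrDr. Qed.

Lemma ico_unshift r : D' r -> D (r + T).
Proof.
by move=> [r0]; rewrite lteBrDr// => rT; split => //; rewrite addr_ge0//; case: DT.
Qed.

Lemma shift_gt0 : (0 < a')%E.
Proof. by rewrite lteBrDr// add0e; case: DT. Qed.

Let psid s : D' s -> dw D' psi s (cst 1 s).
Proof.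
by move=> Ds; rewrite -[cst 1 s]addr0; apply: dwD; [exact: dw_id|exact: dw_cst].
Qed.
Let psic t : D' t -> cst (1 : R) s @[s --> within D' (nbhs t)] --> cst (1 : R) t.
Proof. by move=> _; exact: cvg_cst. Qed.

Lemma C1_curve_shift : C1_curve D gamma -> C1_curve D' (gamma \o psi).
Proof. by move=> gC; have [] := C1_curve_reparam pD pD' ico_unshift psid psic gC. Qed.

Section Frame.
Variable e : R -> frame S.
Hypothesis pe : parallel_frame D gamma e.

Let e_th t : D' t -> om D' (e \o psi) t = om D e (t + T) /\ th D' (e \o psi) t = th D e (t + T).
Proof.
case: pe => _ eC _ Dt; have [_ /(_ t Dt)[oE tE]] := C1_frame_reparam pD pD' ico_unshift psid psic eC.
split; [exact: (etrans oE (scale1r _))|exact: (etrans tE (scale1r _))].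
Qed.

Lemma parallel_frame_shift : parallel_frame D' (gamma \o psi) (e \o psi).
Proof.
have [ef eC eo] := pe; split.
- move=> t Dt; exact: (ef _ (ico_unshift Dt)).
- by have [] := C1_frame_reparam pD pD' ico_unshift psid psic eC.
- move=> t Dt; exact: (etrans (e_th Dt).1 (eo _ (ico_unshift Dt))).
Qed.

(** A primitive of the speed of the translated curve and the translate of a primitive of the
    original speed have the same derivative, so their difference is constant. *)
Lemma Lam_shift t : D' t -> Lam a' (gamma \o psi) (e \o psi) t = Lam a gamma e (t + T) - Lam a gamma e T.
Proof.
move=> Dt; have D0 : D' 0 by split => //; exact: shift_gt0.
have L0 : Lam a' (gamma \o psi) (e \o psi) 0 = 0.
  rewrite /Lam (gen_affine_paramE shift_gt0 parallel_frame_shift D0).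
  by rewrite set_itv1 integral_set1.
have := Dt.1; rewrite le_eqVlt => /predU1P[<-|t0]; first by rewrite L0 add0r subrr.
have tT : T < t + T by rewrite ltrDr.
have [M Md ME] := Lam_sub a0 pe DT (ico_unshift Dt) tT.
have [N Nd NE] := Lam_sub shift_gt0 parallel_frame_shift D0 Dt t0.
rewrite L0 subr0 in NE; rewrite NE ME.
have swap (x y z w : R) : x - y = z - w -> x - z = y - w.
  by move/eqP; rewrite subr_eq => /eqP ->; ring.
apply: swap; rewrite -[in RHS](add0r T).
apply: (@dw_cst_eq R (fun s => N s - M (s + T)) 0 t (ltW t0)) => r r0t.
have Ir : `[0, t]%classic r by rewrite /= in_itv.
have Dr : D' r by exact: (ico_interval D0 Dt r0t).
have Md' : dw `[T, t + T]%classic M (psi r) (espeed a e (psi r)).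
  by apply: is_derive_dw; apply: Md; rewrite /psi lerDr lerD2r.
have sub s : `[0, t]%classic s -> `[T, t + T]%classic (psi s).
  by rewrite /= !in_itv /= /psi lerDr lerD2r.
have pd : dw `[0, t]%classic psi r 1.
  by rewrite -[1]addr0; apply: dwD; [exact: dw_id|exact: dw_cst].
have Mc := dw_comp Ir sub pd Md'.
have := dwB (is_derive_dw `[0, t]%classic (Nd r r0t)) Mc.
have sE : espeed a' (e \o psi) r = espeed a e (psi r).
  exact: (congr1 (fun v : 'rV[R]_4 => Num.sqrt (\sum_(i < 4) v 0 i ^+ 2)) (e_th Dr).2).
have -> : espeed a' (e \o psi) r - 1 *: espeed a e (psi r) = 0.
  by move: (espeed a' _ r) (espeed a e (psi r)) sE => x y ->; rewrite scale1r subrr.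
exact: id.
Qed.

End Frame.

Lemma near_ico_ereal (b : \bar R) (s : R) : ico 0 b s ->
  \forall x \near within [set x : \bar R | (0 <= x < b)%E] (nbhs b),
    [/\ x = (fine x)%:E, ico 0 b (fine x) & s <= fine x].
Proof.
move=> [s0 sb]; rewrite near_withinE.
have : nbhs b [set x | (s%:E < x)%E].
  by apply: open_nbhs_nbhs; split => //; exact: open_ereal_gt_ereal.
apply: filterS => -[r| |] /=; last by rewrite ltNge leNye.
- by rewrite lte_fin lee_fin => sr /andP[r0 rb]; split => //; exact: ltW.
- by move=> _ /andP[_]; rewrite ltNge leey.
Qed.

Lemma finite_gen_affine_length_shift : finite_gen_affine_length a gamma ->
  finite_gen_affine_length a' (gamma \o psi).
Proof.
move=> [e pe [l el]]; exists (e \o psi); first exact: parallel_frame_shift.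
exists (l - Lam a gamma e T) => A [eps /= eps0 epsA].
have [T1 DT1 HT1] := Lam_cvg a0 el eps0.
(* Beyond T1 the parameter is close to its limit; being beyond T as well makes the translated time
   nonnegative. *)
pose T2 := Num.max T1 T.
have DT2 : D T2 by rewrite /T2; case: leP.
have DT2' : D' (T2 - T).
  by apply: ico_shift; [rewrite subr_ge0 le_max lexx orbT|rewrite subrK].
apply: filterS (near_ico_ereal DT2') => x [xE Dx Tx] /=.
rewrite (gen_affine_fin shift_gt0 (parallel_frame_shift pe) Dx) (Lam_shift pe Dx).
apply: epsA; rewrite /ball_ /= opprB addrA subrK distrC; apply: HT1; first exact: ico_unshift.
by rewrite -lerBlDr; apply: le_trans Tx; rewrite lerB// le_max lexx.
Qed.

Lemma endpoint_shift p : endpoint a' (gamma \o psi) p -> endpoint a gamma p.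
Proof.
move=> H N /H[t Dt tN]; exists (t + T); first exact: ico_unshift.
move=> s Ds ts; have := tN (s - T); rewrite /= /psi subrK; apply; last by rewrite ltrBrDr.
apply: ico_shift; rewrite ?subrK//; rewrite subr_ge0; apply: le_trans (ltW ts).
by rewrite lerDr; case: Dt.
Qed.

Lemma singular_region_tail (V : set S) : C1_curve D gamma -> b_incomplete a gamma ->
  open V -> connected V -> gamma @` ico T a `<=` V -> singular_region V.
Proof.
move=> gC [gf gn] oV cV gV; split => //; exists a', (gamma \o psi); split.
- exact: shift_gt0.
- exact: C1_curve_shift.
- split; first exact: finite_gen_affine_length_shift.
  by move=> [p /endpoint_shift pE]; apply: gn; exists p.
move=> _ [t Dt <-]; apply: gV; exists (t + T) => //.
by have [] := ico_unshift Dt; split => //; rewrite lerDr; case: Dt.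
Qed.

End Shift.

(** * Tubes *)

Section Tube.
Context {R : realType} (S : spacetime R).
Notation Of := (@Oframe R S).
Notation Z := ('rV[R]_4 * 'M[R]_4)%type.
Implicit Types (c : chart S) (W : set (OplusM S)).

(** Openness in the frame bundle is tested in every chart c', while the set is given in c; the
    coordinate change [Phi] between the two is continuous. *)
Lemma frame_open_coord c (O : set Z) : open O ->
  open [set f : frame S | chart_dom c (fpt f) /\ O (frame_coord c f)].
Proof.
move=> oO; suff H : frame_open [set f : frame S | chart_dom c (fpt f) /\ O (frame_coord c f)] by exact: H.
move=> c' f [cf Of'] c'f.
pose Phi (z : Z) : Z := (trans c' c z.1, z.2 *m Jac c' c z.1).
pose z0 := frame_coord c' f.
have tz : tdom c' c z0.1 by exact: tdom_map.
have PhiE g : chart_dom c (fpt g) -> chart_dom c' (fpt g) -> Phi (frame_coord c' g) = frame_coord c g.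
  move=> cg c'g; exact: (congr2 pair (trans_map c c'g) (esym (fcomp_trans c'g cg))).
have c1 : z.1 @[z --> z0] --> z0.1 by exact: cvg_fst.
have c2 : z.2 @[z --> z0] --> z0.2 by exact: cvg_snd.
have T1 : trans c' c z.1 @[z --> z0] --> trans c' c z0.1.
  exact: (cvg_comp _ (trans c' c) c1 (differentiable_continuous (trans_diff tz))).
have J1 : Jac c' c z.1 @[z --> z0] --> Jac c' c z0.1.
  exact: (cvg_comp _ (Jac c' c) c1 (differentiable_continuous (Jac_diff tz).1)).
have P1 : Phi z @[z --> z0] --> Phi z0 by exact: (cvg_pair T1 (cvg_mulmx c2 J1)).
have NO : nbhs (Phi z0) O.
  apply: open_nbhs_nbhs; split; first exact: oO.
  exact: (eq_ind_r O Of' (PhiE f cf c'f)).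
have N1 : \forall z \near z0, O (Phi z) by exact: P1 NO.
have N2 : \forall z \near z0, tdom c' c z.1 by exact: c1 (tdom_nbhs tz).
apply: (@filterS2 _ (nbhs z0) (nbhs_filter z0) _ _ _ _ N1 N2) => z Oz tdz g c'g gz.
have cg : chart_dom c (fpt g).
  by move: tdz => /tdomP[_]; rewrite -gz /= chart_mapK.
split; first exact: cg.
exact: (eq_ind _ O Oz _ (etrans (esym (congr1 Phi gz)) (PhiE g cg c'g))).
Qed.

Lemma nbhs_open (T : topologicalType) (x : T) (P : set T) : nbhs x P ->
  exists A : set T, [/\ open A, A x & A `<=` P].
Proof. by rewrite nbhsE => -[A [oA Ax] AP]; exists A. Qed.

(** Openness measured by lengths of curves. For tubes it is the triangle inequality, and
    [conn_upper] turns it into openness of the set and of its projection. *)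
Definition conn_open W : Prop :=
  forall w, W w -> exists2 eps, 0 < eps & forall y l, conn w y l -> l < eps -> W y.

(** The components of y are orthonormal, so the short curve given by [conn_upper] ends over the same
    point with the same components as y, that is, at y. *)
Lemma conn_near c (w : OplusM S) (eps : R) : chart_dom c (Opi w) -> 0 < eps ->
  \forall z \near frame_coord c (Of w), forall y : OplusM S,
    chart_dom c (Opi y) -> frame_coord c (Of y) = z -> exists2 l, conn w y l & l < eps.
Proof.
move=> cw eps0.
apply: (@filterS _ (nbhs (frame_coord c (Of w))) (nbhs_filter _) _ _ _ (conn_upper cw eps0)).
move=> z [v [l [wv le cv vE fE]]] y cy yz; exists l; last exact: le.
have vy : Opi v = Opi y.
  exact: (etrans vE (etrans (congr1 (fun z : Z => chart_inv c z.1) (esym yz)) (chart_mapK cy))).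
have [yo _ _] := set_valP y.
have zo : z.2 *m metric_in c z.1 *m z.2^T = Defs.minkowski R.
  by move: (fcomp_gram cy); rewrite yo => <-; case: z / yz {vE fE}.
have fvy : fcomp c (Of v) = fcomp c (Of y).
  exact: (etrans (fE zo) (congr1 snd (esym yz))).
suff <- : v = y by exact: wv.
apply: val_inj; exact: (frame_eq cv vy fvy).
Qed.

Lemma Oframe_cts (w : OplusM S) (B : set (frame S)) : nbhs (Of w) B -> \forall y \near w, B (Of y).
Proof. by move=> NB; have sv : continuous (set_val : OplusM S -> frame S) by [exact: initial_continuous]; exact: (sv w B NB). Qed.

Lemma conn_open_open W : conn_open W -> open W.
Proof.
move=> oW; rewrite openE => w /oW[eps eps0 We]; rewrite /interior.
pose c := chart_at (Opi w).
have cw : chart_dom c (Opi w) by exact: chart_atP.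
have [A [oA Aw AP]] := @nbhs_open Z (frame_coord c (Of w)) _ (conn_near cw eps0).
have NB := open_nbhs_nbhs (conj (frame_open_coord (c := c) oA) (conj cw Aw)).
apply: (@filterS _ (nbhs w) _ _ _ _ (Oframe_cts NB)) => y [cy Ay].
by have [l wy le] := AP _ Ay y cy erefl; exact: We wy le.
Qed.

(** The base point p moves while the frame components of w are held fixed. These need not be
    orthonormal at p, but [conn_upper] still produces a frame over p at small distance from w. *)
Lemma conn_open_proj W : conn_open W -> open (@Opi R S @` W).
Proof.
move=> oW; rewrite openE => _ [w /oW[eps eps0 We] <-]; rewrite /interior.
pose c := chart_at (Opi w).
have cw : chart_dom c (Opi w) by exact: chart_atP.
have H := conn_upper cw eps0.
have pc : (chart_map c p, fcomp c (Of w)) @[p --> Opi w] --> frame_coord c (Of w).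
  have c1 : chart_map c p @[p --> Opi w] --> chart_map c (Opi w) by exact: (chart_map_cts cw).
  have c2 : cst (fcomp c (Of w)) p @[p --> Opi w] --> fcomp c (Of w) by exact: cvg_cst.
  exact: (cvg_pair c1 c2).
have N := pc _ H.
apply: filterS2 (chart_dom_nbhs cw) N => p cp [v [l [wv le _ vE _]]].
exists v; first exact: We wv le.
exact: (etrans vE (chart_mapK cp)).
Qed.

(** A curve is defined on a nondegenerate interval; a short curve to some w, followed by its
    reverse, serves as a loop. *)
Lemma conn_refl (x : OplusM S) (eps : R) : 0 < eps -> exists2 l, conn x x l & l < eps.
Proof.
move=> eps0; have e2 : 0 < eps / 2 by rewrite divr_gt0.
have := nbhs_singleton (conn_upper (chart_atP (Opi x)) e2).
move=> [w [l [xw le _ _ _]]]; exists (l + l); first exact: (conn_trans xw (conn_sym xw)).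
by lra.
Qed.

Lemma arc_prefix (p q : R) (v : R -> OplusM S) L r : p < q -> arc `[p, q]%classic v L -> p < r <= q ->
  exists2 l, conn (v p) (v r) l & l <= L q - L p.
Proof.
move=> pq A /andP[pr rq]; exists (L r - L p).
  apply: (arc_conn pr); apply: arc_sub A; try exact: perfect_segment.
  by move=> x /=; rewrite !in_itv /= => /andP[-> /le_trans ->].
rewrite lerD2r; move: rq; rewrite le_eqVlt => /predU1P[->//|rq].
rewrite -subr_ge0; apply: (@conn_ge0 _ S (v r) (v q)); apply: (arc_conn rq).
apply: arc_sub A; try exact: perfect_segment.
by move=> x /=; rewrite !in_itv /= => /andP[/(le_trans (ltW pr)) -> ->].
Qed.

Section Along.
Variables (D : set R) (u : R -> OplusM S) (eps : R).

Definition tube : set (OplusM S) := [set w | exists2 s, D s & exists2 l, conn (u s) w l & l < eps].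

Lemma tube_open : conn_open tube.
Proof.
move=> w [s Ds [l uw le]]; exists (eps - l); first by rewrite subr_gt0.
move=> y m wy me; exists s => //; exists (l + m); first exact: conn_trans uw wy.
by rewrite -ltrBrDl.
Qed.

Lemma sub_tube s : 0 < eps -> D s -> tube (u s).
Proof. by move=> eps0 Ds; exists s => //; exact: conn_refl. Qed.

(** The projection is a union of connected sets through [gamma s0]: the curve itself together with
    the projection of one short curve starting on its lift. That short curve projects into the image
    of the tube because its initial pieces are no longer than the whole. *)
Lemma tube_connected (gamma : R -> S) : 0 < eps -> is_interval D -> D !=set0 ->
  (forall t, D t -> Opi (u t) = gamma t) -> {within D, continuous gamma} ->
  connected (@Opi R S @` tube).
Proof.
move=> eps0 iD [s0 Ds0] ug gc.
have cD : connected (gamma @` D).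
  by apply: connected_continuous_connected gc; exact/connected_intervalP.
have Dtube : gamma @` D `<=` @Opi R S @` tube.
  by move=> _ [t Dt <-]; exists (u t); [exact: sub_tube|exact: ug].
have H w : tube w -> exists C : set S, [/\ connected C, C (gamma s0), C (Opi w) & C `<=` @Opi R S @` tube].
  move=> [s Ds [l /conn_arc[p [q [v [L [pq A vp vq lE]]]]] le]].
  have [[/subspace_continuousP vc _] _] := A.1.
  have cC : connected ((@Opi R S \o v) @` `[p, q]%classic).
    apply: connected_continuous_connected; first exact/connected_intervalP/interval_is_interval.
    exact/subspace_continuousP.
  have Ip : `[p, q]%classic p by rewrite /= in_itv /= lexx ltW.
  have Iq : `[p, q]%classic q by rewrite /= in_itv /= lexx ltW.
  exists (gamma @` D `|` (@Opi R S \o v) @` `[p, q]%classic); split.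
  - apply: connectedU => //; exists (gamma s); split; first by exists s.
    by exists p => //; rewrite /= vp ug.
  - by left; exists s0.
  - by right; exists q => //; rewrite /= vq.
  - move=> x [/Dtube//|[r + <-]]; rewrite /= in_itv /= => /andP[pr rq].
    exists (v r) => //; move: pr; rewrite le_eqVlt => /predU1P[<-|pr].
      by rewrite vp; exact: sub_tube.
    have [|m vm ml] := arc_prefix pq A (r := r); first by rewrite pr.
    exists s => //; exists m; first by rewrite -vp.
    by apply: le_lt_trans le; rewrite lE.
have -> : @Opi R S @` tube = \bigcup_(C in [set C : set S | [/\ connected C, C (gamma s0) & C `<=` @Opi R S @` tube]]) C.
  apply/seteqP; split => [_ [w /H[C [cC C0 Cw CW]] <-]|x [C [_ _ CW] Cx]]; last exact: CW.
  by exists C.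
apply: bigcup_connected; last by move=> C [].
by exists (gamma s0) => C [].
Qed.

End Along.

End Tube.

(** * Lengths along the lift near the end of the curve *)

Section Tail.
Context {R : realType} (S : spacetime R) (a : \bar R) (gamma : R -> S).
Notation D := (ico 0 a).

(* The generalised affine parameter bounds, up to a factor, the length of a lift of gamma to a
   parallel positive frame. *)
Lemma lift_small (a_gt0 : (0 < a)%E) : finite_gen_affine_length a gamma -> exists u : R -> OplusM S,
  [/\ forall t, D t -> Opi (u t) = gamma t,
      exists B, forall s t, D s -> D t -> exists2 l, conn (u s) (u t) l & l < B &
      forall eps, 0 < eps -> exists2 T, D T &
        forall s t, D s -> D t -> T <= s -> T <= t -> exists2 l, conn (u s) (u t) l & l < eps].
Proof.
move=> [e pe [l el]]; have [u [K [K0 ug uC uK]]] := positive_lift a_gt0 pe.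
have F s t (st : s < t) (Ds : D s) (Dt : D t) := affine_conn a_gt0 pe K0 uC uK Ds Dt st.
pose L := Lam a gamma e.
have Lmon s t : D s -> D t -> s <= t -> L s <= L t.
  move=> Ds Dt; rewrite le_eqVlt => /predU1P[->//|st].
  have [m /conn_ge0 m0 mL] := F s t st Ds Dt.
  by rewrite -subr_ge0 -(pmulr_rge0 _ K0); exact: le_trans mL.
(* Reduces both claims to an estimate for [s < t]: the relation is symmetric, and equal parameters
   are covered by [conn_refl]. P restricts the range of parameters. *)
have G eps : 0 < eps -> forall P : R -> Prop,
    (forall s t, D s -> D t -> P s -> P t -> s < t -> K * (L t - L s) < eps) ->
    forall s t, D s -> D t -> P s -> P t -> exists2 m, conn (u s) (u t) m & m < eps.
  move=> eps0 P H s t Ds Dt Ps Pt; case: (ltgtP s t) => [st|ts|->]; last exact: conn_refl.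
    have [m um mL] := F s t st Ds Dt; exists m => //.
    exact: le_lt_trans mL (H s t Ds Dt Ps Pt st).
  have [m um mL] := F t s ts Dt Ds; exists m; first exact: conn_sym.
  exact: le_lt_trans mL (H t s Dt Ds Pt Ps ts).
exists u; split=> [//||eps eps0].
  have [T DT HT] := Lam_cvg a_gt0 el (@ltr01 R).
  have LB t : D t -> L t < l + 1.
    move=> Dt; have DM : D (Num.max t T) by case: leP.
    apply: (@le_lt_trans _ _ (L (Num.max t T))); first by apply: Lmon; rewrite ?le_max ?lexx.
    have := HT _ DM; rewrite le_max lexx orbT => /(_ isT).
    by rewrite ltr_norml -/(L _) => /andP[_]; rewrite ltrBlDr addrC.
  (* [L] is nondecreasing and eventually below [l + 1], so it is below [l + 1] throughout, while
     [L 0] bounds it from below. *)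
  pose B := K * (l + 1 - L 0).
  have B0 : 0 < B by rewrite mulr_gt0// subr_gt0 LB.
  exists B => s t Ds Dt; apply: (G B B0 (fun _ => True)) => // {}s {}t {}Ds {}Dt _ _ _.
  by rewrite ltr_pM2l// ltr_leB// ?LB// Lmon//; case: Ds.
(* Both [L s] and [L t] deviate from l by less than this, and the length is at most K times their
   difference. *)
have e2 : 0 < eps / (2 * K) by rewrite divr_gt0// mulr_gt0.
have [T DT HT] := Lam_cvg a_gt0 el e2; exists T => // s t Ds Dt Ts Tt.
apply: (G eps eps0 (fun t => T <= t)) => // {}s {}t {}Ds {}Dt {}Ts {}Tt _.
have := HT s Ds Ts; have := HT t Dt Tt; rewrite -/(L s) -/(L t).
rewrite !ltr_norml => /andP[_ h1] /andP[h2 _].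
have h : L t - L s < eps / K.
  have -> : eps / K = eps / (2 * K) + eps / (2 * K) by field; rewrite gt_eqF.
  by move: h1 h2; move: (L t) (L s) (eps / _) => x y z h1 h2; lra.
by rewrite mulrC -ltr_pdivlMr.
Qed.

End Tail.

Lemma natural_dist_ge0 (R : realType) (S : spacetime R) bgl bR (x y : OplusM S) :
  (0 <= natural_dist bgl bR x y)%E.
Proof.
apply: le_ereal_inf_tmp => _ [s [t [u [_ _ _ _ ->]]]]; apply: integral_ge0 => r _.
by rewrite lee_fin; exact: sqrtr_ge0.
Qed.

(** The diameter is an extended real: points in [V n] exclude the value -oo of an empty supremum,
    and the uniform bound excludes +oo. Halving eps turns the weak bound into a strict one. *)
Lemma dist_diam_cvg0 (R : realType) (T : Type) (d : T -> T -> \bar R) (V : nat -> set T) :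
  (forall n, V n !=set0) -> (forall x y, 0 <= d x y)%E ->
  (forall eps : R, 0 < eps -> \forall n \near \oo, forall x y, V n x -> V n y -> (d x y <= eps%:E)%E) ->
  dist_diam d (V n) @[n --> \oo] --> 0%E.
Proof.
move=> V0 d0 H A [eps /= eps0 epsA].
have e2 : 0 < eps / 2 by rewrite divr_gt0.
apply: filterS (H _ e2) => n Hn; rewrite /=.
have le : (dist_diam d (V n) <= (eps / 2)%:E)%E.
  by apply: ge_ereal_sup => _ [x Vx [y Vy <-]]; exact: Hn.
have ge : (0 <= dist_diam d (V n))%E.
  have [x Vx] := V0 n; apply: le_trans (d0 x x) _; apply: ereal_sup_ubound.
  by exists x => //; exists x.
move: le ge; case: (dist_diam _ _) => [r| |] //; rewrite !lee_fin => re r0.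
by apply: epsA; rewrite /ball_ /= sub0r normrN ger0_norm//; lra.
Qed.

Theorem corollary2 (R : realType) (S : spacetime R) (U : set S) (U_open : open U)
    (a : \bar R) (a_gt0 : (0 < a)%E) (gamma : R -> S)
    (gamma_C1 : C1_curve (ico 0 a) gamma)
    (gamma_finite : finite_gen_affine_length a gamma)
    (gamma_noend : ~ (exists p, endpoint a gamma p))
    (gamma_U : gamma @` ico 0 a `<=` U)
    (t_ : nat -> R) (t_in : forall n, ico 0 a (t_ n))
    (t_cvg : (t_ n)%:E @[n --> \oo] --> a) :
  exists V : nat -> set (OplusM S), (forall n, open (V n)) /\
    forall d : OplusM S -> OplusM S -> \bar R, natural_distance_function d ->
    [/\ forall n, dist_bounded d (V n) /\ cauchy_incomplete d (closure (V n)),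
        forall n, singular_region (@Opi R S @` V n) /\
          gamma @` ico (t_ n) a `<=` @Opi R S @` V n &
        dist_diam d (V n) @[n --> \oo] --> 0%E].
Proof.
have [u [ug [B uB] ut]] := lift_small a_gt0 gamma_finite.
have subD n t : ico (t_ n) a t -> ico 0 a t.
  by move=> [tt ta]; split => //; apply: le_trans tt; case: (t_in n).
have tD n : ico (t_ n) a (t_ n) by split => //; case: (t_in n).
have tT T : ico 0 a T -> \forall n \near \oo, T <= t_ n.
  move=> [_ Ta]; have N : nbhs a [set x | (T%:E < x)%E].
    by apply: open_nbhs_nbhs; split => //; exact: open_ereal_gt_ereal.
  have H : \forall n \near \oo, (T%:E < (t_ n)%:E)%E := t_cvg _ N.
  by apply: filterS H => n; rewrite lte_fin => /ltW.
pose V n := tube (ico (t_ n) a) u n.+1%:R^-1.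
have uV n t : ico (t_ n) a t -> V n (u t) by exact: sub_tube.
exists V; split=> [n|d [bgl [bR ->]]]; first by apply: conn_open_open; exact: tube_open.
have [k [K [k0 K0 dK kd]]] := natural_dist_bounds S bgl bR.
have dle (x y : OplusM S) l b : conn x y l -> l <= b -> (natural_dist bgl bR x y <= (K * b)%:E)%E.
  move=> xy lb; apply: le_trans (dK x y l xy) _.
  by rewrite lee_fin ler_wpM2l// ltW.
(* Two points of the tube are joined through the lift: back to [u s], along to [u t], and out again.
   Each of the two outer curves is shorter than the radius of the tube. *)
have Vconn n b : (forall s t, ico (t_ n) a s -> ico (t_ n) a t -> exists2 l, conn (u s) (u t) l & l < b) ->
    forall x y, V n x -> V n y -> (natural_dist bgl bR x y <= (K * (n.+1%:R^-1 + n.+1%:R^-1 + b))%:E)%E.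
  move=> H x y [s Ds [l ux ln]] [t Dt [m uy mn]]; have [q uq qb] := H s t Ds Dt.
  apply: (dle _ _ _ _ (conn_trans (conn_trans (conn_sym ux) uq) uy)).
  by move: (n.+1%:R^-1) ln mn => z ln mn; lra.
split=> [n|n|].
- split.
    exists (K * (n.+1%:R^-1 + n.+1%:R^-1 + B)); apply: Vconn => s t Ds Dt.
    exact: uB (subD n s Ds) (subD n t Dt).
  (* The maximum keeps the parameters in the tail that defines [V n], whatever the order of the
     [t_ i], and still lets them tend to a. *)
  move=> compl; pose q i := Num.max (t_ n) (t_ i).
  have qn i : ico (t_ n) a (q i).
    split; first by rewrite le_max lexx.
    by rewrite /q; case: (leP (t_ n)) => _; [have [_] := t_in i|have [_] := t_in n].
  have qD i : ico 0 a (q i) by exact: subD (qn i).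
  have qT T : ico 0 a T -> \forall i \near \oo, T <= q i.
    by move=> /tT; apply: filterS => i Ti; rewrite le_max Ti orbT.
  have [|eps eps0|x _ xlim] := compl (u \o q).
  + by move=> i; apply: subset_closure; exact: uV.
  + have e1 : 0 < eps / K by rewrite divr_gt0.
    have [T DT HT] := ut _ e1; have [N _ HN] := qT T DT.
    exists N => i j /HN /= Ti /HN /= Tj.
    have [l ul le] := HT _ _ (qD i) (qD j) Ti Tj.
    apply: le_lt_trans (dK _ _ _ ul) _.
    by rewrite lte_fin mulrC -ltr_pdivlMr.
  apply: gamma_noend; exists (Opi x) => A NA.
  have [dl dl0 HA] := conn_lower NA.
  have dl2 : 0 < dl / 2 by rewrite divr_gt0.
  have [T DT HT] := ut _ dl2.
  (* The factor k is the one of [kd]: a distance below [k * (dl / 2)] yields a curve of length below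
     [dl / 2]. *)
  have N : nbhs 0%E [set y : \bar R | (y < (k * (dl / 2))%:E)%E].
    apply: open_nbhs_nbhs; split; first exact: open_ereal_lt_ereal.
    by rewrite /= lte_fin mulr_gt0.
  (* One index suffices: from [u t] to [u (q i)], and from there to x, each time by less than
     [dl / 2], for every t beyond T. *)
  have [i [Ti di]] : exists i, T <= q i /\ (natural_dist bgl bR (u (q i)) x < (k * (dl / 2))%:E)%E.
    have [i [Ti di]] := filter_ex (filterI (qT T DT) (xlim _ N)).
    by exists i.
  have [l xl] := kd _ _ _ di; rewrite ltr_pM2l// => ld.
  exists T => // t Dt /ltW Tt; rewrite -(ug t Dt).
  have [m um md] := HT _ _ Dt (qD i) Tt Ti.
  apply: (HA (u t) (m + l)); first exact: (conn_sym (conn_trans um xl)).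
  by lra.
- have sub : gamma @` ico (t_ n) a `<=` @Opi R S @` V n.
    by move=> _ [t Dt <-]; exists (u t); [exact: uV|exact: (ug t (subD n t Dt))].
  split=> //; apply: (singular_region_tail (t_in n) gamma_C1) => //.
    by apply: conn_open_proj; exact: tube_open.
  apply: (tube_connected (gamma := gamma)) => //.
  + by move=> x y Dx Dy z xzy; exact: (ico_interval Dx Dy).
  + by exists (t_ n).
  + by move=> t Dt; apply: ug; exact: subD Dt.
  + by apply: continuous_subspaceW gamma_C1.1 => t; exact: subD.
- apply: dist_diam_cvg0.
  + by move=> n; exists (u (t_ n)); exact: uV.
  + by move=> x y; exact: natural_dist_ge0.
  (* Three contributions are added up, two radii of the tube and the length along the tail of the
     lift, and all of them are multiplied by K. *)
  move=> eps eps0; have e3 : 0 < eps / K / 3 by rewrite !divr_gt0.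
  have [T DT HT] := ut _ e3.
  have Nn : \forall n \near \oo, n.+1%:R^-1 < eps / K / 3.
    exact: near_infty_natSinv_lt (PosNum e3).
  apply: filterS2 (tT T DT) Nn => n Tn ne x y Vx Vy.
  apply: le_trans (Vconn n (eps / K / 3) _ x y Vx Vy) _.
    move=> s t Ds Dt.
    exact: (HT s t (subD n s Ds) (subD n t Dt) (le_trans Tn Ds.1) (le_trans Tn Dt.1)).
  rewrite lee_fin mulrC -ler_pdivlMr//.
  by move: (eps / K) (n.+1%:R^-1) ne => z w ne; lra.
Qed.
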